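(* For every integer $n\ge 3$, the maximum number $r_2(n)$ of real embeddings in the plane among Laman graphs with $n$ vertices satisfies $$r_2(n)\;\ge\; 2^{(n-3)\bmod 7}\cdot 2\cdot 430^{\lfloor (n-3)/7\rfloor}.$$ The right-hand side grows asymptotically (up to constant factors) as $(430^{1/7})^{n}$, where $430^{1/7}\approx 2.378$.
   Context: All graphs are finite and simple. For a graph $G=(V,E)$ and edge lengths $\boldsymbol{\lambda}=(\lambda_e)_{e\in E}\in\mathbb{R}_{+}^{|E|}$, an embedding of $(G,\boldsymbol{\lambda})$ in $\mathbb{R}^d$ is a map $\rho:V\to\mathbb{R}^d$ with $\|\rho(a)-\rho(b)\|=\lambda_{ab}$ for every edge $ab\in E$ (injectivity is not required). Embeddings are counted modulo rigid motions, i.e. orientation-preserving isometries (rotations and translations) of $\mathbb{R}^d$; thus in $\mathbb{R}^2$ a generic non-degenerate triangle has $2$ embeddings. Let $r_d(G,\boldsymbol{\lambda})$ be the number of embeddings of $(G,\boldsymbol{\lambda})$ in $\mathbb{R}^d$ modulo rigid motions. $G$ is generically rigid in $\mathbb{R}^d$ if for edge lengths induced by any generic configuration of $|V|$ points in $\mathbb{R}^d$ the number of embeddings in $\mathbb{R}^d$ with the same edge lengths is finite modulo rigid motions; it is generically minimally rigid if in addition removing any edge yields a graph that is not generically rigid. A Laman graph is a generically minimally rigid graph in $\mathbb{R}^2$; equivalently, $|E|=2|V|-3$ and every subgraph $(V',E')$ with $|V'|\ge 2$ satisfies $|E'|\le 2|V'|-3$. For a Laman graph $G$, $r_2(G)$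 is the maximum of $r_2(G,\boldsymbol{\lambda})$ over all $\boldsymbol{\lambda}\in\mathbb{R}_+^{|E|}$ for which $r_2(G,\boldsymbol{\lambda})$ is finite. $r_2(n)$ is the maximum of $r_2(G)$ over all Laman graphs $G$ with $n$ vertices. The expression $(n-3)\bmod 7$ denotes the remainder in $\{0,\dots,6\}$. *)

(* Defs.v *)
From mathcomp Require Import all_boot all_order all_algebra.
From mathcomp Require Import all_classical all_reals all_analysis.
(* The notations of mpoly clash with those of MathComp-Analysis. *)
From mathcomp Require Import -(notations) mpoly.

Set Implicit Arguments.
Unset Strict Implicit.
Unset Printing Implicit Defensive.
Import Order.TTheory GRing.Theory Num.Theory.
Import numFieldNormedType.Exports.
Local Open Scope classical_set_scope.
Local Open Scope ring_scope.

Record sgraph (V : finType) := SGraph {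
  edges : {set {set V}};
  edges_card2 : [forall e in edges, #|e| == 2%N]
}.

Lemma del_edge_subproof (V : finType) (G : sgraph V) (e : {set V}) :
  [forall f in (edges G :\ e)%SET, #|f| == 2%N].
Proof.
apply/forall_inP => f /finset.setD1P [_ fG].
exact: (forall_inP (edges_card2 G)).
Qed.

Definition del_edge (V : finType) (G : sgraph V) (e : {set V}) : sgraph V :=
  SGraph (del_edge_subproof G e).

(* The library norm on ['rV[R]_d] is the sup norm, hence this definition. *)
Definition edist (R : realType) (d : nat) (x y : 'rV[R]_d) : R :=
  Num.sqrt (\sum_(i < d) (x ord0 i - y ord0 i) ^+ 2).

Definition rigid_motion (R : realType) (d : nat) :
    set ('rV[R]_d -> 'rV[R]_d) :=
  [set f | exists (A : 'M[R]_d) (b : 'rV[R]_d),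
     [/\ A *m A^T = 1%:M, \det A = 1 & f = fun x => x *m A + b]].

(* Edge lengths are given on all subsets of [V]; only the values on the edges
   of the graph are ever used. *)
Definition embeddings (R : realType) (d : nat) (V : finType) (G : sgraph V)
    (lam : {set V} -> R) : set (V -> 'rV[R]_d) :=
  [set rho | forall a b : V, [set a; b]%SET \in edges G ->
     edist (rho a) (rho b) = lam [set a; b]%SET].

Definition motion_class (R : realType) (d : nat) (V : finType)
    (rho : V -> 'rV[R]_d) : set (V -> 'rV[R]_d) :=
  [set f \o rho | f in @rigid_motion R d].

(* r_d(G, lam), equal to [+oo] when there are infinitely many classes. *)
Definition num_embeddings (R : realType) (d : nat) (V : finType)
    (G : sgraph V) (lam : {set V} -> R) : \bar R :=
  counting [set motion_class rho | rho in @embeddings R d V G lam].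

(* The |V| * d coordinates of p are algebraically independent over the
   rationals. *)
Definition generic_configuration (R : realType) (d : nat) (V : finType)
    (p : V -> 'rV[R]_d) : Prop :=
  forall P : mpoly #|{: V * 'I_d}| rat, P != 0 ->
    mmap (@ratr R)
      (fun k => p (enum_val k).1 ord0 (enum_val k).2) P != 0.

(* [embeddings G lam p] says that [lam] restricted to the edges is the edge
   length assignment induced by [p]. *)
Definition generically_rigid (R : realType) (d : nat) (V : finType)
    (G : sgraph V) : Prop :=
  forall (p : V -> 'rV[R]_d) (lam : {set V} -> R),
    generic_configuration p -> embeddings G lam p ->
    (num_embeddings d G lam < +oo)%E.

Definition generically_minimally_rigid (R : realType) (d : nat) (V : finType)
    (G : sgraph V) : Prop :=
  generically_rigid R d G /\
  forall e, e \in edges G -> ~ generically_rigid R d (del_edge G e).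

Definition laman (R : realType) (V : finType) (G : sgraph V) : Prop :=
  generically_minimally_rigid R 2 G.

(* Both maxima are taken in the extended reals, as least upper bounds, so that
   they are total; over sets of natural numbers, a least upper bound that is
   finite is attained. *)
Definition r2_graph (R : realType) (V : finType) (G : sgraph V) : \bar R :=
  ereal_sup [set num_embeddings 2 G lam | lam in
    [set lam : {set V} -> R | (forall e, e \in edges G -> 0 < lam e) /\
                              (num_embeddings 2 G lam < +oo)%E]].

Definition r2 (R : realType) (n : nat) : \bar R :=
  ereal_sup [set x | exists (V : finType) (G : sgraph V),
    [/\ #|V| = n, laman R G & x = r2_graph R G]].

Definition lower_bound (n : nat) : nat :=
  (2 ^ ((n - 3) %% 7) * 2 * 430 ^ ((n - 3) %/ 7))%N.

(* Main.v *)
(* A realization of the framework is called regular when the differential of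
   the map taking a configuration to its squared edge lengths and to the
   positions of two adjacent "pinned" vertices a, b is onto; there are as many
   constraints as coordinates, so this differential is then invertible.

   Finiteness. If p is generic and regular, and q has the same lengths and
   pins, then q is regular: any velocity of p extends to a derivation of a
   subring of R containing the coordinates of p and q, and differentiating the
   equations f(q) = f(p) shows that the differential at q is onto. Hence the
   fibre of p is discrete; it is compact, so finite. By the Newton-Kantorovich
   theorem, the length of any single edge can be varied while the others are
   kept, so that no edge can be deleted.

   Lower bound. Regular realizations persist under small perturbations of the
   lengths, so it is enough to count regular realizations for one choice of
   lengths, which is then perturbed to a generic one. Attaching k copies of a
   block of 7 vertices and m single vertices to a common triangle multiplies
   the numbers of realizations of the blocks, and reflection gives a factor 2.
   The block is the 10-vertex graph with 880 complex realizations, from which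
   a triangle is taken out; for the lengths chosen below, 430 of its real
   realizations with a fixed triangle are certified by Newton-Kantorovich from
   approximations computed in fixed-point arithmetic. *)

From Stdlib Require Import ZArith.
From HB Require Import structures.
Require Import Defs.
From mathcomp Require Import all_boot all_order all_algebra.
From mathcomp Require Import all_classical all_reals all_analysis.
From mathcomp Require Import -(notations) mpoly.
From mathcomp Require Import finmap ring lra zify ssrZ.

Set Implicit Arguments.
Unset Strict Implicit.
Unset Printing Implicit Defensive.
Import Order.TTheory GRing.Theory Num.Theory.
Import numFieldNormedType.Exports.
Local Open Scope classical_set_scope.
Local Open Scope ring_scope.

(** Distances enter only squared, so every constraint is a polynomial of degree at most two and its
    expansion at a point is exact. One bound on the quadratic part thus serves three times: to
    isolate the points of a fibre, to follow a regular realization when the lengths move, and to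
    certify the numerical approximations. Fixing two adjacent vertices replaces the quotient by
    rigid motions, because a rigid motion that fixes two distinct points is the identity. The
    lengths are perturbed to generic ones because [r2_graph] admits only lengths with finitely many
    classes, and the certified lengths could have further realizations in continuous families.
    Genericity yields finiteness, and positive lengths as well. In the transfer of regularity from p
    to q, algebraic independence is what allows the velocity of p to be arbitrary: it is chosen so
    that the constraints have prescribed derivatives, and the derivation carries these values over
    to q. The 430 realizations of the block and their mirror images account for 860 of the 880
    complex ones. *)

(* The instance [completeNormedModType] of matrices required by
   [banach_fixed_point] is not inferred from the library. *)
HB.instance Definition _ (R : realType) (m n : nat) :=
  Complete.copy 'M[R]_(m, n) 'M[R]_(m, n).

Lemma row_norm_le (R : realType) M (x : 'rV[R]_M) (a : R) :
  0 <= a -> (`|x| <= a) <-> forall i, `|x 0 i| <= a.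
Proof.
move=> a0; rewrite (_ : `|x| = mx_norm x)// mx_normrE; split.
  by move=> /bigmax_leP[_ xa] i; exact: (xa (0, i)).
move=> xa; apply/bigmax_leP; split => // -[i j] _ /=.
by rewrite (ord1 i).
Qed.

Lemma row_norm_coord (R : realType) M (x : 'rV[R]_M) i : `|x 0 i| <= `|x|.
Proof. by have /(row_norm_le x (normr_ge0 _)) := lexx `|x|. Qed.

(** The Newton step contracts only near the approximation, hence Banach's theorem on a closed ball
    instead of the whole space. *)
Lemma ball_fixpoint (R : realType) M (rho k : R) (f : 'rV[R]_M -> 'rV[R]_M) :
  0 <= rho -> 0 <= k < 1 -> (forall x, `|x| <= rho -> `|f x| <= rho) ->
  (forall x y, `|x| <= rho -> `|y| <= rho -> `|f x - f y| <= k * `|x - y|) ->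
  exists2 x, `|x| <= rho & x = f x.
Proof.
move=> rho0 /andP[k0 k1] fS fL.
pose U := [set x : 'rV[R]_M | `|x| <= rho].
have fU : {homo f : x / U x >-> U x} by [].
apply: (@banach_fixed_point R 'rV[R]_M U (mkfun fU)).
- exists (NngNum k0); split=> //= -[x y] [/= Ux Uy].
  exact: fL.
- rewrite (_ : U = (fun x : 'rV[R]_M => `|x|) @^-1` [set r | r <= rho]) //.
  apply: closed_comp => [x _|]; first exact: norm_continuous.
  exact: closed_le.
- by exists 0; rewrite /U /= normr0.
Qed.

(** * Pins and edge lengths as quadratic constraints *)

(* [inl (v, i)] stands for the i-th coordinate of v, and [inr (u, v)] for the
   squared distance between u and v. *)
Definition constr (V : Type) := (V * 'I_2 + V * V)%type.

Section Constraints.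
Variables (R : comNzRingType) (V : Type).
Implicit Types (p h : V -> 'rV[R]_2) (c : constr V).

Definition dot (x y : 'rV[R]_2) : R := x 0 0 * y 0 0 + x 0 1 * y 0 1.

Definition cval c p : R :=
  match c with
  | inl vi => p vi.1 0 vi.2
  | inr uv => dot (p uv.1 - p uv.2) (p uv.1 - p uv.2)
  end.

Definition cbil c h h' : R :=
  match c with
  | inl _ => 0
  | inr uv => dot (h uv.1 - h uv.2) (h' uv.1 - h' uv.2)
  end.

Definition cdiff c p h : R :=
  match c with
  | inl vi => h vi.1 0 vi.2
  | inr uv => 2 * dot (p uv.1 - p uv.2) (h uv.1 - h uv.2)
  end.

(** The exact Taylor expansion: degree at most two leaves no remainder beyond [cbil], the polar form
    of the quadratic part. *)
Lemma cval_add c p h :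
  cval c (fun v => p v + h v) = cval c p + cdiff c p h + cbil c h h.
Proof.
case: c => [[v i]|[u v]] /=; rewrite /dot !mxE; first by rewrite addr0.
by ring.
Qed.

Lemma cdiff_add c p d h :
  cdiff c (fun v => p v + d v) h = cdiff c p h + 2 * cbil c d h.
Proof.
by case: c => [[v i]|[u v]] /=; rewrite /dot ?mxE ?mulr0 ?addr0//; ring.
Qed.

(** The identity a^2 - b^2 = (a - b)(a + b) for a symmetric form; it makes the quadratic part
    Lipschitz with a small constant on a small ball. *)
Lemma cbil_sub c h h' :
  cbil c h h - cbil c h' h' =
  cbil c (fun v => h v - h' v) (fun v => h v + h' v).
Proof.
by case: c => [[v i]|[u v]] /=; rewrite /dot ?mxE ?subrr//; ring.
Qed.

(** In the applications [H j] is a velocity that changes constraint j at rate about 1 and the others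
    hardly at all, so that [y] is measured in the space of constraint values. *)
Definition lincomb M (H : 'I_M -> V -> 'rV[R]_2) (y : 'rV[R]_M) (v : V) :=
  \sum_j y 0 j *: H j v.

Lemma lincombB M (H : 'I_M -> V -> 'rV[R]_2) (y z : 'rV[R]_M) v :
  lincomb H (y - z) v = lincomb H y v - lincomb H z v.
Proof.
rewrite /lincomb -sumrB; apply: eq_bigr => j _.
by rewrite !mxE scalerBl.
Qed.

Lemma cdiff_lincomb c p M (H : 'I_M -> V -> 'rV[R]_2) (y : 'rV[R]_M) :
  cdiff c p (lincomb H y) = \sum_j y 0 j * cdiff c p (H j).
Proof.
case: c => [[v i]|[u v]] /=; rewrite /lincomb.
  by rewrite summxE; apply: eq_bigr => j _; rewrite !mxE.
rewrite /dot !mxE !summxE -!sumrB !mulr_sumr -big_split /= mulr_sumr.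
by apply: eq_bigr => j _; rewrite !mxE; ring.
Qed.

Lemma cdiff_lincombB c p M (H : 'I_M -> V -> 'rV[R]_2) (y z : 'rV[R]_M) :
  cdiff c p (lincomb H (y - z)) =
  cdiff c p (lincomb H y) - cdiff c p (lincomb H z).
Proof.
rewrite !cdiff_lincomb -sumrB; apply: eq_bigr => j _.
by rewrite !mxE mulrBl.
Qed.

End Constraints.

(** * Newton-Kantorovich theorem for quadratic constraints *)

Section NewtonKantorovich.
Variables (R : realType) (V : Type).
Implicit Types (p h : V -> 'rV[R]_2) (c : constr V).

(** The constant is 2 coordinates times (2a)(2b), a difference of two vectors costing a factor 2. *)
Lemma cbil_bound c h h' (a b : R) :
  (forall v k, `|h v 0 k| <= a) -> (forall v k, `|h' v 0 k| <= b) ->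
  `|cbil c h h'| <= 8 * a * b.
Proof.
move=> ha hb; case: c => [[v i]|[u v]] /=.
  rewrite normr0 -mulrA mulr_ge0// mulr_ge0//.
    by apply: le_trans (ha v i).
  by apply: le_trans (hb v i).
have K i : `|(h u - h v) 0 i * (h' u - h' v) 0 i| <= 4 * a * b.
  rewrite normrM (_ : 4 * a * b = (a + a) * (b + b)); last by ring.
  by apply: ler_pM => //; rewrite !mxE; apply: le_trans (ler_normB _ _) _;
    apply: lerD.
rewrite /dot; apply: le_trans (ler_normD _ _) _.
by have := K 0; have := K 1; lra.
Qed.

Lemma lincomb_bound M (H : 'I_M -> V -> 'rV[R]_2) (be : R) y v k :
  (forall v k, \sum_j `|H j v 0 k| <= be) ->
  `|lincomb H y v 0 k| <= be * `|y|.
Proof.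
move=> Hb; rewrite /lincomb summxE; apply: le_trans (ler_norm_sum _ _ _) _.
apply: le_trans (_ : \sum_j `|H j v 0 k| * `|y| <= _); last first.
  by rewrite -mulr_suml ler_wpM2r.
apply: ler_sum => j _; rewrite !mxE normrM mulrC ler_wpM2l//.
exact: row_norm_coord.
Qed.

(* Newton's method with the fixed approximate inverse [H] of the Jacobian,
   carried out in the space of residuals. *)
Lemma newton_kantorovich M (c : 'I_M -> constr V) p
    (H : 'I_M -> V -> 'rV[R]_2) (t : 'I_M -> R) (th be rho ep : R) :
  (forall i, \sum_j `|(i == j)%:R - cdiff (c i) p (H j)| <= th) ->
  (forall v k, \sum_j `|H j v 0 k| <= be) ->
  (forall i, `|cval (c i) p - t i| <= ep) ->
  0 <= th -> 0 <= be -> 0 <= rho -> th + 16 * be ^+ 2 * rho < 1 ->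
  th * rho + ep + 8 * be ^+ 2 * rho ^+ 2 <= rho ->
  exists y : 'rV[R]_M,
  [/\ `|y| <= rho,
      forall i, cval (c i) (fun v => p v + lincomb H y v) = t i &
      forall s : 'I_M -> R, exists z : 'rV[R]_M, forall i,
        cdiff (c i) (fun v => p v + lincomb H y v) (lincomb H z) = s i].
Proof.
move=> Hth Hbe Hep th0 be0 rho0 lt1 le_rho.
(* The row sums bound the sup-norm operator norm of the identity minus the Jacobian composed with
   [H]. *)
have defect (y : 'rV[R]_M) i : `|y 0 i - cdiff (c i) p (lincomb H y)| <= th * `|y|.
  have -> : y 0 i - cdiff (c i) p (lincomb H y) =
      \sum_j y 0 j * ((i == j)%:R - cdiff (c i) p (H j)).
    rewrite cdiff_lincomb [RHS](eq_bigr (fun j => y 0 j * (i == j)%:R -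
      y 0 j * cdiff (c i) p (H j))); last by move=> j _; rewrite mulrBr.
    rewrite sumrB; congr (_ - _); rewrite (bigD1 i)//= eqxx mulr1 big1 ?addr0//.
    by move=> j /negbTE; rewrite eq_sym => ->; rewrite mulr0.
  apply: le_trans (ler_norm_sum _ _ _) _.
  apply: le_trans (ler_wpM2r (normr_ge0 y) (Hth i)).
  rewrite mulr_suml; apply: ler_sum => j _; rewrite normrM mulrC ler_wpM2l//.
  exact: row_norm_coord.
(* The contraction constant: [th] from the linear defect, and 8 * be * (2 * be * rho) from the
   quadratic part through [cbil_sub]. *)
pose k := th + 16 * be ^+ 2 * rho.
have k0 : 0 <= k by rewrite addr_ge0// mulr_ge0// mulr_ge0// exprn_ge0.
pose f (y : 'rV[R]_M) : 'rV[R]_M :=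
  \row_i (y 0 i - (cval (c i) (fun v => p v + lincomb H y v) - t i)).
(* Three sources of error: the inexact inverse, the residual at [p], and the quadratic part. Each is
   matched with one term of the hypothesis on [rho]. *)
have fE y i : f y 0 i = (y 0 i - cdiff (c i) p (lincomb H y)) -
    (cval (c i) p - t i) - cbil (c i) (lincomb H y) (lincomb H y).
  by rewrite mxE cval_add; ring.
have linb (y : 'rV[R]_M) v j : `|y| <= rho -> `|lincomb H y v 0 j| <= be * rho.
  move=> yr; apply: le_trans (lincomb_bound _ _ _ Hbe) _.
  by rewrite ler_wpM2l.
have fS y : `|y| <= rho -> `|f y| <= rho.
  move=> yr; apply/row_norm_le => // i; rewrite fE.
  apply: le_trans le_rho; apply: le_trans (ler_normB _ _) _.
  apply: lerD; last first.
    rewrite (_ : 8 * _ * _ = 8 * (be * rho) * (be * rho)); last by ring.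
    by apply: cbil_bound => v j; exact: linb.
  apply: le_trans (ler_normB _ _) _; apply: lerD => //.
  apply: le_trans (defect _ _) _; by rewrite ler_wpM2l.
have fL x y : `|x| <= rho -> `|y| <= rho -> `|f x - f y| <= k * `|x - y|.
  move=> xr yr; apply/row_norm_le => [|i]; first by rewrite mulr_ge0.
  have -> : (f x - f y) 0 i =
      ((x - y) 0 i - cdiff (c i) p (lincomb H (x - y))) -
      (cbil (c i) (lincomb H x) (lincomb H x) -
       cbil (c i) (lincomb H y) (lincomb H y)).
    by rewrite mxE [(- f y) 0 i]mxE !fE cdiff_lincombB !mxE; ring.
  apply: le_trans (ler_normB _ _) _; rewrite /k [leRHS]mulrDl; apply: lerD => //.
  rewrite cbil_sub.
  rewrite (_ : 16 * _ * _ * _ = 8 * (be * `|x - y|) * (be * rho + be * rho));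
    last by ring.
  apply: cbil_bound => v j.
    by rewrite -lincombB; exact: lincomb_bound.
  by rewrite mxE; apply: le_trans (ler_normD _ _) _; apply: lerD; exact: linb.
have k01 : 0 <= k < 1 by rewrite k0.
have [y yr yf] := ball_fixpoint rho0 k01 fS fL.
exists y; split => // [i|s].
  have := congr1 (fun z : 'rV[R]_M => z 0 i) yf; rewrite mxE => E.
  by apply/eqP; rewrite -subr_eq0; apply/eqP; lra.
pose x v := p v + lincomb H y v.
pose S : 'rV[R]_M := \row_i s i.
(* Surjectivity of the differential at the solution found: a fixed point of [g] solves the linear
   system. Moving the base point by [lincomb H y] changes the differential by twice [cbil], so the
   same [k] bounds the defect there. *)
pose g (z : 'rV[R]_M) : 'rV[R]_M :=
  \row_i (z 0 i - cdiff (c i) x (lincomb H z)) + S.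
have gd (z : 'rV[R]_M) i : `|z 0 i - cdiff (c i) x (lincomb H z)| <= k * `|z|.
  rewrite /x cdiff_add opprD addrA; apply: le_trans (ler_normB _ _) _.
  rewrite /k [leRHS]mulrDl; apply: lerD => //; rewrite normrM ger0_norm//.
  rewrite (_ : 16 * _ * _ * _ = 2 * (8 * (be * rho) * (be * `|z|))); last by ring.
  rewrite ler_pM2l//; apply: cbil_bound => v j; first exact: linb.
  exact: lincomb_bound.
(* The radius solving [k * rho' + |S| = rho'], so that [g] maps the ball to itself. *)
pose rho' := `|S| / (1 - k).
have k1 : 0 < 1 - k by rewrite subr_gt0.
have rho'0 : 0 <= rho' by rewrite divr_ge0// ltW.
have rho'E : k * rho' + `|S| = rho'.
  have -> : `|S| = (1 - k) * rho' by rewrite /rho' mulrCA divff ?mulr1// gt_eqF.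
  by ring.
have gS z : `|z| <= rho' -> `|g z| <= rho'.
  move=> zr; rewrite -rho'E; apply: le_trans (ler_normD _ _) _; apply: lerD => //.
  apply/row_norm_le => [|i]; first by rewrite mulr_ge0.
  by rewrite mxE; apply: le_trans (gd _ _) _; rewrite ler_wpM2l.
have gL z z' : `|z| <= rho' -> `|z'| <= rho' -> `|g z - g z'| <= k * `|z - z'|.
  move=> _ _; apply/row_norm_le => [|i]; first by rewrite mulr_ge0.
  rewrite (_ : (g z - g z') 0 i =
    (z - z') 0 i - cdiff (c i) x (lincomb H (z - z'))) //.
  by rewrite cdiff_lincombB !mxE; ring.
have [z _ zg] := ball_fixpoint rho'0 k01 gS gL.
exists z => i; have := congr1 (fun w : 'rV[R]_M => w 0 i) zg.
by rewrite !mxE -/x => E; lra.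
Qed.

End NewtonKantorovich.

(** * Derivations extending a prescribed velocity of a generic point *)

(** Dual numbers: the pair (a, a') stands for a + a' eps with eps^2 = 0, and a' plays the role of
    the derivative of a. *)
Definition dual (R : Type) := (R * R)%type.

Section Dual.
Variable R : fieldType.

HB.instance Definition _ := GRing.Zmodule.on (dual R).

Definition dual_one : dual R := (1, 0).
Definition dual_mul (a b : dual R) : dual R :=
  (a.1 * b.1, a.1 * b.2 + a.2 * b.1).

Let mulA : associative dual_mul.
Proof. by move=> [a a'] [b b'] [c c']; congr pair => /=; ring. Qed.
Let mulC : commutative dual_mul.
Proof. by move=> [a a'] [b b']; congr pair => /=; ring. Qed.
Let mul1 : left_id dual_one dual_mul.
Proof. by move=> [a a']; congr pair => /=; ring. Qed.
Let mulD : left_distributive dual_mul +%R.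
Proof. by move=> [a a'] [b b'] [c c']; congr pair => /=; ring. Qed.
Let one_neq0 : dual_one != 0.
Proof. by apply/eqP => -[/eqP]; rewrite oner_eq0. Qed.

HB.instance Definition _ :=
  GRing.Zmodule_isComNzRing.Build (dual R) mulA mulC mul1 mulD one_neq0.

Lemma dual_mulE (a b : dual R) : a * b = (a.1 * b.1, a.1 * b.2 + a.2 * b.1).
Proof. by []. Qed.

Definition dre (a : dual R) : R := a.1.

Let dre_is_zmod : zmod_morphism dre. Proof. by []. Qed.
Let dre_is_monoid : monoid_morphism dre. Proof. by []. Qed.
HB.instance Definition _ := GRing.isZmodMorphism.Build (dual R) R dre dre_is_zmod.
HB.instance Definition _ :=
  GRing.isMonoidMorphism.Build (dual R) R dre dre_is_monoid.

Definition dinj (a : R) : dual R := (a, 0).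
Let dinj_is_zmod : zmod_morphism dinj.
Proof. by move=> a b; congr pair; rewrite /= subr0. Qed.
Let dinj_is_monoid : monoid_morphism dinj.
Proof. by split=> // a b; congr pair; rewrite /= mulr0 mul0r addr0. Qed.
HB.instance Definition _ :=
  GRing.isZmodMorphism.Build R (dual R) dinj dinj_is_zmod.
HB.instance Definition _ :=
  GRing.isMonoidMorphism.Build R (dual R) dinj dinj_is_monoid.

Lemma dual_mul_eq0 (a b : dual R) : dre a != 0 -> a * b = 0 -> b = 0.
Proof.
case: a b => [a a'] [b b'] /= a0 [/eqP]; rewrite mulf_eq0 (negbTE a0) => /eqP->.
by move=> /eqP; rewrite mulr0 addr0 mulf_eq0 (negbTE a0) => /eqP->.
Qed.

(** Taylor's formula at x + y eps, cut after the linear term because eps^2 = 0. *)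
Lemma horner_dual (g : {poly dual R}) (x y : R) :
  g.[(x, y) : dual R] = g.[dinj x] + ((0, y) : dual R) * g^`().[dinj x].
Proof.
elim/poly_ind: g => [|g c IH]; first by rewrite deriv0 !horner0 mulr0 addr0.
rewrite derivD derivM derivX derivC !hornerE IH.
have -> : (x, y) = dinj x + ((0, y) : dual R) :> dual R.
  by congr pair; rewrite /= ?addr0 ?add0r.
have e2 : ((0, y) : dual R) * (0, y) = 0.
  by rewrite dual_mulE /= !mul0r mulr0 addr0.
move: ((0, y) : dual R) (dinj x) (g.[dinj x]) (g^`().[dinj x]) e2.
move=> e a u v e2.
have -> : (u + e * v) * (a + e) + c =
  u * a + c + e * (u + v * a) + (e * e) * v by ring.
by rewrite e2; ring.
Qed.

(* A subring of the dual numbers that is the graph of a function is a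
   derivation defined on a subring of R. *)
Definition dual_graph (S : dual R -> Prop) :=
  [/\ S 1, (forall a b, S a -> S b -> S (a - b)),
      (forall a b, S a -> S b -> S (a * b)) &
      (forall a, S a -> dre a = 0 -> a = 0)].

Lemma dual_graph0 S : dual_graph S -> S 0.
Proof. by move=> [S1 SB _ _]; rewrite -(subrr 1); exact: SB. Qed.

Lemma dual_graphD S a b : dual_graph S -> S a -> S b -> S (a + b).
Proof.
move=> gS Sa Sb; have [_ SB _ _] := gS; rewrite -[b]opprK; apply: (SB) => //.
by rewrite -[- b]add0r; apply: (SB) => //; exact: dual_graph0.
Qed.

Lemma dual_graph_sum S (I : Type) (r : seq I) (F : I -> dual R) :
  dual_graph S -> (forall i, S (F i)) -> S (\sum_(i <- r) F i).
Proof.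
move=> gS SF; elim/big_ind: _ => //; first exact: dual_graph0.
by move=> a b; exact: dual_graphD.
Qed.

End Dual.

Section DualExtension.
Variables (R : numFieldType) (S : dual R -> Prop) (gS : dual_graph S).

Let pS (g : {poly dual R}) := forall i, S g`_i.

Let pSB f g : pS f -> pS g -> pS (f - g).
Proof. by have [_ SB _ _] := gS; move=> Sf Sg i; rewrite coefB; exact: SB. Qed.

Let pSM f g : pS f -> pS g -> pS (f * g).
Proof.
have [_ _ SM _] := gS; move=> Sf Sg i; rewrite coefM.
by apply: dual_graph_sum => // j; apply: (SM).
Qed.

Let pSC a : S a -> pS a%:P.
Proof. by move=> Sa i; rewrite coefC; case: ifP => // _; exact: dual_graph0. Qed.

Let pSX : pS 'X.
Proof.
have [S1 _ _ _] := gS => i; rewrite coefX; case: eqP => _ //.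
exact: dual_graph0.
Qed.

Let pSXn k : pS 'X^k.
Proof.
elim: k => [|k IH]; first by rewrite expr0; apply: pSC; case: gS.
by rewrite exprS; apply: pSM.
Qed.

Let pSderiv g : pS g -> pS g^`().
Proof.
move=> Sg i; rewrite coef_deriv.
have SM n : S (g`_i.+1 *+ n); last exact: SM.
elim: n => [|n IH]; first by rewrite mulr0n; exact: dual_graph0.
by rewrite mulrS; apply: dual_graphD => //; exact: Sg.
Qed.

Let re (g : {poly dual R}) := map_poly (@dre R) g.

Let re_eq0 g : pS g -> re g = 0 -> g = 0.
Proof.
have [_ _ _ S0] := gS; move=> Sg g0; apply/polyP => i; rewrite coef0.
apply: S0 => //; have := congr1 (fun h : {poly R} => h`_i) g0.
by rewrite coef_map coef0.
Qed.

Let size_re g : pS g -> size (re g) = size g.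
Proof.
move=> Sg; have [->|g0] := eqVneq g 0; first by rewrite /re rmorph0 !size_poly0.
apply: size_map_poly_id0; apply/eqP => l0.
have [_ _ _ S0] := gS.
by move/eqP: g0; apply; apply/eqP; rewrite -lead_coef_eq0 (S0 _ _ l0)//; exact: Sg.
Qed.

Let extension (z : dual R) : dual R -> Prop := fun a => exists2 g, pS g & a = g.[z].

Let extension_graph z : (forall g, pS g -> (re g).[dre z] = 0 -> g.[z] = 0) ->
  dual_graph (extension z).
Proof.
move=> H; have [S1 _ _ _] := gS; split.
- by exists 1; [rewrite -[1]/(1%:P); exact: pSC|rewrite hornerC].
- by move=> _ _ [f Sf ->] [g Sg ->]; exists (f - g); [exact: pSB|rewrite !hornerE].
- by move=> _ _ [f Sf ->] [g Sg ->]; exists (f * g); [exact: pSM|rewrite hornerM].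
- by move=> _ [g Sg ->]; rewrite -horner_map; exact: H.
Qed.

(** Extension of a derivation by one element in characteristic 0. A derivative [y] of [x] is
    admissible when every polynomial over [S] that vanishes at [x] in its real part vanishes at (x,
    y); adjoining (x, y) to [S] then still gives the graph of a function. *)
Lemma dual_graph_extend (x : R) : exists (y : R) (S' : dual R -> Prop),
  [/\ dual_graph S', (forall a, S a -> S' a) & S' (x, y)].
Proof.
suff [y Hy] : exists y : R,
    forall g, pS g -> (re g).[x] = 0 -> g.[(x, y) : dual R] = 0.
  exists y, (extension (x, y)); split; first exact: extension_graph.
    by move=> a Sa; exists a%:P; [exact: pSC|rewrite hornerC].
  by exists 'X => //; rewrite hornerX.
(* Transcendental case: the condition on [y] is vacuous apart from the zero polynomial, and 0 is
   taken. *)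
have [H|] := pselect (forall g, pS g -> (re g).[x] = 0 -> g = 0).
  by exists 0 => g Sg g0; rewrite (H g)// horner0.
move=> /existsNP[g1 /not_implyP[Sg1 /not_implyP[g1x /eqP g1n0]]].
(* Algebraic case: a nonzero polynomial of least size plays the role of the minimal polynomial. [S]
   is only a ring, so it cannot be made monic. *)
pose Q n := `[< exists g, [/\ pS g, (re g).[x] = 0, g != 0 & size g = n] >].
have exQ : exists n, Q n by exists (size g1); apply/asboolP; exists g1.
have [n /asboolP[g0 [Sg0 g0x g0n0 <-]] minn] := ex_minnP exQ.
have reg0 : re g0 != 0 by apply: contraNneq g0n0 => /re_eq0 ->.
(* Separability: in characteristic 0 the derivative is a nonzero polynomial over [S] of smaller
   size, which by minimality cannot vanish at [x]. *)
have dg0 : (re g0)^`().[x] != 0.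
  have rE : (re g0)^`() = re g0^`() by rewrite /re deriv_map.
  have sg : (1 < size (re g0))%N.
    rewrite ltnNge; apply/negP => /size1_polyC E; move: g0x reg0.
    by rewrite E hornerC => ->; rewrite eqxx.
  apply/eqP; rewrite rE => d0.
  have dn0 : g0^`() != 0.
    apply/eqP => E; have := congr1 (fun h : {poly R} => h`_(size (re g0)).-2) rE.
    rewrite E /re rmorph0 coef0 coef_deriv.
    rewrite (_ : (size (re g0)).-2.+1 = (size (re g0)).-1); last first.
      by case: (size _) sg => [|[]].
    move/eqP; rewrite -mulr_natr mulf_eq0 pnatr_eq0.
    rewrite -[_`_ _ == 0]/(lead_coef (re g0) == 0).
    by rewrite lead_coef_eq0 (negbTE reg0)/=; case: (size _) sg => [|[]].
  have : (size g0 <= size g0^`())%N.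
    by apply: minn; apply/asboolP; exists g0^`(); split => //; exact: pSderiv.
  by rewrite leqNgt lt_size_deriv.
pose z y : dual R := (x, y).
(* By [horner_dual] this is the only value for which the second component of [g0] at (x, y) is
   zero. *)
exists (- (g0.[dinj x]).2 / (re g0)^`().[x]).
set y := (- _ / _).
have g0z : g0.[z y] = 0.
  rewrite horner_dual; congr pair => /=.
    by rewrite mul0r addr0 -[_.1]/(dre _) -horner_map.
  rewrite mul0r add0r -[(g0^`().[_]).1]/(dre _) -horner_map/= -/(re _).
  by rewrite [re _]/re -deriv_map -/(re _) divfK// subrr.
move=> g; have [k] := ubnP (size g); elim: k g => // k IH g sg Sg gx.
have [->|gn0] := eqVneq g 0; first by rewrite horner0.
have s0 : (size g0 <= size g)%N by apply: minn; apply/asboolP; exists g.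
have S0 : S (lead_coef g0) by exact: Sg0.
have S1 : S (lead_coef g) by exact: Sg.
(* One step of pseudo-division by [g0]: the leading terms cancel. By induction [g2] vanishes at (x,
   y), hence so does [lead_coef g0] times [g], and this factor can be cancelled because its real
   part is nonzero. *)
pose g2 := (lead_coef g0)%:P * g - (lead_coef g)%:P * 'X^(size g - size g0) * g0.
have Sg2 : pS g2.
  by apply: pSB; apply: pSM => //; [exact: pSC|apply: pSM => //; exact: pSC].
have sz2 : (size g2 < size g)%N.
  have gs0 : (0 < size g)%N by rewrite size_poly_gt0.
  rewrite -(prednK gs0) ltnS; apply/leq_sizeP => j; rewrite leq_eqVlt.
  case/orP => [/eqP <-|jg].
    rewrite coefB -mulrA !coefCM coefXnM.
    rewrite ifF; last first.
      apply/negbTE; rewrite -leqNgt.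
      by rewrite -ltnS (prednK gs0) ltn_subrL size_poly_gt0 g0n0 gs0.
    rewrite (_ : (_ - _)%N = (size g0).-1); last first.
      have : (0 < size g0)%N by rewrite size_poly_gt0.
      move: s0 gs0; case: (size g) => // a; case: (size g0) => // b.
      by rewrite !ltnS /= subSS => ab _ _; rewrite subKn.
    by rewrite -!lead_coefE mulrC subrr.
  have {}jg : (size g <= j)%N by rewrite -(prednK gs0).
  rewrite coefB -mulrA !coefCM coefXnM nth_default// mulr0.
  case: ifP; rewrite ?mulr0 ?subr0// => /negbT; rewrite -leqNgt => jk.
  rewrite nth_default ?mulr0 ?subr0//.
  by rewrite leq_subRL// subnK.
have g2x : (re g2).[x] = 0.
  rewrite /re /g2 rmorphB !rmorphM /= -!/(re _) !hornerE gx g0x.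
  by rewrite !mulr0 subr0.
have := IH g2 (leq_trans sz2 sg) Sg2 g2x.
rewrite /g2 !hornerE -/(z y) g0z mulr0 subr0 => /dual_mul_eq0; apply.
rewrite -[dre _]/(dre (lead_coef g0)).
have -> : dre (lead_coef g0) = lead_coef (re g0).
  by rewrite !lead_coefE size_re// coef_map.
by rewrite lead_coef_eq0.
Qed.

End DualExtension.

Lemma dual_graph_extend_seq (R : numFieldType) (S : dual R -> Prop) (s : seq R) :
  dual_graph S -> exists S' : dual R -> Prop,
  [/\ dual_graph S', (forall a, S a -> S' a) &
      forall x, x \in s -> exists y, S' (x, y)].
Proof.
elim: s S => [|x s IH] S gS; first by exists S.
have [y [S1 [gS1 SS1 S1x]]] := dual_graph_extend gS x.
have [S2 [gS2 S12 S2s]] := IH _ gS1.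
exists S2; split => // [a /SS1/S12 //|w].
by rewrite inE => /orP[/eqP->|/S2s//]; exists y; exact: S12.
Qed.

(** The starting ring consists of the rational polynomials evaluated at p + dp eps. It is the graph
    of a function because a polynomial whose real part vanishes at [p] is zero by algebraic
    independence; hence [dp] may be arbitrary. The elements of [s] are then adjoined one at a
    time. *)
Lemma generic_derivation (R : realType) n (p dp : 'I_n -> R) (s : seq R) :
  (forall P : mpoly n rat, P != 0 -> mmap (@ratr R) p P != 0) ->
  exists S : dual R -> Prop,
  [/\ dual_graph S, (forall k, S (p k, dp k)) &
      forall x, x \in s -> exists y, S (x, y)].
Proof.
move=> gen; pose f := (@dinj R) \o (@ratr R).
pose v k : dual R := (p k, dp k).
pose S0 (a : dual R) := exists P : mpoly n rat, a = mmap f v P.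
have gS0 : dual_graph S0.
  split.
  - by exists 1; rewrite rmorph1.
  - by move=> _ _ [P ->] [Q ->]; exists (P - Q); rewrite rmorphB.
  - by move=> _ _ [P ->] [Q ->]; exists (P * Q); rewrite rmorphM.
  - move=> _ [P ->] P0; have [->|/gen/negP[]] := eqVneq P 0; first by rewrite rmorph0.
    rewrite -P0; apply/eqP; rewrite /mmap rmorph_sum; apply: eq_bigr => m _.
    rewrite rmorphM /=; congr (_ * _); rewrite /mmap1 rmorph_prod.
    by apply: eq_bigr => i _; rewrite rmorphXn.
have [S [gS SS0 Ss]] := dual_graph_extend_seq s gS0.
exists S; split => // k; apply: SS0; exists (mpolyX _ (mnm1 k)).
by rewrite mmapX mmap1U.
Qed.

(** * Density of generic points *)

Lemma finite_poly_roots (R : idomainType) (q : {poly R}) : q != 0 ->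
  finite_set [set y | root q y].
Proof.
have [n] := ubnP (size q); elim: n q => // n IH q sq q0.
have [[r rq]|nr] := pselect (exists r, root q r); last first.
  rewrite (_ : [set y | root q y] = set0) //.
  by apply/seteqP; split => // y qy; apply: nr; exists y.
have [q1 E] := factor_theorem _ _ rq.
have q10 : q1 != 0 by apply: contraNneq q0 => q10; rewrite E q10 mul0r.
rewrite (_ : [set y | root q y] = [set r] `|` [set y | root q1 y]).
  rewrite finite_setU; split; first exact: finite_set1.
  by apply: IH => //; move: sq; rewrite E size_Mmonic ?monicXsubC// size_XsubC addn2 /=.
apply/seteqP; split => y /=; rewrite E rootM root_XsubC.
  by move=> /orP[|/eqP]; [right|left].
by move=> [->|->]; rewrite ?eqxx ?orbT.
Qed.

Lemma mmap_muni (R : comNzRingType) (K : nzRingType) (f : {rmorphism K -> R}) n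
    (x : 'I_n.+1 -> R) (P : mpoly n.+1 K) :
  mmap f x P = (map_poly (mmap f (fun i => x (widen_ord (leqnSn n) i)))
                  (muni P)).[x ord_max].
Proof.
rewrite muniE rmorph_sum /= horner_sum; apply: eq_bigr => m _.
rewrite -[_ *: 'X^_]mul_polyC rmorphM /= map_polyC /= map_polyXn !hornerE.
rewrite mmapZ mmapX -mulrA; congr (_ * _).
rewrite /mmap1 big_ord_recr /=; congr (_ * _).
by apply: eq_bigr => i _; rewrite mnmE.
Qed.

(** A monomial is determined by its last exponent and by the others, so each coefficient of [P] can
    be read off from [muni P]. *)
Lemma muni_neq0 (K : nzRingType) n (P : mpoly n.+1 K) : P != 0 -> muni P != 0.
Proof.
move=> P0; apply/eqP => E.
have [m0 Pm0] : exists m, mcoeff m P != 0.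
  apply/not_existsP => H; move/eqP: P0; apply; apply/mpolyP => m.
  by rewrite mcoeff0; apply/eqP; apply: contrapT => /negP; exact: H.
have m0P : m0 \in msupp P by rewrite mcoeff_msupp.
move/eqP: Pm0; apply.
have := congr1 (fun q : {poly mpoly n K} => mcoeff (Multinom
  [tuple m0 (widen_ord (leqnSn n) i) | i < n]) q`_(m0 ord_max)) E.
rewrite muniE coef0 mcoeff0 coef_sum raddf_sum /= (bigD1_seq m0) ?msupp_uniq//=.
rewrite big1 => [|m mm0].
  by rewrite addr0 coefZ coefXn eqxx mulr1 mcoeffZ mcoeffX eqxx mulr1.
rewrite coefZ coefXn; case: eqP => [e|]; last by rewrite mulr0 mcoeff0.
rewrite mulr1 mcoeffZ mcoeffX; case: eqP => [/mnmP e'|]; last by rewrite mulr0.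
case/eqP: mm0; apply/mnmP => i.
have [j ->|->] := unliftP ord_max i; last by rewrite e.
have := e' j; rewrite !mnmE => {}e'; rewrite (_ : lift _ _ = widen_ord (leqnSn n) j)//.
by apply/val_inj => /=; rewrite /bump leqNgt ltn_ord.
Qed.

Lemma mpoly0_neq0 (R : comNzRingType) (K : nzRingType) (f : {rmorphism K -> R})
    (x : 'I_0 -> R) (P : mpoly 0 K) : injective f -> P != 0 -> mmap f x P != 0.
Proof.
move=> finj P0.
have allm (m : multinom 0) : m = mnm0 by apply/mnmP => -[].
have PE : P = mpolyC 0 (mcoeff mnm0 P).
  by apply/mpolyP => m; rewrite mcoeffC (allm m) eqxx mulr1.
rewrite PE mmapC; apply: contra_neq P0 => f0; rewrite PE.
by rewrite (_ : mcoeff _ _ = 0) ?mpolyC0//; apply: finj; rewrite f0 rmorph0.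
Qed.

(** The coordinates are chosen one after the other. Once the first n are independent, each nonzero
    polynomial excludes finitely many values of the last one. There are countably many polynomials,
    and an interval of positive measure is not covered by a countable set. *)
Lemma generic_dense (R : realType) n (x0 : 'I_n -> R) (e : R) : 0 < e ->
  exists x : 'I_n -> R, (forall k, `|x k - x0 k| < e) /\
    forall P : mpoly n rat, P != 0 -> mmap (@ratr R) x P != 0.
Proof.
move=> e0; elim: n x0 => [|n IH] x0.
  by exists x0; split => [[]//|P]; exact/mpoly0_neq0/fmorph_inj.
have [x [xx0 xgen]] := IH (fun i => x0 (widen_ord (leqnSn n) i)).
(* Lists of terms form a countable type that maps onto all rational polynomials, so the union of
   root sets is indexed by them. *)
pose F (s : seq (multinom n.+1 * rat)) : mpoly n.+1 rat :=
  \sum_(mc <- s) mc.2 *: mpolyX rat mc.1.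
have Fsurj P : exists s, F s = P.
  exists [seq (m, mcoeff m P) | m <- msupp P].
  by rewrite /F big_map [RHS]mpolyE.
pose q (P : mpoly n.+1 rat) := map_poly (mmap (@ratr R) x) (muni P).
have q0 P : P != 0 -> q P != 0.
  move=> /muni_neq0; apply: contra_neq => qP0; apply/polyP => i; rewrite coef0.
  apply: contrapT => /eqP /xgen/eqP; apply.
  by have := congr1 (fun h : {poly R} => h`_i) qP0; rewrite coef_map coef0.
pose bad := \bigcup_(s in [set s | F s != 0]) [set y | root (q (F s)) y].
have cbad : countable bad.
  apply: bigcup_countable; first exact: countableP.
  by move=> s /q0 s0; apply/finite_set_countable/finite_poly_roots.
pose c := x0 ord_max.
have [y [yc ybad]] : exists y, `|y - c| < e /\ ~ bad y.
  apply/not_existsP => H.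
  have sub : `]c - e, c + e[%classic `<=` bad.
    move=> y /=; rewrite in_itv /= => /andP[cy yc].
    by apply: contrapT => nb; apply: (H y); split => //; apply/ltr_normlP; split; lra.
  have := countable_lebesgue_measure0 (sub_countable (subset_card_le sub) cbad).
  rewrite lebesgue_measure_itv /= lte_fin ifT; last by lra.
  by rewrite -EFinB => -[]; lra.
exists (fun i => if unlift ord_max i is Some j then x j else y); split.
  move=> i; case: unliftP => [j ->|->]; last exact: yc.
  rewrite (_ : lift _ _ = widen_ord (leqnSn n) j)//.
  by apply/val_inj => /=; rewrite /bump leqNgt ltn_ord.
move=> P P0; rewrite mmap_muni unlift_none.
rewrite (_ : (fun i => _) = x); last first.
  apply/funext => i; case: unliftP => [j|] E.
    by congr x; apply/val_inj; have := congr1 val E; rewrite /= /bump leqNgt ltn_ord.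
  by have := congr1 val E; rewrite /= => En; have := ltn_ord i; rewrite En ltnn.
have [s sP] := Fsurj P; apply/negP => root0; apply: ybad.
by exists s; rewrite /= sP.
Qed.

(** * Regular realizations and finiteness of fibres *)

Section Regular.
Variables (R : realType) (V : finType).
Implicit Types (p q h : V -> 'rV[R]_2) (c : constr V) (cs : seq (constr V)).

Definition regular cs q := forall t : constr V -> R,
  exists h, forall c, c \in cs -> cdiff c q h = t c.

(** A constraint evaluated by ring operations at the dual point q + h eps has its value as real part
    and its differential as second part. *)
Lemma dual_graph_constr (S : dual R -> Prop) q h c : dual_graph S ->
  (forall v i, S (q v 0 i, h v 0 i)) -> S (cval c q, cdiff c q h).
Proof.
move=> gS Sq; case: c => [[v i]|[u v]] /=; first exact: Sq.
have [_ SB SM _] := gS.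
have D i : S ((q u - q v) 0 i, (h u - h v) 0 i).
  by rewrite !mxE; exact: (SB _ _ (Sq u i) (Sq v i)).
have := dual_graphD gS (SM _ _ (D 0) (D 0)) (SM _ _ (D 1) (D 1)).
set x := (X in S X -> _); suff -> : (dot (q u - q v) (q u - q v),
  2 * dot (q u - q v) (h u - h v)) = x by [].
by apply: injective_projections; rewrite /x !dual_mulE /dot /=; ring.
Qed.

Lemma regular_transfer cs p q : generic_configuration p -> regular cs p ->
  (forall c, c \in cs -> cval c q = cval c p) -> regular cs q.
Proof.
move=> gen reg pq t; have [dp dpt] := reg t.
have [S [gS Sp Sq]] := generic_derivation
  (fun k => dp (enum_val k).1 0 (enum_val k).2)
  [seq q vi.1 0 vi.2 | vi <- enum {: V * 'I_2}] gen.
have {}Sp v i : S (p v 0 i, dp v 0 i).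
  by have := Sp (enum_rank (v, i)); rewrite enum_rankK.
have {}Sq vi : exists y, S (q vi.1 0 vi.2, y).
  by apply: Sq; apply/mapP; exists vi; rewrite ?mem_enum.
have [dq Sdq] := choice Sq.
exists (fun v => \row_i dq (v, i)) => c ccs.
have Sq' v i : S (q v 0 i, (\row_j dq (v, j)) 0 i).
  by rewrite mxE; exact: (Sdq (v, i)).
have [_ SB _ S0] := gS.
(* Both dual values lie in [S] and have the same real part. Their difference is therefore zero, and
   the velocity [dq] of [q] has the derivative prescribed for [dp]. *)
have := S0 _ (SB _ _ (dual_graph_constr c gS Sq') (dual_graph_constr c gS Sp)).
rewrite /dre /= (pq c ccs) subrr => /(_ erefl) [_ /eqP].
by rewrite subr_eq0 (dpt c ccs) => /eqP.
Qed.

End Regular.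

Section Square.
Variable V : finType.
Let N := #|{: V * 'I_2}|.
Variable cs : seq (constr V).
Hypotheses (cs_uniq : uniq cs) (cs_size : size cs = N).

Definition bconf (K : nzRingType) (k : 'I_N) (v : V) : 'rV[K]_2 :=
  \row_i ((v, i) == enum_val k)%:R.

Definition conf (K : nzRingType) (y : 'rV[K]_N) (v : V) : 'rV[K]_2 :=
  \row_i y 0 (enum_rank (v, i)).

Definition coords (K : nzRingType) (q : V -> 'rV[K]_2) : 'rV[K]_N :=
  \row_k q (enum_val k).1 0 (enum_val k).2.

Lemma coordsK (K : nzRingType) (q : V -> 'rV[K]_2) : conf (coords q) =1 q.
Proof. by move=> v; apply/rowP => i; rewrite !mxE enum_rankK. Qed.

Lemma confK (K : nzRingType) (y : 'rV[K]_N) : coords (conf y) = y.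
Proof. by apply/rowP => k; rewrite !mxE -surjective_pairing enum_valK. Qed.

Lemma lincomb_bconf (K : comNzRingType) (q : V -> 'rV[K]_2) :
  lincomb (@bconf K) (coords q) =1 q.
Proof.
move=> v; apply/rowP => i; rewrite /lincomb summxE.
rewrite (bigD1 (enum_rank (v, i)))//= big1 ?addr0 => [|k kv].
  by rewrite !mxE enum_rankK eqxx mulr1.
rewrite !mxE; case: eqP => [e|]; last by rewrite mulr0.
by rewrite e enum_valK eqxx in kv.
Qed.

Definition cidx (i : 'I_N) : constr V := tnth (Tuple (introT eqP cs_size)) i.

Lemma cidx_mem i : cidx i \in cs.
Proof. exact: mem_tnth. Qed.

Lemma mem_cidx c : c \in cs -> exists i, c = cidx i.
Proof. by move=> ccs; apply/tnthP; exact: ccs. Qed.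

Lemma cidx_inj : injective cidx.
Proof. by apply/tuple_uniqP. Qed.

(** The transposed Jacobian, since velocities are row vectors multiplied on the left. The ring is
    left general so that it can also be formed over polynomials. *)
Definition cmx (K : comNzRingType) (q : V -> 'rV[K]_2) : 'M[K]_N :=
  \matrix_(k, i) cdiff (cidx i) q (@bconf K k).

Lemma cdiff_ext (K : comNzRingType) (W : Type) (c : constr W)
    (q q' h h' : W -> 'rV[K]_2) : q =1 q' -> h =1 h' ->
  cdiff c q h = cdiff c q' h'.
Proof. by move=> E E'; case: c => [[v i]|[u v]] /=; rewrite ?E ?E'. Qed.

Lemma cval_ext (K : comNzRingType) (W : Type) (c : constr W)
    (q q' : W -> 'rV[K]_2) : q =1 q' -> cval c q = cval c q'.
Proof. by move=> E; case: c => [[v i]|[u v]] /=; rewrite ?E. Qed.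

Lemma coords_cmx (K : comNzRingType) (q h : V -> 'rV[K]_2) i :
  (coords h *m cmx q) 0 i = cdiff (cidx i) q h.
Proof.
rewrite mxE -(cdiff_ext (cidx i) (frefl q) (lincomb_bconf h)).
by rewrite cdiff_lincomb; apply: eq_bigr => k _; rewrite [cmx q k i]mxE.
Qed.

Lemma regularE (R : realType) (q : V -> 'rV[R]_2) :
  regular cs q <-> \det (cmx q) != 0.
Proof.
split=> [reg|]; last first.
  rewrite -unitfE -unitmxE => u t.
  pose y := (\row_i t (cidx i)) *m invmx (cmx q).
  exists (conf y) => c /mem_cidx[i ->].
  by rewrite -coords_cmx confK mulmxKV// mxE.
suff [B BA] : exists B : 'M[R]_N, B *m cmx q = 1%:M.
  have := congr1 determinant BA; rewrite det_mulmx det1.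
  by apply: contra_eq_neq => ->; rewrite mulr0 eq_sym oner_eq0.
(* Preimages of the unit vectors are the rows of a left inverse. *)
have /choice[H Ht] : forall i : 'I_N, exists h : V -> 'rV[R]_2,
    forall j, cdiff (cidx j) q h = (i == j)%:R.
  move=> i; have [h ht] := reg (fun c => (c == cidx i)%:R).
  exists h => j; rewrite ht ?cidx_mem//; congr (_%:R).
  by rewrite (inj_eq cidx_inj) eq_sym.
exists (\matrix_i coords (H i)); apply/matrixP => i j.
rewrite !mxE -Ht -coords_cmx !mxE.
by apply: eq_bigr => k _; rewrite !mxE.
Qed.

Lemma cdiff_map (K L : comNzRingType) (f : {rmorphism K -> L}) c
    (q h : V -> 'rV[K]_2) :
  f (cdiff c q h) = cdiff c (fun v => map_mx f (q v)) (fun v => map_mx f (h v)).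
Proof.
case: c => [[v i]|[u v]] /=; first by rewrite mxE.
by rewrite /dot !mxE rmorphM rmorph_nat rmorphD !rmorphM !rmorphB.
Qed.

(** The Jacobian determinant is one rational polynomial in the coordinates. Being nonzero at [p0],
    it is a nonzero polynomial, and so does not vanish at a generic point. *)
Lemma generic_regular (R : realType) (p p0 : V -> 'rV[R]_2) :
  generic_configuration p -> regular cs p0 -> regular cs p.
Proof.
move=> gen /regularE reg0; apply/regularE.
pose X (v : V) : 'rV[mpoly N rat]_2 :=
  \row_i mpolyX rat (mnm1 (enum_rank (v, i))).
pose f (q : V -> 'rV[R]_2) := mmap (@ratr R) (fun k => coords q 0 k).
have fX q : f q (\det (cmx X)) = \det (cmx q).
  rewrite /f -det_map_mx /=; congr determinant; apply/matrixP => k i.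
  rewrite !mxE cdiff_map; apply: cdiff_ext => v; apply/rowP => j; rewrite !mxE.
    by rewrite /= mmapX mmap1U !mxE enum_rankK.
  by rewrite rmorph_nat.
rewrite -fX /f (_ : (fun k => coords p 0 k) =
  fun k => p (enum_val k).1 ord0 (enum_val k).2); last first.
  by apply/funext => k; rewrite mxE.
by apply: gen; apply: contra_neq reg0 => d0; rewrite -fX d0 /f rmorph0.
Qed.

Lemma finite_fiber (R : realType) (t : constr V -> R) (C : R) :
  let K := [set q : V -> 'rV[R]_2 | forall c, c \in cs -> cval c q = t c] in
  (forall q, K q -> forall v i, `|q v 0 i| <= C) ->
  (forall q, K q -> regular cs q) -> finite_set K.
Proof.
move=> K bd reg.
pose K' := [set y : 'rV[R]_N | K (conf y)].
suff fK' : finite_set K'.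
  apply: sub_finite_set (finite_image (@conf R) fK') => q Kq.
  have Eq : conf (coords q) = q by apply/funext; exact: coordsK.
  by exists (coords q) => //; rewrite /K' /= Eq.
have clK' : closed K'.
  rewrite (_ : K' = \bigcap_(c in [set c | c \in cs])
      ((fun y : 'rV[R]_N => cval c (conf y)) @^-1` [set t c])); last first.
    by apply/seteqP; split => y H c; exact: H.
  apply: closed_bigI => c _; apply: closed_comp => [y _|]; last first.
    exact: closed_eq.
  have cc v i : {for y, continuous (fun y : 'rV[R]_N => conf y v 0 i)}.
    rewrite (_ : (fun y : 'rV[R]_N => _) = (fun y => y 0 (enum_rank (v, i)))).
      exact: coord_continuous.
    by apply/funext => z; rewrite mxE.
  case: c => [[v i]|[u v]] /=; first exact: cc.
  rewrite /dot.
  have cd i : {for y, continuous (fun y : 'rV[R]_N => (conf y u - conf y v) 0 i)}.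
    rewrite (_ : (fun y : 'rV[R]_N => _) =
      (fun y => conf y u 0 i - conf y v 0 i)).
      by apply: continuousB; exact: cc.
    by apply/funext => z; rewrite mxE [(- conf z v) 0 i]mxE.
  have cdM i : {for y, continuous (fun y : 'rV[R]_N =>
      (conf y u - conf y v) 0 i * (conf y u - conf y v) 0 i)}.
    by apply: continuousM; exact: cd.
  exact: (continuousD (cdM 0) (cdM 1)).
have cK' : compact K'.
  apply: bounded_closed_compact clK'.
  exists `|C|; split; first exact: num_real.
  move=> x Cx y Ky; apply/row_norm_le => [|k].
    by apply: le_trans (ltW Cx).
  apply: le_trans (ltW Cx); apply: le_trans (ler_norm _).
  have := bd _ Ky (enum_val k).1 (enum_val k).2.
  by rewrite mxE -surjective_pairing enum_valK.
(* Every point of the fibre is isolated. Points outside it get the default radius 1, so that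
   [choice] yields a total function. *)
have iso y : exists r : R, 0 < r /\
    (K' y -> forall z, K' z -> ball y r z -> z = y).
  have [Ky|] := pselect (K' y); last by exists 1.
  have := reg _ Ky => /regularE; rewrite -unitfE -unitmxE => u.
  set A := cmx _ in u; pose B := invmx A.
  pose be := 1 + \sum_i \sum_j `|B i j|.
  have be0 : 0 < be by rewrite ltr_pwDl// sumr_ge0// => i _; exact: sumr_ge0.
  exists (8 * be)^-1; split; first by rewrite invr_gt0 mulr_gt0.
  move=> _ z Kz; rewrite -ball_normE /= => yz.
  apply/eqP; rewrite -subr_eq0; apply/eqP; set h := z - y.
  have hE v : conf z v = conf y v + conf h v.
    by apply/rowP => i; rewrite !mxE addrCA subrr addr0.
  (* Two points of the fibre have equal constraint values, so the linear part of their difference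
     [h] is minus the quadratic part. Inverting [A] gives |h| <= 8 be |h|^2; a nonzero [h] thus has
     norm at least 1 / (8 be), the radius chosen above. *)
  have Ah i : (h *m A) 0 i = - cbil (cidx i) (conf h) (conf h).
    rewrite -[h]confK coords_cmx.
    have := Kz _ (cidx_mem i); rewrite (cval_ext _ hE) cval_add.
    by rewrite (Ky _ (cidx_mem i)) confK; lra.
  have hb : `|h| <= 8 * be * `|h| ^+ 2.
    apply/row_norm_le => [|k]; first by rewrite mulr_ge0 ?exprn_ge0// mulr_ge0// ltW.
    rewrite -[h in leLHS](mulmxK u) mxE.
    apply: le_trans (ler_norm_sum _ _ _) _.
    apply: le_trans (_ : \sum_i (8 * `|h| ^+ 2) * `|B i k| <= _).
      apply: ler_sum => i _; rewrite normrM ler_wpM2r// Ah normrN.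
      rewrite expr2 mulrA; apply: cbil_bound => v j; rewrite mxE;
        exact: row_norm_coord.
    rewrite -mulr_sumr mulrAC ler_wpM2r ?exprn_ge0// ler_pM2l//.
    apply: le_trans (_ : \sum_i \sum_j `|B i j| <= _); last by rewrite lerDr.
    apply: ler_sum => i _; rewrite (bigD1 k)//= lerDl sumr_ge0//.
  apply/eqP; rewrite -normr_eq0; apply/eqP; apply: contrapT => /eqP h0.
  have hp : 0 < `|h| by rewrite lt_neqAle eq_sym h0 normr_ge0.
  have : 1 <= 8 * be * `|h|.
    by rewrite -(ler_pM2r hp) mul1r (le_trans hb)// expr2 mulrA.
  rewrite leNgt => /negP; apply.
  by rewrite mulrC -ltr_pdivlMr ?mulr_gt0// div1r /h distrC.
(* Each ball contains no point of the fibre but its centre, so the centres of a finite subcover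
   exhaust the fibre. *)
have [r rP] := choice iso.
move: cK'; rewrite compact_cover => /(_ _ K' (fun y => ball y (r y))).
case=> [y _|y Ky|D DK' cov].
- by apply: ball_open; exact: (rP y).1.
- by exists y => //; apply: ballxx; exact: (rP y).1.
apply: sub_finite_set (finite_fset D) => y Ky.
have [z zD /= yz] := cov _ Ky.
have -> // : y = z.
by apply: (rP z).2 => //; have := DK' _ zD; rewrite in_setE.
Qed.

End Square.

(** * Rigid motions of the plane *)

Section RigidMotions.
Variable R : realType.
Implicit Types x y z : 'rV[R]_2.

Definition sqd x y : R := dot (x - y) (x - y).

Lemma edistE x y : Defs.edist x y = Num.sqrt (sqd x y).
Proof.
rewrite /Defs.edist big_ord_recl big_ord1 /sqd /dot !mxE !expr2.
by rewrite (_ : lift 0 0 = 1)//; exact/val_inj.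
Qed.

Lemma sqd_ge0 x y : 0 <= sqd x y.
Proof. by rewrite /sqd /dot -!expr2 addr_ge0// sqr_ge0. Qed.

Lemma sqdC x y : sqd x y = sqd y x.
Proof. by rewrite /sqd /dot !mxE; ring. Qed.

Lemma edist_eq x y z t : Defs.edist x y = Defs.edist z t <-> sqd x y = sqd z t.
Proof.
rewrite !edistE; split => [/eqP|->//].
by rewrite eqr_sqrt ?sqd_ge0// => /eqP.
Qed.

Lemma rowP2 x y : x 0 0 = y 0 0 -> x 0 1 = y 0 1 -> x = y.
Proof.
move=> e0 e1; apply/rowP => i; case: (unliftP 0 i) => [j ->|->]; last exact: e0.
by rewrite (ord1 j) (_ : lift 0 0 = 1)//; exact/val_inj.
Qed.

Lemma sqd_eq0 x y : sqd x y = 0 -> x = y.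
Proof.
rewrite /sqd /dot -!expr2 => /eqP; rewrite paddr_eq0 ?sqr_ge0// !sqrf_eq0 !mxE.
rewrite !subr_eq0 => /andP[/eqP e0 /eqP e1]; exact: rowP2.
Qed.

Definition rot (a b : R) : 'M[R]_2 :=
  \matrix_(i, j) if i == j then a else if i == 0 then b else - b.

Lemma mul_rot x a b :
  (x *m rot a b) 0 0 = x 0 0 * a - x 0 1 * b /\
  (x *m rot a b) 0 1 = x 0 0 * b + x 0 1 * a.
Proof.
by split; rewrite mxE big_ord_recl big_ord1 !mxE /= (_ : lift 0 0 = 1) ?mulrN//;
  exact/val_inj.
Qed.

Lemma det_mx22 (A : 'M[R]_2) : \det A = A 0 0 * A 1 1 - A 0 1 * A 1 0.
Proof.
have l1 : lift 0 0 = 1 :> 'I_2 by exact/val_inj.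
have l0 : lift 1 0 = 0 :> 'I_2 by exact/val_inj.
rewrite (expand_det_row _ 0) !big_ord_recl big_ord0 /cofactor !det_mx11 !mxE.
by rewrite !l1 !l0 /= /bump /=; ring.
Qed.

Lemma rigid_motionP (f : 'rV[R]_2 -> 'rV[R]_2) : rigid_motion f <->
  exists a b (c : 'rV[R]_2), a ^+ 2 + b ^+ 2 = 1 /\ f = fun x => x *m rot a b + c.
Proof.
have l1 : lift 0 0 = 1 :> 'I_2 by exact/val_inj.
split.
  move=> [A [c [AA dA ->]]].
  have E i j := congr1 (fun M : 'M[R]_2 => M i j) AA.
  have := E 0 0; have := E 0 1; have := E 1 1.
  rewrite !mxE !big_ord_recl !big_ord0 !mxE !l1 /= !addr0.
  rewrite det_mx22 in dA.
  set p := A 0 0 in dA *; set q := A 0 1 in dA *.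
  set r := A 1 0 in dA *; set s := A 1 1 in dA * => e11 e01 e00.
  (* The left side is the trace of A A^T minus 2 det A, that is 2 - 2. *)
  have sum0 : (p - s) ^+ 2 + (q + r) ^+ 2 = 0.
    by transitivity ((p * p + q * q) + (r * r + s * s) - 2 * (p * s - q * r));
      [ring|rewrite e00 e11 dA; ring].
  move/eqP: sum0; rewrite paddr_eq0 ?sqr_ge0// !sqrf_eq0 subr_eq0 addrC.
  rewrite addr_eq0 => /andP[/eqP ps /eqP rq].
  exists p, q, c; split; first by rewrite !expr2.
  rewrite (_ : A = rot p q)//; apply/matrixP => i j; rewrite mxE.
  case: (unliftP 0 i) => [i' ->|->]; case: (unliftP 0 j) => [j' ->|->];
    rewrite ?(ord1 i') ?(ord1 j') ?l1 //=.
move=> [a [b [c [ab ->]]]]; exists (rot a b), c; split => //; last first.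
  by rewrite det_mx22 !mxE /= -ab; ring.
apply/matrixP => i j; rewrite !mxE !big_ord_recl !big_ord0 !mxE !l1 /=.
by case: (unliftP 0 i) => [i' ->|->]; case: (unliftP 0 j) => [j' ->|->];
    rewrite ?(ord1 i') ?(ord1 j') ?l1 //= -?ab; ring.
Qed.

Lemma rigid_id : rigid_motion (@id 'rV[R]_2).
Proof.
apply/rigid_motionP; exists 1, 0, 0; split; first by rewrite expr0n expr1n addr0.
apply/funext => x; have [e0 e1] := mul_rot x 1 0.
by apply: rowP2; rewrite mxE ?e0 ?e1 !mxE; ring.
Qed.

Lemma rigid_comp (f g : 'rV[R]_2 -> 'rV[R]_2) :
  rigid_motion f -> rigid_motion g -> rigid_motion (f \o g).
Proof.
move=> [A [b [AA dA ->]]] [A' [b' [AA' dA' ->]]].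
exists (A' *m A), (b' *m A + b); split.
- by rewrite trmx_mul mulmxA -(mulmxA A') AA mulmx1.
- by rewrite det_mulmx dA dA' mulr1.
- by apply/funext => x /=; rewrite mulmxDl addrA mulmxA.
Qed.

Lemma rigid_inv (f : 'rV[R]_2 -> 'rV[R]_2) : rigid_motion f ->
  exists2 g, rigid_motion g & forall x, g (f x) = x.
Proof.
move=> [A [b [AA dA ->]]]; exists (fun x => x *m A^T + (- b *m A^T)).
  exists A^T, (- b *m A^T); split => //; last by rewrite det_tr.
  by rewrite trmxK; apply: mulmx1C.
by move=> x; rewrite mulmxDl -mulmxA AA mulmx1 mulNmx addrK.
Qed.

Lemma rigid_sqd (f : 'rV[R]_2 -> 'rV[R]_2) x y :
  rigid_motion f -> sqd (f x) (f y) = sqd x y.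
Proof.
move=> /rigid_motionP[a [b [c [ab ->]]]].
have [x0 x1] := mul_rot x a b; have [y0 y1] := mul_rot y a b.
have S i : (x *m rot a b + c - (y *m rot a b + c)) 0 i =
    (x *m rot a b) 0 i - (y *m rot a b) 0 i.
  by rewrite opprD addrACA subrr addr0 [LHS]mxE; congr (_ + _); rewrite [LHS]mxE.
rewrite /sqd /dot !S x0 x1 y0 y1 -[RHS]mul1r -ab !mxE; ring.
Qed.

(** In complex notation [rot a b] is multiplication by a + ib; it fixes the nonzero number u + iv =
    x - y, hence a + ib = 1. The equations [e0] and [e1] are the real and imaginary parts. *)
Lemma rigid_fix2 (f : 'rV[R]_2 -> 'rV[R]_2) x y :
  rigid_motion f -> f x = x -> f y = y -> x != y -> f = id.
Proof.
move=> /rigid_motionP[a [b [c [ab ->]]]] fx fy xy.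
have [x0 x1] := mul_rot x a b; have [y0 y1] := mul_rot y a b.
have E z i : z *m rot a b + c = z -> (z *m rot a b) 0 i + c 0 i = z 0 i.
  by move=> e; rewrite -[in RHS]e [RHS]mxE.
have := E _ 0 fx; have := E _ 1 fx; have := E _ 0 fy; have := E _ 1 fy.
rewrite x0 x1 y0 y1 => ey1 ey0 ex1 ex0.
pose u := x 0 0 - y 0 0; pose v := x 0 1 - y 0 1.
have e0 : u * (a - 1) = v * b by rewrite /u /v; lra.
have e1 : u * b = - (v * (a - 1)) by rewrite /u /v; lra.
have uv0 : u ^+ 2 + v ^+ 2 != 0.
  apply: contra_neq xy => uv; apply: sqd_eq0.
  by rewrite /sqd /dot !mxE -uv /u /v; ring.
have a1 : a = 1.
  apply/eqP; rewrite -subr_eq0; apply/eqP; apply: (mulfI uv0); rewrite mulr0.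
  transitivity (u * (u * (a - 1)) + v * (v * (a - 1))); first by ring.
  have -> : v * (a - 1) = - (u * b) by rewrite e1 opprK.
  by rewrite e0; ring.
have b0 : b = 0.
  by apply/eqP; rewrite -sqrf_eq0; apply/eqP; move: ab; rewrite a1 expr1n; lra.
have cE : c = 0.
  apply: rowP2; rewrite mxE.
    by move: ex0; rewrite a1 b0; lra.
  by move: ex1; rewrite a1 b0; lra.
apply/funext => z; have [z0 z1] := mul_rot z a b.
by apply: rowP2; rewrite mxE ?z0 ?z1 cE a1 b0 mxE; ring.
Qed.

(** The rotation is the complex quotient (y' - x') / (y - x), of modulus 1; [a] and [b] are its real
    and imaginary parts. *)
Lemma rigid_exists x y x' y' : sqd x y = sqd x' y' -> x != y ->
  exists f : 'rV[R]_2 -> 'rV[R]_2, [/\ rigid_motion f, f x = x' & f y = y'].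
Proof.
move=> xy neq.
have D0 : sqd x y != 0 by apply: contra_neq neq => /sqd_eq0.
pose u := y 0 0 - x 0 0; pose v := y 0 1 - x 0 1.
pose u' := y' 0 0 - x' 0 0; pose v' := y' 0 1 - x' 0 1.
have D : sqd x y = u ^+ 2 + v ^+ 2.
  by rewrite /sqd /dot /u /v !mxE; ring.
have D' : sqd x y = u' ^+ 2 + v' ^+ 2.
  by rewrite xy /sqd /dot /u' /v' !mxE; ring.
pose a := (u * u' + v * v') / sqd x y; pose b := (u * v' - v * u') / sqd x y.
have aD : a * sqd x y = u * u' + v * v' by rewrite /a divfK.
have bD : b * sqd x y = u * v' - v * u' by rewrite /b divfK.
have eu : u * a - v * b = u'.
  apply: (mulIf D0); transitivity (u * (a * sqd x y) - v * (b * sqd x y)); first by ring.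
  by rewrite aD bD D; ring.
have ev : u * b + v * a = v'.
  apply: (mulIf D0); transitivity (u * (b * sqd x y) + v * (a * sqd x y)); first by ring.
  by rewrite aD bD D; ring.
have [x0 x1] := mul_rot x a b; have [y0 y1] := mul_rot y a b.
exists (fun z => z *m rot a b + (x' - x *m rot a b)); split.
- apply/rigid_motionP; exists a, b, (x' - x *m rot a b); split => //.
  apply: (mulIf D0); apply: (mulIf D0).
  transitivity ((a * sqd x y) ^+ 2 + (b * sqd x y) ^+ 2); first by ring.
  rewrite aD bD mul1r {1}D D'; ring.
- by rewrite addrC subrK.
- rewrite addrCA; apply: rowP2.
    rewrite !mxE in x0 y0 *; rewrite x0 y0.
    by move: eu; rewrite /u /v /u'; lra.
  rewrite !mxE in x1 y1 *; rewrite x1 y1.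
  by move: ev; rewrite /u /v /v'; lra.
Qed.

End RigidMotions.

(** * Pinned frameworks *)

Lemma seq_lower_bound (R : realFieldType) (T : eqType) (s : seq T) (f : T -> R) :
  (forall x, x \in s -> 0 < f x) ->
  exists2 e, 0 < e & forall x, x \in s -> e <= f x.
Proof.
elim: s => [|x s IH] fpos; first by exists 1.
case: IH => [y ys|e e0 es]; first by apply: fpos; rewrite inE ys orbT.
exists (Num.min e (f x)); first by rewrite lt_min e0 fpos ?inE ?eqxx.
by move=> y; rewrite inE ge_min => /orP[/eqP->|/es->//]; rewrite lexx orbT.
Qed.

Lemma ler_sumr_single (R : realFieldType) (T : finType) (F : T -> R) x :
  (forall y, 0 <= F y) -> F x <= \sum_y F y.
Proof. by move=> F0; rewrite (bigD1 x)//= lerDl sumr_ge0. Qed.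

Lemma cval_continuous (R : realType) (V : finType) (cs : seq (constr V))
    (p0 : V -> 'rV[R]_2) (de : R) : 0 < de ->
  exists2 eta, 0 < eta & forall p : V -> 'rV[R]_2,
    (forall v i, `|p v 0 i - p0 v 0 i| <= eta) ->
    forall c, c \in cs -> `|cval c p - cval c p0| <= de.
Proof.
move=> de0.
have one c : exists eta : R, 0 < eta /\
    forall p : V -> 'rV[R]_2, (forall v i, `|p v 0 i - p0 v 0 i| <= eta) ->
      `|cval c p - cval c p0| <= de.
  case: c => [[v i]|[u v]]; first by exists de; split => // p; apply.
  pose B : R := 1 + `|(p0 u - p0 v) 0 0| + `|(p0 u - p0 v) 0 1|.
  have B1 : 1 <= B by rewrite /B -addrA lerDl addr_ge0.
  have B0 : 0 < B := lt_le_trans ltr01 B1.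
  (* The linear term is at most 4 eta (B - 1) and the quadratic one at most 8 eta^2 <= 8 eta,
     together at most 16 B eta. *)
  pose eta := Num.min 1 (de / (16 * B)).
  have eta0 : 0 < eta by rewrite lt_min ltr01 divr_gt0// mulr_gt0.
  exists eta; split => // p pp.
  pose h w := p w - p0 w.
  have hb w i : `|h w 0 i| <= eta by rewrite mxE [(- p0 w) 0 i]mxE.
  have -> : cval (inr (u, v)) p =
      cval (inr (u, v)) (fun w => p0 w + h w).
    by rewrite /= /h !(addrC (p0 _)) !subrK.
  rewrite cval_add (_ : forall x y z : R, x + y + z - x = y + z); last first.
    by move=> *; ring.
  apply: le_trans (ler_normD _ _) _.
  have b1 := cbil_bound (inr (u, v) : constr V) hb hb.
  have e1 : eta <= 1 by rewrite ge_min lexx.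
  have eB : eta * (16 * B) <= de by rewrite -ler_pdivlMr ?mulr_gt0// ge_min lexx orbT.
  have hd i : `|(h u - h v) 0 i| <= 2 * eta.
    rewrite mxE [(- h v) 0 i]mxE mulrDl mul1r.
    by apply: le_trans (ler_normB _ _) _; apply: lerD.
  have b2 : `|cdiff (inr (u, v)) p0 h| <= 4 * eta * (B - 1).
    rewrite /= normrM ger0_norm// /dot.
    apply: le_trans (_ : 2 * (`|(p0 u - p0 v) 0 0| * (2 * eta) +
      `|(p0 u - p0 v) 0 1| * (2 * eta)) <= _); last by rewrite /B; nra.
    rewrite ler_pM2l//; apply: le_trans (ler_normD _ _) _.
    by rewrite !normrM; apply: lerD; apply: ler_wpM2l.
  by apply: le_trans (lerD b2 b1) _; nra.
have [eta etaP] := choice one.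
have [e e0 es] := seq_lower_bound (s := cs) (fun c _ => (etaP c).1).
exists e => // p pp c ccs; apply: (etaP c).2 => v i.
by apply: le_trans (pp v i) _; exact: es.
Qed.

(** An inverse function theorem with control of the displacement. At a regular point the Jacobian
    has an exact right inverse, so [newton_kantorovich] applies with defect 0. *)
Lemma regular_open (R : realType) (V : finType) (cs : seq (constr V))
    (q : V -> 'rV[R]_2) (e : R) :
  uniq cs -> size cs = #|{: V * 'I_2}| -> regular cs q -> 0 < e ->
  exists2 de, 0 < de & forall t : constr V -> R,
    (forall c, c \in cs -> `|cval c q - t c| <= de) ->
    exists q', [/\ forall c, c \in cs -> cval c q' = t c,
      forall v i, `|q' v 0 i - q v 0 i| <= e & regular cs q'].
Proof.
move=> cu csz reg e0.
pose c i := cidx csz i.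
have cmem i : c i \in cs by exact: cidx_mem.
have /choice[H Ht] : forall i, exists h : V -> 'rV[R]_2,
    forall j, cdiff (c j) q h = (i == j)%:R.
  move=> i; have [h ht] := reg (fun d => (d == c i)%:R).
  exists h => j; rewrite ht//; congr (_%:R).
  by rewrite (inj_eq (cidx_inj cu (cs_size := csz))) eq_sym.
pose be := 1 + \sum_v \sum_(k < 2) \sum_j `|H j v 0 k|.
have beP v k : \sum_j `|H j v 0 k| <= be.
  apply: le_trans (_ : \sum_v \sum_(k < 2) \sum_j `|H j v 0 k| <= _).
    apply: le_trans (@ler_sumr_single _ _
      (fun v => \sum_(k < 2) \sum_j `|H j v 0 k|) v _) => [|w].
      apply: (@ler_sumr_single _ _ (fun k => \sum_j `|H j v 0 k|)) => l.
      exact: sumr_ge0.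
    by do 2?apply: sumr_ge0 => *.
  by rewrite lerDr.
have be1 : 1 <= be.
  by rewrite lerDl; do 3?apply: sumr_ge0 => *.
have be0 : 0 < be := lt_le_trans ltr01 be1.
(* The first bound keeps the displacement below [e]; the second gives 8 be^2 rho^2 <= rho / 4, which
   leaves room for a residual of rho / 2. *)
pose rho := Num.min (e / be) (32 * be ^+ 2)^-1.
have rho0 : 0 < rho.
  by rewrite lt_min divr_gt0//= invr_gt0 mulr_gt0// exprn_gt0.
have rbe : be * rho <= e by rewrite mulrC -ler_pdivlMr// ge_min lexx.
have rb2 : 32 * be ^+ 2 * rho <= 1.
  rewrite mulrC -ler_pdivlMr ?div1r ?mulr_gt0 ?exprn_gt0//.
  by rewrite ge_min lexx orbT.
exists (rho / 2); first by rewrite divr_gt0.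
move=> t ht.
have Hth i : \sum_j `|(i == j)%:R - cdiff (c i) q (H j)| <= 0.
  by rewrite big1// => j _; rewrite Ht eq_sym subrr normr0.
have [||y [yr yt yreg]] := newton_kantorovich Hth beP (fun i => ht _ (cmem i))
  (lexx 0) (ltW be0) (ltW rho0).
- by rewrite add0r; nra.
- by rewrite mul0r add0r; nra.
exists (fun v => q v + lincomb H y v); split.
- by move=> d /(mem_cidx csz)[i ->]; exact: yt.
- move=> v i; rewrite mxE addrAC subrr add0r.
  apply: le_trans (lincomb_bound _ _ _ beP) _.
  by apply: le_trans rbe; rewrite ler_wpM2l// ltW.
- move=> s; have [z zs] := yreg (fun i => s (c i)).
  by exists (lincomb H z) => d /(mem_cidx csz)[i ->]; exact: zs.
Qed.

Section Graphs.
Variable V : finType.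
Implicit Types (s : seq (V * V)) (e : V * V).

Definition edge_set s : {set {set V}} :=
  [set [set e.1; e.2]%SET | e in [seq e <- s | e.1 != e.2]]%SET.

Lemma edge_set_card2 s : [forall A in edge_set s, #|A| == 2%N].
Proof.
apply/forall_inP => A /imsetP[e]; rewrite mem_filter => /andP[e12 _] ->.
by rewrite cards2 e12.
Qed.

Definition graph_of s : sgraph V := SGraph (edge_set_card2 s).

Lemma graph_ofP s (A : {set V}) : (forall e, e \in s -> e.1 != e.2) ->
  A \in edges (graph_of s) <-> exists2 e, e \in s & A = [set e.1; e.2]%SET.
Proof.
move=> irr; split => [/imsetP[e]|[e es ->]].
  by rewrite mem_filter => /andP[_ es] ->; exists e.
by apply/imsetP; exists e => //; rewrite mem_filter es irr.
Qed.

Lemma set2_inj (a b c d : V) : [set a; b]%SET = [set c; d]%SET ->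
  (a = c /\ b = d) \/ (a = d /\ b = c).
Proof.
move=> /setP E.
have M x : (x == a) || (x == b) = ((x == c) || (x == d)).
  by have := E x; rewrite !inE.
have := M a; rewrite eqxx /= => /esym/orP[]/eqP ac; subst a;
  have := M b; rewrite eqxx orbT => /esym/orP[]/eqP bc; subst b.
- by have := M d; rewrite eqxx !orbT orbb => /eqP ->; left.
- by left.
- by right.
- by have := M c; rewrite eqxx /= orbb => /eqP ->; left.
Qed.

End Graphs.

Section Pinned.
Variables (R : realType) (V : finType) (a b : V) (s : seq (V * V)).

(** The graph meant is [(a, b) :: s]: pinning a and b replaces the constraint of the edge ab. The
    size condition makes four pinned coordinates and the edges of [s] as many as the coordinates,
    which amounts to 2|V| - 3 edges in all. Connectedness is stated as an induction principle along
    edges. *)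
Record pinned_graph : Prop := PinnedGraph {
  pinned_neq : a != b;
  pinned_irr : forall e, e \in s -> e.1 != e.2;
  pinned_uniq : uniq s;
  pinned_size : (size s + 4 = #|V| * 2)%N;
  pinned_connected : forall S : V -> Prop, S a ->
    (forall e, e \in (a, b) :: s -> S e.1 <-> S e.2) -> forall v, S v
}.

Hypothesis G : pinned_graph.

Definition pins : seq (constr V) :=
  [:: inl (a, 0); inl (a, 1); inl (b, 0); inl (b, 1)] ++ map inr s.

Lemma pins_uniq : uniq pins.
Proof.
rewrite /pins cat_uniq map_inj_uniq ?(pinned_uniq G); last by move=> ? ? [].
rewrite andbT; apply/andP; split.
  have ab := pinned_neq G; have ba : b != a by rewrite eq_sym.
  by rewrite /= !inE /eq_op /= /eq_op /= ?eqxx ?(negbTE ab) ?(negbTE ba).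
by apply/hasPn => _ /mapP[e _ ->]; rewrite !inE.
Qed.

Lemma pins_size : size pins = #|{: V * 'I_2}|.
Proof. by rewrite /= size_map card_prod card_ord -(pinned_size G) addnC. Qed.

Lemma ord2P (P : 'I_2 -> Prop) : P 0 -> P 1 -> forall i, P i.
Proof.
move=> P0 P1 i; case: (unliftP 0 i) => [j ->|->//].
by rewrite (ord1 j) (_ : lift 0 0 = 1)//; exact/val_inj.
Qed.

Lemma pinsP (P : constr V -> Prop) : (forall c, c \in pins -> P c) <->
  [/\ forall i, P (inl (a, i)), forall i, P (inl (b, i)) &
      forall e, e \in s -> P (inr e)].
Proof.
split=> [H|[Pa Pb Ps] c].
  split=> [||e es]; last by apply: H; rewrite /pins mem_cat map_f ?orbT.
    by apply: ord2P; apply: H; rewrite !inE eqxx ?orbT.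
  by apply: ord2P; apply: H; rewrite !inE eqxx ?orbT.
rewrite mem_cat => /orP[|/mapP[e es ->]]; last exact: Ps.
by rewrite !inE => /or4P[] /eqP ->.
Qed.

Lemma same_pinsP (q p : V -> 'rV[R]_2) :
  (forall c, c \in pins -> cval c q = cval c p) <->
  [/\ q a = p a, q b = p b &
      forall e, e \in s -> sqd (q e.1) (q e.2) = sqd (p e.1) (p e.2)].
Proof.
split=> [/pinsP[qa qb qs]|[qa qb qs]].
  by split => //; apply/rowP => i; [exact: qa|exact: qb].
by apply/pinsP; split => [i|i|//]; rewrite /= ?qa ?qb.
Qed.

(** The difference of the first coordinates of u and v is a nonzero polynomial. *)
Lemma generic_neq (p : V -> 'rV[R]_2) u v :
  generic_configuration p -> u != v -> p u != p v.
Proof.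
move=> gen uv; apply/eqP => puv.
pose X (w : V) := mpolyX rat (mnm1 (enum_rank (w, 0 : 'I_2))).
have /gen/eqP[] : X u - X v != 0.
  rewrite subr_eq0; apply/eqP => /(congr1 (mcoeff (mnm1 (enum_rank (u, 0 : 'I_2))))).
  rewrite !mcoeffX eqxx eq_mnm1 (inj_eq enum_rank_inj).
  by rewrite xpair_eqE eq_sym (negbTE uv) /= => /eqP; rewrite oner_eq0.
by rewrite rmorphB /= !mmapX !mmap1U !enum_rankK puv subrr.
Qed.

(** The ordering of the pair that is picked is immaterial by symmetry of the distance; sets not of
    the form {u, v} get 0. *)
Definition induced_length (p : V -> 'rV[R]_2) (A : {set V}) : R :=
  if [pick e : V * V | A == [set e.1; e.2]%SET] is Some e
  then Defs.edist (p e.1) (p e.2) else 0.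

Lemma induced_lengthE p u v :
  induced_length p [set u; v]%SET = Defs.edist (p u) (p v).
Proof.
rewrite /induced_length; case: pickP => [[x y] /= /eqP /set2_inj|/(_ (u, v))].
  by case=> -[-> ->] //; apply/edist_eq; rewrite sqdC.
by rewrite /= eqxx.
Qed.

Let irr_full e : e \in (a, b) :: s -> e.1 != e.2.
Proof. by rewrite inE => /orP[/eqP->|]; [exact: pinned_neq|exact: pinned_irr]. Qed.

Lemma embeddingsP (lam : {set V} -> R) (rho : V -> 'rV[R]_2) :
  embeddings (graph_of ((a, b) :: s)) lam rho <->
  forall e, e \in (a, b) :: s ->
    Defs.edist (rho e.1) (rho e.2) = lam [set e.1; e.2]%SET.
Proof.
split=> [H e es|H x y]; first by apply: H; apply/(graph_ofP _ irr_full); exists e.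
move=> /(graph_ofP _ irr_full)[e es E]; rewrite E -H//.
by case: (set2_inj E) => -[-> ->] //; apply/edist_eq; rewrite sqdC.
Qed.

(** Bounds propagate from the pinned vertex a along edges of fixed length. *)
Lemma pinned_bounded (p : V -> 'rV[R]_2) : exists C : R, forall q,
  (forall c, c \in pins -> cval c q = cval c p) ->
  forall v i, `|q v 0 i| <= C.
Proof.
pose K q := forall c, c \in pins -> cval c q = cval c p.
pose S v := exists C : R, forall q, K q -> forall i, `|q v 0 i| <= C.
have step u v : (exists l : R, forall q, K q -> sqd (q u) (q v) = l) -> S u -> S v.
  (* A real whose square is at most [l] has absolute value at most 1 + l. *)
  move=> [l ql] [C qC]; exists (C + (1 + l)) => q Kq i.
  have -> : q v 0 i = q u 0 i - (q u - q v) 0 i.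
    by rewrite mxE [(- q v) 0 i]mxE; ring.
  apply: le_trans (ler_normB _ _) _; apply: lerD; first exact: qC.
  have := ql q Kq; rewrite /sqd /dot; set d := q u - q v => dE.
  have di : d 0 i ^+ 2 <= l.
    move: i; apply: ord2P; rewrite -dE -!expr2.
      by rewrite lerDl sqr_ge0.
    by rewrite lerDr sqr_ge0.
  rewrite -[d 0 i ^+ 2]real_normK ?num_real// in di.
  by have := normr_ge0 (d 0 i); nra.
have Sall : forall v, S v.
  apply: (pinned_connected G).
    exists (\sum_i `|p a 0 i|) => q /same_pinsP[-> _ _] i.
    exact: (@ler_sumr_single _ _ (fun i => `|p a 0 i|)).
  move=> e es; suff H : exists l : R, forall q, K q -> sqd (q e.1) (q e.2) = l.
    split; apply: step => //; have [l lP] := H; exists l => q /lP <-.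
    by rewrite sqdC.
  exists (sqd (p e.1) (p e.2)) => q /same_pinsP[qa qb qs].
  by move: es; rewrite inE => /orP[/eqP->|/qs//]; rewrite /= qa qb.
have [C CP] := choice Sall.
exists (\sum_v `|C v|) => q Kq v i.
apply: le_trans (CP v q Kq i) _; apply: le_trans (ler_norm _) _.
exact: (@ler_sumr_single _ _ (fun v => `|C v|)).
Qed.

Lemma motion_class_comp (f : 'rV[R]_2 -> 'rV[R]_2) (rho : V -> 'rV[R]_2) :
  rigid_motion f -> motion_class (f \o rho) = motion_class rho.
Proof.
move=> rf; apply/seteqP; split => _ [g rg <-].
  by exists (g \o f) => //; exact: rigid_comp.
have [h rh hf] := rigid_inv rf.
exists (g \o h); first exact: rigid_comp.
by apply/funext => v /=; rewrite hf.
Qed.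

Lemma motion_class_refl (rho : V -> 'rV[R]_2) : motion_class rho rho.
Proof. by exists id => //; exact: rigid_id. Qed.

Lemma motion_class_sqd (rho rho' : V -> 'rV[R]_2) u v :
  motion_class rho = motion_class rho' ->
  sqd (rho u) (rho v) = sqd (rho' u) (rho' v).
Proof.
move=> E; have := motion_class_refl rho; rewrite E => -[f rf <-] /=.
by rewrite rigid_sqd.
Qed.

Lemma motion_class_inj (rho rho' : V -> 'rV[R]_2) :
  rho a = rho' a -> rho b = rho' b -> rho' a != rho' b ->
  motion_class rho = motion_class rho' -> rho = rho'.
Proof.
move=> ea eb ab E; have := motion_class_refl rho; rewrite E => -[f rf fE].
rewrite -fE (_ : f = id)//; move: ea eb; rewrite -fE /= => ea eb.
exact: (rigid_fix2 rf ea eb ab).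
Qed.

Let pinned_fiber (p : V -> 'rV[R]_2) :=
  [set q : V -> 'rV[R]_2 | forall c, c \in pins -> cval c q = cval c p].

(** The edge ab has the same nonzero length in every embedding, so each class contains a
    representative with a and b placed as in [p]. These representatives lie in one fibre, finite by
    regularity. *)
Lemma finite_num_embeddings (p : V -> 'rV[R]_2) (lam : {set V} -> R) :
  generic_configuration p -> regular pins p ->
  embeddings (graph_of ((a, b) :: s)) lam p ->
  finite_set [set motion_class rho |
    rho in embeddings (d := 2) (graph_of ((a, b) :: s)) lam].
Proof.
move=> gen reg /embeddingsP plam.
have [C qC] := pinned_bounded p.
have fK : finite_set (pinned_fiber p).
  apply: (finite_fiber pins_uniq pins_size qC) => q qp.
  exact: regular_transfer gen reg qp.
apply: sub_finite_set (finite_image (@motion_class R 2 V) fK).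
move=> _ [rho /embeddingsP rlam <-].
have pab : p a != p b by apply: generic_neq => //; exact: pinned_neq.
have same e : e \in (a, b) :: s -> sqd (rho e.1) (rho e.2) = sqd (p e.1) (p e.2).
  by move=> es; apply/edist_eq; rewrite rlam// plam.
have rab : rho a != rho b.
  apply: contra_neq pab => e; apply: sqd_eq0.
  by rewrite -(same (a, b)) ?inE ?eqxx//= e /sqd subrr /dot !mxE mulr0 addr0.
have [f [rf fa fb]] := rigid_exists (same (a, b) (mem_head _ _)) rab.
exists (f \o rho); last exact: motion_class_comp.
apply/same_pinsP; split => // e es /=; rewrite rigid_sqd//.
by apply: same; rewrite inE es orbT.
Qed.

(** For minimality, the length of the deleted edge is given infinitely many values near a generic
    regular point while all others are kept. Since rigid motions preserve it, these realizations lie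
    in distinct classes. *)
Lemma pinned_laman (p0 : V -> 'rV[R]_2) : regular pins p0 ->
  laman R (graph_of ((a, b) :: s)).
Proof.
move=> reg0; split.
  move=> p lam gen plam; rewrite /num_embeddings /counting asboolT ?ltry//.
  apply: finite_num_embeddings plam => //.
  exact: (generic_regular pins_uniq pins_size gen reg0).
move=> A /(graph_ofP _ irr_full)[[x y] xys AE] rig.
have [pc [_ gen']] := @generic_dense R #|{: V * 'I_2}| (fun=> 0) 1 ltr01.
pose p := conf (\row_k pc k) : V -> 'rV[R]_2.
have gen : generic_configuration p.
  move=> P P0; rewrite (_ : (fun k => _) = pc); first exact: gen'.
  by apply/funext => k; rewrite !mxE -surjective_pairing enum_valK.
have reg := generic_regular pins_uniq pins_size gen reg0.
have [de de0 deP] := regular_open pins_uniq pins_size reg ltr01.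
pose lam := induced_length p.
have emb0 : embeddings (del_edge (graph_of ((a, b) :: s)) A) lam p.
  by move=> u v _; rewrite /lam induced_lengthE.
have := rig p lam gen emb0.
rewrite /num_embeddings /counting; case: asboolP => // fin _.
suff [q qP] : exists q : nat -> V -> 'rV[R]_2, forall n,
    embeddings (del_edge (graph_of ((a, b) :: s)) A) lam (q n) /\
    forall m, sqd (q n x) (q n y) = sqd (q m x) (q m y) -> n = m.
  apply: infinite_nat.
  rewrite (_ : [set: nat] = (fun n => motion_class (q n)) @^-1`
    [set motion_class rho | rho in
      embeddings (del_edge (graph_of ((a, b) :: s)) A) lam]).
    apply: finite_preimage fin => n m _ _ /motion_class_sqd E.
    by apply: (qP n).2; exact: E.
  apply/seteqP; split => // n _; exists (q n) => //; exact: (qP n).1.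
pose mu : R := 1 + `|(p b - p a) 0 0| + `|(p b - p a) 0 1|.
have mu0 : 0 < mu by rewrite /mu -addrA ltr_pwDl// addr_ge0.
have mui i : `|(p b - p a) 0 i| <= mu.
  by move: i; apply: ord2P; rewrite /mu ?lerDr ?addr_ge0// addrAC lerDr addr_ge0.
(* Distinct positive shifts. The factor mu + 1 covers both cases below: moving b by [tau n] times b
   - a changes a pin by at most [tau n * mu], and shifting a squared length changes a constraint by
   [tau n]. *)
pose tau (n : nat) : R := de / (mu + 1) * n.+1%:R^-1.
have tau0 n : 0 < tau n by rewrite mulr_gt0 ?invr_gt0// divr_gt0// addr_gt0.
have tau_inj : injective tau.
  move=> n m; rewrite /tau => /mulfI-/(_ _)/invr_inj/eqP.
  rewrite eqr_nat => E; apply/eqP; rewrite -eqSS; apply: E.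
  by rewrite gt_eqF// divr_gt0// addr_gt0.
have tau_le n : tau n * (mu + 1) <= de.
  have mu1 : mu + 1 != 0 by rewrite gt_eqF// addr_gt0.
  rewrite /tau mulrAC (divfK mu1) -[leRHS]mulr1; apply: ler_wpM2l.
    exact: ltW.
  by rewrite invf_le1// ler1n.
have [Eab|nab] := eqVneq A [set a; b]%SET.
  (* Moving [b] along the line [ab] keeps all edges but [ab]. *)
  pose t n (c : constr V) : R := cval c p +
    (if c is inl (v, i) then (v == b)%:R * (tau n * (p b - p a) 0 i) else 0).
  have tde n c : c \in pins -> `|cval c p - t n c| <= de.
    move=> _; rewrite /t opprD addrA subrr add0r normrN.
    case: c => [[v i]|e]; last by rewrite normr0 ltW.
    apply: le_trans (tau_le n); rewrite normrM normrM (gtr0_norm (tau0 n)).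
    apply: le_trans (_ : 1 * (tau n * mu) <= _); last first.
      by rewrite mul1r ler_pM2l// lerDl.
    apply: ler_pM => //; first by rewrite mulr_ge0// ltW.
      by case: eqP => _; rewrite ?normr1 ?normr0.
    by rewrite ler_pM2l.
  have /choice[q qP] n := deP (t n) (tde n).
  have qa n : q n a = p a.
    apply/rowP => i; have [qt _ _] := qP n.
    have [/(_ i) /= -> _ _] := (pinsP (fun c => cval c (q n) = t n c)).1 qt.
    by rewrite /t (negbTE (pinned_neq G)) mul0r addr0.
  have qb n : q n b = p b + tau n *: (p b - p a).
    apply/rowP => i; have [qt _ _] := qP n.
    have [_ /(_ i) /= -> _] := (pinsP (fun c => cval c (q n) = t n c)).1 qt.
    by rewrite /t /= eqxx mul1r !mxE.
  have qs n e : e \in s -> sqd (q n e.1) (q n e.2) = sqd (p e.1) (p e.2).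
    move=> es; have [qt _ _] := qP n.
    have [_ _ /(_ e es)] := (pinsP (fun c => cval c (q n) = t n c)).1 qt.
    by rewrite /t addr0.
  have sq n : sqd (q n a) (q n b) = (1 + tau n) ^+ 2 * sqd (p a) (p b).
    by rewrite qa qb /sqd /dot !mxE; ring.
  have pab0 : sqd (p a) (p b) != 0.
    apply: contraNneq (generic_neq gen (pinned_neq G)) => /sqd_eq0 ->.
    by rewrite eqxx.
  exists q => n; split=> [u v|m].
    rewrite !inE => /andP[nuv /(graph_ofP _ irr_full)[e es E]].
    rewrite E /lam induced_lengthE.
    have es' : e \in s.
      move: es; rewrite inE => /orP[/eqP e'|//].
      by move: nuv; rewrite E e' /= Eab eqxx.
    by case: (set2_inj E) => -[-> ->]; apply/edist_eq;
      rewrite ?[sqd _ (q n e.1)]sqdC qs.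
  have kE k : sqd (q k x) (q k y) = sqd (q k a) (q k b).
    by case: (set2_inj (esym (etrans (esym Eab) AE))) => -[/= -> ->] //; rewrite sqdC.
  rewrite !kE !sq => E; have /eqP := mulIf pab0 E.
  rewrite eqrXn2 ?addr_ge0 ?(ltW (tau0 _))//.
  by move=> /eqP/addrI; exact: tau_inj.
have xs : (x, y) \in s.
  move: xys; rewrite inE => /orP[/eqP[ex ey]|//].
  by move: nab; rewrite AE /= ex ey eqxx.
(* The deleted edge is now itself a constraint, and its squared length is shifted directly. *)
pose t n (c : constr V) : R := cval c p +
  (if c is inr e then (A == [set e.1; e.2]%SET)%:R * tau n else 0).
have tde n c : c \in pins -> `|cval c p - t n c| <= de.
  move=> _; rewrite /t opprD addrA subrr add0r normrN.
  case: c => [?|e]; first by rewrite normr0 ltW.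
  apply: le_trans (tau_le n); rewrite normrM (gtr0_norm (tau0 n)).
  rewrite mulrC ler_pM2l//; case: eqP => _; rewrite ?normr1 ?normr0.
    by rewrite lerDr ltW.
  by rewrite addr_ge0// ltW.
have /choice[q qP] n := deP (t n) (tde n).
have qt n := (pinsP (fun c => cval c (q n) = t n c)).1 (let: And3 qt _ _ := qP n in qt).
have qa n : q n a = p a.
  by apply/rowP => i; have [/(_ i) /= -> _ _] := qt n; rewrite /t addr0.
have qb n : q n b = p b.
  by apply/rowP => i; have [_ /(_ i) /= -> _] := qt n; rewrite /t addr0.
have qs n e : e \in (a, b) :: s -> A != [set e.1; e.2]%SET ->
    sqd (q n e.1) (q n e.2) = sqd (p e.1) (p e.2).
  rewrite inE => /orP[/eqP-> _|es nA]; first by rewrite /= qa qb.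
  have [_ _ /(_ e es)] := qt n.
  by rewrite /t (negbTE nA) mul0r addr0.
exists q => n; split=> [u v|m].
  rewrite !inE => /andP[nuv /(graph_ofP _ irr_full)[e es E]].
  rewrite E /lam induced_lengthE.
  have nA : A != [set e.1; e.2]%SET by rewrite -E eq_sym.
  by case: (set2_inj E) => -[-> ->]; apply/edist_eq;
    rewrite ?[sqd _ (q n e.1)]sqdC qs.
have E k : sqd (q k x) (q k y) = sqd (p x) (p y) + tau k.
  have [_ _ /(_ _ xs) /= Ek] := qt k; rewrite /sqd Ek.
  by rewrite /t /= AE eqxx mul1r.
by rewrite !E => /addrI; exact: tau_inj.
Qed.

End Pinned.

(** * Counting realizations after a generic perturbation *)

Section CountPinned.
Variables (R : realType) (V : finType) (a b : V) (s : seq (V * V)).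
Hypothesis G : pinned_graph a b s.
Variables (I : finType) (q : I -> V -> 'rV[R]_2).
Hypothesis qreg : forall i, regular (pins a b s) (q i).
Hypothesis qsame : forall i j c, c \in pins a b s -> cval c (q i) = cval c (q j).
Hypothesis qinj : forall i j, q i =1 q j -> i = j.

Let qsep : exists2 e : R, 0 < e & forall i j (q' : V -> 'rV[R]_2),
  (forall v k, `|q' v 0 k - q i v 0 k| <= e) ->
  (forall v k, `|q' v 0 k - q j v 0 k| <= e) -> i = j.
Proof.
pose D (ij : I * I) := \sum_v \sum_(k < 2) `|q ij.1 v 0 k - q ij.2 v 0 k|.
have [|d d0 dP] := @seq_lower_bound R _ [seq ij <- enum {: I * I} | ij.1 != ij.2] D.
  move=> [i j]; rewrite mem_filter /= => /andP[ij _].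
  rewrite lt_neqAle sumr_ge0 ?andbT => [|v _]; last exact: sumr_ge0.
  rewrite eq_sym; apply: contra_neq ij => D0; apply: qinj => v; apply/rowP => k.
  move/eqP: D0; rewrite psumr_eq0 => [|w _]; last exact: sumr_ge0.
  move=> /allP/(_ v (mem_index_enum _)) /=; rewrite psumr_eq0// => /allP.
  by move=> /(_ k (mem_index_enum _)) /=; rewrite normr_eq0 subr_eq0 => /eqP.
(* If q' is within e of both realizations, their 2|V| coordinates differ by at most 2e each, in
   total by 4e|V|, which is less than the least distance [d]. *)
pose e := d / (4 * #|V|.+1%:R).
have e0 : 0 < e by rewrite divr_gt0// mulr_gt0.
exists e => // i j q' qi qj; apply/eqP; apply: contraT => ij.
have : d <= D (i, j) by apply: dP; rewrite mem_filter /= ij mem_enum.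
suff : D (i, j) < d by rewrite ltNge => /negbTE ->.
apply: le_lt_trans (_ : \sum_(v : V) 4 * e < _).
  apply: ler_sum => v _; rewrite big_ord_recl big_ord1.
  have K k : `|q i v 0 k - q j v 0 k| <= 2 * e.
    rewrite (_ : _ - _ = (q' v 0 k - q j v 0 k) - (q' v 0 k - q i v 0 k)); last by ring.
    apply: le_trans (ler_normB _ _) _; have := qi v k; have := qj v k; lra.
  by have := K 0; have := K (lift 0 0); rewrite /=; lra.
have E : 4 * e * #|V|.+1%:R = d.
  rewrite mulrAC mulrC /e divfK// gt_eqF// mulr_gt0//.
have -> : \sum_(v : V) 4 * e = 4 * e * #|V|%:R by rewrite sumr_const mulr_natr.
by rewrite -E ltr_pM2l ?mulr_gt0// ltr_nat.
Qed.

(** The realizations share all constraint values, so one generic point [p] near [q i0] prescribes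
    nearby values for every one of them. Each [q i] then moves to a realization with the constraints
    of [p], by less than the separation radius. Equal pins keep distinct realizations in distinct
    classes. *)
Lemma pinned_count (i0 : I) :
  (#|I|%:R%:E <= r2_graph R (graph_of ((a, b) :: s)))%E.
Proof.
pose p0 := q i0.
have [e e0 sep] := qsep.
have /choice[de deP] i : exists de : R, 0 < de /\ forall t : constr V -> R,
    (forall c, c \in pins a b s -> `|cval c (q i) - t c| <= de) ->
    exists q', [/\ forall c, c \in pins a b s -> cval c q' = t c,
      forall v k, `|q' v 0 k - q i v 0 k| <= e & regular (pins a b s) q'].
  have [de de0 H] := regular_open (pins_uniq G) (pins_size G) (qreg i) e0.
  by exists de.
have [d d0 dP] := @seq_lower_bound R _ (enum I) de (fun i _ => (deP i).1).
have [eta eta0 etaP] := cval_continuous (pins a b s) p0 d0.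
have [pc [pcp gen']] := generic_dense (fun k => coords p0 0 k) eta0.
pose p := conf (\row_k pc k) : V -> 'rV[R]_2.
have gen : generic_configuration p.
  move=> P P0; rewrite (_ : (fun k => _) = pc); first exact: gen'.
  by apply/funext => k; rewrite !mxE -surjective_pairing enum_valK.
have near c : c \in pins a b s -> `|cval c p - cval c p0| <= d.
  apply: etaP => v k; have := pcp (enum_rank (v, k)).
  by rewrite !mxE enum_rankK => /ltW.
have /choice[q' q'P] i : exists q', [/\
    forall c, c \in pins a b s -> cval c q' = cval c p,
    forall v k, `|q' v 0 k - q i v 0 k| <= e & regular (pins a b s) q'].
  apply: (deP i).2 => c cs; rewrite (qsame i i0 cs) distrC.
  by apply: le_trans (near c cs) _; apply: dP; rewrite mem_enum.
have reg : regular (pins a b s) p.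
  exact (generic_regular (pins_uniq G) (pins_size G) gen (qreg i0)).
pose lam := induced_length p.
have plam : embeddings (graph_of ((a, b) :: s)) lam p.
  by move=> u v _; rewrite /lam induced_lengthE.
have fin := finite_num_embeddings G gen reg plam.
have numE : num_embeddings 2 (graph_of ((a, b) :: s)) lam =
    (#|` fset_set [set motion_class rho |
      rho in embeddings (d := 2) (graph_of ((a, b) :: s)) lam]|)%:R%:E.
  by rewrite /num_embeddings /counting asboolT.
apply: (@le_trans _ _ (num_embeddings 2 (graph_of ((a, b) :: s)) lam)); last first.
  apply: ereal_sup_ubound; exists lam => //; split; last by rewrite numE ltry.
  move=> A; have irr x : x \in (a, b) :: s -> x.1 != x.2.
    rewrite inE => /orP[/eqP->|xs]; first exact: pinned_neq G.
    exact: (pinned_irr G xs).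
  move=> /(graph_ofP _ irr)[x xs ->].
  rewrite /lam induced_lengthE edistE sqrtr_gt0 lt_neqAle sqd_ge0 andbT.
  rewrite eq_sym; apply: contra_neq (generic_neq gen (irr x xs)).
  exact: sqd_eq0.
rewrite numE lee_fin ler_nat.
have cinj : injective (fun i => motion_class (q' i)).
  move=> i j E; apply: (sep i j (q' i)); first by case: (q'P i).
  have [/same_pinsP[ai bi _] _ _] := q'P i.
  have [/same_pinsP[aj bj _] _ _] := q'P j.
  have -> : q' i = q' j.
    apply: (motion_class_inj (a := a) (b := b)) E; rewrite ?ai ?bi ?aj ?bj//.
    exact: generic_neq (pinned_neq G).
  by case: (q'P j).
rewrite cardE -(size_map (fun i => motion_class (q' i))).
have un : uniq [seq motion_class (q' i) | i <- enum I].
  by rewrite map_inj_uniq ?enum_uniq.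
rewrite -(undup_id un) -card_fseq.
apply: fsubset_leq_card; apply/fsubsetP => X; rewrite inE => /mapP[i _ ->].
rewrite in_fset_set//; apply/mem_set; exists (q' i) => //.
have [/same_pinsP[ai bi si] _ _] := q'P i.
apply/(embeddingsP G) => x xs; rewrite /lam induced_lengthE; apply/edist_eq.
by move: xs; rewrite inE => /orP[/eqP->|/si//]; rewrite /= ai bi.
Qed.

Lemma pinned_r2 (i0 : I) n : #|V| = n -> (#|I|%:R%:E <= r2 R n)%E.
Proof.
move=> Vn; apply: le_trans (pinned_count i0) _; apply: ereal_sup_ubound.
exists V, (graph_of ((a, b) :: s)); split => //.
exact: pinned_laman G _ (qreg i0).
Qed.

End CountPinned.

(** * Fans of graphs sharing a triangle *)

Definition t0 : 'I_3 := @Ordinal 3 0 isT.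
Definition t1 : 'I_3 := @Ordinal 3 1 isT.
Definition t2 : 'I_3 := @Ordinal 3 2 isT.

Definition cmap (V W : Type) (f : V -> W) (c : constr V) : constr W :=
  match c with
  | inl vi => inl (f vi.1, vi.2)
  | inr e => inr (f e.1, f e.2)
  end.

Section Fans.
Variable R : realType.

Lemma cval_cmap (V W : Type) (f : V -> W) c (q : W -> 'rV[R]_2) :
  cval (cmap f c) q = cval c (q \o f).
Proof. by case: c. Qed.

Lemma cdiff_cmap (V W : Type) (f : V -> W) c (q h : W -> 'rV[R]_2) :
  cdiff (cmap f c) q h = cdiff c (q \o f) (h \o f).
Proof. by case: c. Qed.

Lemma cdiffD (V : Type) (c : constr V) (q h h' : V -> 'rV[R]_2) :
  cdiff c q (fun v => h v + h' v) = cdiff c q h + cdiff c q h'.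
Proof. by case: c => [[v i]|[u v]] /=; rewrite /dot !mxE//; ring. Qed.

Variable T : 'I_3 -> 'rV[R]_2.

(** All realizations put the triangle at the same place [T], so that whatever is attached to it can
    be realized independently of the rest. Mirror images are excluded here and added once, in
    [fan_r2]. *)
Record fan (V : finType) (tri : 'I_3 -> V) (s : seq (V * V)) (I : finType)
    (q : I -> V -> 'rV[R]_2) : Prop := Fan {
  fan_graph : pinned_graph (tri t0) (tri t1) s;
  fan_tri : injective tri;
  fan_pos : forall i k, q i (tri k) = T k;
  fan_reg : forall i, regular (pins (tri t0) (tri t1) s) (q i);
  fan_same : forall i j e, e \in s -> cval (inr e) (q i) = cval (inr e) (q j);
  fan_inj : forall i j, q i =1 q j -> i = j
}.

Definition glue (V W : Type) (q : V -> 'rV[R]_2) (w : W -> 'rV[R]_2)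
    (x : V + W) : 'rV[R]_2 :=
  match x with inl v => q v | inr y => w y end.

(* A block of new vertices [W] attached to a fixed triangle by edges [es],
   together with pairwise distinct regular realizations [w]. *)
Record attachment (W : finType) (es : seq (('I_3 + W) * ('I_3 + W)))
    (J : finType) (w : J -> W -> 'rV[R]_2) : Prop := Attachment {
  att_irr : forall e, e \in es -> e.1 != e.2;
  att_new : forall e, e \in es -> is_inl e.1 -> ~~ is_inl e.2;
  att_uniq : uniq es;
  att_size : (size es = #|W| * 2)%N;
  att_connected : forall S : 'I_3 + W -> Prop, (forall k, S (inl k)) ->
    (forall e, e \in es -> S e.1 <-> S e.2) -> forall x, S x;
  att_reg : forall j (t : constr ('I_3 + W) -> R), exists h : W -> 'rV[R]_2,
    forall e, e \in es ->
      cdiff (inr e) (glue T (w j)) (glue (fun=> 0) h) = t (inr e);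
  att_same : forall i j e, e \in es ->
    cval (inr e) (glue T (w i)) = cval (inr e) (glue T (w j));
  att_inj : forall i j, w i =1 w j -> i = j
}.

Section Attach.
Variables (V W I J : finType) (tri : 'I_3 -> V) (s : seq (V * V)).
Variables (q : I -> V -> 'rV[R]_2) (es : seq (('I_3 + W) * ('I_3 + W))).
Variable w : J -> W -> 'rV[R]_2.
Hypotheses (F : fan tri s q) (A : attachment es w).

Definition attach_vertex (x : 'I_3 + W) : V + W :=
  match x with inl k => inl (tri k) | inr y => inr y end.

Let inl2 (e : V * V) : (V + W) * (V + W) := (inl e.1, inl e.2).
Let att2 e := (attach_vertex e.1, attach_vertex e.2).

Definition attach_edges : seq ((V + W) * (V + W)) := map inl2 s ++ map att2 es.

Let attach_vertex_inj : injective attach_vertex.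
Proof. by move=> [k|y] [k'|y'] //= [] => [/(fan_tri F)|] ->. Qed.

Lemma attach_pinned : pinned_graph (inl (tri t0)) (inl (tri t1)) attach_edges.
Proof.
have G := fan_graph F; split.
- by apply: contra_neq (pinned_neq G) => -[].
- move=> e; rewrite mem_cat => /orP[] /mapP[e' e's ->] /=.
    by apply: contra_neq (pinned_irr G e's) => -[].
  by apply: contra_neq (att_irr A e's) => /attach_vertex_inj.
- rewrite cat_uniq !map_inj_uniq ?(pinned_uniq G) ?(att_uniq A).
  + rewrite andbT /=; apply/hasPn => _ /mapP[e ees ->].
    apply/negP => /mapP[[u v] _ [] /=].
    have := att_new A ees; case: e {ees} => [[k|y] [k'|y']] //=.
    by move=> /(_ isT).
  + by move=> [x y] [x' y'] [/attach_vertex_inj -> /attach_vertex_inj ->].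
  + by move=> [x y] [x' y'] [-> ->].
- rewrite size_cat !size_map card_sum mulnDl -(pinned_size G) (att_size A).
  by rewrite addnAC.
- move=> S Sa H.
  have SV v : S (inl v).
    apply: (pinned_connected G (S := fun v => S (inl v))) => // e.
    rewrite inE => /orP[/eqP->|es']; first by apply: (H (_, _)); rewrite inE eqxx.
    by apply: (H (inl2 e)); rewrite inE mem_cat map_f ?orbT.
  case=> [v|y]; first exact: SV.
  apply: (att_connected A (S := fun x => S (attach_vertex x)) _ _ (inr y)) =>
    // [k|e ees].
    exact: SV.
  apply: (H (att2 e)); rewrite inE mem_cat; apply/orP; right; apply/orP; right.
  exact: map_f.
Qed.

(** The differential is block triangular: the constraints of the old graph involve only old
    vertices, and those of the block can be solved by moving only new vertices. *)
Lemma fan_attach :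
  fan (inl \o tri) attach_edges (fun ij : I * J => glue (q ij.1) (w ij.2)).
Proof.
have glueE i j : glue (q i) (w j) \o attach_vertex =1 glue T (w j).
  by case=> [k|y] //=; rewrite (fan_pos F).
split.
- exact: attach_pinned.
- by move=> k k' /= [] /(fan_tri F).
- by move=> [i j] k /=; rewrite (fan_pos F).
- move=> [i j] t /=.
  have [h hP] := fan_reg F i (fun c => t (cmap inl c)).
  (* The velocity already given to the triangle. Its effect on the block constraints is subtracted
     from the target before solving for the new vertices. *)
  pose h0 : 'I_3 + W -> 'rV[R]_2 := glue (h \o tri) (fun=> 0).
  have [h' h'P] := att_reg A j (fun c => t (cmap attach_vertex c) -
    cdiff c (glue T (w j)) h0).
  exists (glue h h'); apply/pinsP; have [ha hb hs] := (pinsP _ _ _ _).1 hP.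
  split => //= e; rewrite mem_cat => /orP[] /mapP[e' e's ->].
    exact: (hs _ e's).
  have -> : inr (att2 e') = cmap attach_vertex (inr e') by case: e' e's.
  have hE : glue h h' \o attach_vertex =1 fun x => h0 x + glue (fun=> 0) h' x.
    by case=> [k|y] /=; rewrite ?addr0 ?add0r.
  rewrite -[LHS]/(cdiff (cmap attach_vertex (inr e')) (glue (q i) (w j)) (glue h h')).
  by rewrite cdiff_cmap (cdiff_ext (inr e') (glueE i j) hE) cdiffD (h'P _ e's); ring.
- move=> [i j] [i' j'] e; rewrite mem_cat => /orP[] /mapP[e' e's ->].
    have -> : inr (inl2 e') = cmap inl (inr e') by case: e' e's.
    rewrite !cval_cmap /=; exact: (fan_same F _ _ e's).
  have -> : inr (att2 e') = cmap attach_vertex (inr e') by case: e' e's.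
  rewrite !cval_cmap !(cval_ext _ (glueE _ _)); exact: (att_same A _ _ e's).
- move=> [i j] [i' j'] E; congr pair.
    by apply: (fan_inj F) => v; exact: (E (inl v)).
  by apply: (att_inj A) => y; exact: (E (inr y)).
Qed.

End Attach.

Definition fan_exists n N := exists (V : finType) (tri : 'I_3 -> V)
  (s : seq (V * V)) (I : finType) (q : I -> V -> 'rV[R]_2),
  [/\ fan tri s q, #|V| = n & #|I| = N].

Lemma fan_exists_attach n N (W J : finType)
    (es : seq (('I_3 + W) * ('I_3 + W))) (w : J -> W -> 'rV[R]_2) :
  fan_exists n N -> attachment es w -> fan_exists (n + #|W|) (N * #|J|).
Proof.
move=> [V [tri [s [I [q [F <- <-]]]]]] A.
exists (V + W)%type, (inl \o tri), (attach_edges tri s es), (I * J)%type.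
exists (fun ij => glue (q ij.1) (w ij.2)); split; first exact: fan_attach.
  by rewrite card_sum.
by rewrite card_prod.
Qed.

Lemma dot_solve (u v : 'rV[R]_2) (r1 r2 : R) :
  u 0 0 * v 0 1 - u 0 1 * v 0 0 != 0 ->
  exists z, dot u z = r1 /\ dot v z = r2.
Proof.
set D := _ - _ => D0.
pose z0 := (r1 * v 0 1 - r2 * u 0 1) / D; pose z1 := (r2 * u 0 0 - r1 * v 0 0) / D.
exists (\row_i if i == 0 then z0 else z1); rewrite /dot !mxE /=.
have e0 : z0 * D = r1 * v 0 1 - r2 * u 0 1 by rewrite /z0 divfK.
have e1 : z1 * D = r2 * u 0 0 - r1 * v 0 0 by rewrite /z1 divfK.
split; apply: (mulIf D0).
  transitivity (u 0 0 * (z0 * D) + u 0 1 * (z1 * D)); first by ring.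
  by rewrite e0 e1 /D; ring.
transitivity (v 0 0 * (z0 * D) + v 0 1 * (z1 * D)); first by ring.
by rewrite e0 e1 /D; ring.
Qed.

(** The determinant of the two edge vectors, nonzero when [x] is off the line through [T t0] and
    [T t1]. *)
Let nondegenerate (x : 'rV[R]_2) :=
  (T t0 - x) 0 0 * (T t1 - x) 0 1 - (T t0 - x) 0 1 * (T t1 - x) 0 0 != 0.

Lemma fan_triangle : nondegenerate (T t2) -> fan_exists 3 1.
Proof.
move=> nd; exists 'I_3, id, [:: (t0, t2); (t1, t2)], unit, (fun=> T).
split; [split => //|exact: card_ord|exact: card_unit].
- split => //; first by move=> e; rewrite !inE => /orP[] /eqP ->.
    by rewrite card_ord.
  move=> S S0 H; have S1 : S t1 by rewrite -(H (t0, t1)) ?inE ?eqxx.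
  have S2 : S t2 by rewrite -(H (t0, t2)) ?inE ?eqxx ?orbT.
  by case=> -[|[|[|]]] //= p; [move: S0|move: S1|move: S2]; congr S; exact/val_inj.
- move=> _ t.
  pose ha : 'rV[R]_2 := \row_i t (inl (t0, i)).
  pose hb : 'rV[R]_2 := \row_i t (inl (t1, i)).
  have [z [z1 z2]] := dot_solve
    (dot (T t0 - T t2) ha - t (inr (t0, t2)) / 2)
    (dot (T t1 - T t2) hb - t (inr (t1, t2)) / 2) nd.
  exists (fun k => if k == t0 then ha else if k == t1 then hb else z).
  apply/pinsP; split => [i|i|e]; rewrite /= ?mxE//.
  have dB (x y y' : 'rV[R]_2) : dot x (y - y') = dot x y - dot x y'.
    by rewrite /dot !mxE; ring.
  by rewrite !inE => /orP[] /eqP -> /=; rewrite dB ?z1 ?z2; field.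
- by move=> [] [].
Qed.

Definition mir (x : 'rV[R]_2) : 'rV[R]_2 :=
  \row_i if i == 0 then x 0 0 else - x 0 1.

Lemma dot_mir x y : dot (mir x) (mir y) = dot x y.
Proof. by rewrite /dot !mxE /= mulrNN. Qed.

Lemma mirB x y : mir (x - y) = mir x - mir y.
Proof. by apply/rowP => i; rewrite !mxE; case: ifP => _ //; rewrite opprD. Qed.

Lemma mirK : involutive mir.
Proof. by move=> x; apply: rowP2; rewrite !mxE /= ?opprK. Qed.

Lemma cdiff_mir (V : Type) (e : V * V) (p h : V -> 'rV[R]_2) :
  cdiff (inr e) (mir \o p) (mir \o h) = cdiff (inr e) p h.
Proof. by rewrite /= -!mirB dot_mir. Qed.

Hypotheses (T0 : T t0 0 1 = 0) (T1 : T t1 0 1 = 0) (T2 : T t2 0 1 != 0).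
Hypothesis T01 : T t0 != T t1.

(** A vertex joined to two fixed ones has two mirror positions. One of those used lies on [T t2]
    itself, which is allowed since embeddings need not be injective. *)
Lemma vertex_attachment : exists (es : seq (('I_3 + unit) * ('I_3 + unit)))
  (w : bool -> unit -> 'rV[R]_2), attachment es w.
Proof.
exists [:: (inl t0, inr tt); (inl t1, inr tt)].
exists (fun (b : bool) _ => if b then T t2 else mir (T t2)).
have T01' : T t0 0 0 != T t1 0 0.
  by apply: contra_neq T01 => e; apply: rowP2; rewrite // T0 T1.
split.
- by move=> e; rewrite !inE => /orP[] /eqP ->.
- by move=> e; rewrite !inE => /orP[] /eqP ->.
- by [].
- by rewrite card_unit.
- move=> S Sk H [k|[]]; first exact: Sk.
  by rewrite -(H (inl t0, inr tt)) ?inE ?eqxx//; exact: Sk.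
- move=> b t; set x := if b then _ else _.
  have x1 : x 0 1 != 0 by rewrite /x; case: (b); rewrite ?mxE /= ?oppr_eq0.
  have nd : nondegenerate x.
    rewrite /nondegenerate !mxE T0 T1 (_ : _ - _ = x 0 1 * (T t1 0 0 - T t0 0 0)).
      by rewrite mulf_neq0// subr_eq0 eq_sym.
    by ring.
  have [z [z1 z2]] := dot_solve (- t (inr (inl t0, inr tt)) / 2)
    (- t (inr (inl t1, inr tt)) / 2) nd.
  exists (fun=> z) => e.
  have dB (y y' : 'rV[R]_2) : dot y (0 - y') = - dot y y'.
    by rewrite /dot !mxE; ring.
  by rewrite !inE => /orP[] /eqP -> /=; rewrite dB ?z1 ?z2; field.
- have M k : k = t0 \/ k = t1 -> mir (T k) = T k.
    by move=> kk; apply: rowP2; rewrite !mxE//=; case: kk => ->;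
      rewrite ?T0 ?T1 oppr0.
  suff H b e : e \in [:: (inl t0, inr tt); (inl t1, inr tt)] ->
      cval (inr e) (glue T (fun _ : unit => if b then T t2 else mir (T t2))) =
      cval (inr e) (glue T (fun=> T t2)).
    by move=> i j e ees; rewrite !H.
  case: b => //; rewrite !inE => /orP[] /eqP -> /=;
    by rewrite -{1 2}[T _]M; [rewrite -mirB dot_mir|auto].
- have mT : mir (T t2) <> T t2.
    move=> /(congr1 (fun x : 'rV[R]_2 => x 0 1)); rewrite mxE /= => /eqP.
    by rewrite -subr_eq0 -opprD oppr_eq0 -mulr2n mulrn_eq0 (negbTE T2).
  by move=> [] [] // /(_ tt) // /esym.
Qed.

(** Reflection in the line through [T t0] and [T t1] keeps all pins and lengths but moves the third
    triangle vertex, which tells mirror images apart. *)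
Lemma fan_r2 n N : (0 < N)%N -> fan_exists n N -> ((N * 2)%:R%:E <= r2 R n)%E.
Proof.
move=> N0 [V [tri [s [I [q [F Vn IN]]]]]].
have G := fan_graph F.
have [i0 _] : exists i : I, i \in predT by apply/card_gt0P; rewrite IN.
pose Q (ib : I * bool) v := if ib.2 then q ib.1 v else mir (q ib.1 v).
have M k : k = t0 \/ k = t1 -> mir (T k) = T k.
  by move=> kk; apply: rowP2; rewrite !mxE//=; case: kk => ->;
    rewrite ?T0 ?T1 oppr0.
have -> : (N * 2)%N = #|{: I * bool}| by rewrite card_prod card_bool IN.
apply: (pinned_r2 G (q := Q)) Vn; last exact: (i0, true).
- move=> [i []] t; first exact: (fan_reg F).
  (* The required velocity of the reflected realization is the mirror image of one of [q i]; as
     reflection negates second coordinates, so are the targets at the pins. *)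
  have [h hP] := fan_reg F i (fun c => match c with
    | inl (v, k) => if k == 0 then t c else - t c | inr _ => t c end).
  have [ha hb hs] := (pinsP _ _ _ _).1 hP.
  exists (mir \o h); apply/pinsP; split => [k|k|e es].
  + rewrite /= mxE; have := ha 0; have := ha 1 => /= h1 h0.
    case: eqP => [->|/eqP k0]; first exact: h0.
    by rewrite h1 opprK; congr (t (inl (_, _))); move: k k0; apply: ord2P.
  + rewrite /= mxE; have := hb 0; have := hb 1 => /= h1 h0.
    case: eqP => [->|/eqP k0]; first exact: h0.
    by rewrite h1 opprK; congr (t (inl (_, _))); move: k k0; apply: ord2P.
  + by rewrite -(hs e es); exact: cdiff_mir.
- suff H ib c : c \in pins (tri t0) (tri t1) s -> cval c (Q ib) = cval c (q i0).
    by move=> ib jb c cs; rewrite !H.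
  move: c; apply/same_pinsP; case: ib => i b; rewrite /Q /=; split.
  + by rewrite !(fan_pos F); case: b => //; rewrite M//; left.
  + by rewrite !(fan_pos F); case: b => //; rewrite M//; right.
  + move=> e es; have := fan_same F i i0 es => /= E.
    by rewrite /sqd -E; case: b => //; rewrite -mirB dot_mir.
- have mT : mir (T t2) <> T t2.
    move=> /(congr1 (fun x : 'rV[R]_2 => x 0 1)); rewrite mxE /= => /eqP.
    by rewrite -subr_eq0 -opprD oppr_eq0 -mulr2n mulrn_eq0 (negbTE T2).
  move=> [i b] [j c] E; have := E (tri t2); rewrite /Q /= !(fan_pos F) => E2.
  have bc : b = c by move: E2; case: b {E}; case: c => // /esym.
  rewrite bc; congr pair; apply: (fan_inj F) => v.
  by have := E v; rewrite /Q /= bc; case: c {bc E E2} => // /(can_inj mirK).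
Qed.

End Fans.

(** * A block of seven vertices with 430 realizations *)

Section Certificate.
Local Open Scope Z_scope.

Definition zpoint := (Z * Z)%type.

Definition zsub (p q : zpoint) : zpoint := (p.1 - q.1, p.2 - q.2).
Definition zdot (p q : zpoint) : Z := p.1 * q.1 + p.2 * q.2.
Definition znth (s : seq zpoint) (n : nat) : zpoint := nth (0, 0) s n.
Definition zvec (s : seq zpoint) (e : nat * nat) : zpoint :=
  zsub (znth s e.1) (znth s e.2).
Definition zsum (s : seq Z) : Z := foldr Z.add 0 s.

(* Vertices 0, 1, 2 form the triangle and 3, ..., 9 the block. Coordinates are
   in units of 2^-20, squared lengths in units of 2^-12. *)
Definition ztriangle : seq zpoint :=
  [:: (0, 0); (2164736, 0); (-515072, 1085440)].

Definition zedges : seq (nat * nat * Z) :=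
  [:: (0%N, 3%N, 25125); (1%N, 4%N, 22629); (3%N, 4%N, 19917);
      (2%N, 5%N, 19580); (3%N, 5%N, 20415); (2%N, 6%N, 25451);
      (4%N, 6%N, 19060); (5%N, 7%N, 22541); (6%N, 7%N, 20095);
      (7%N, 8%N, 19048); (3%N, 8%N, 20533); (7%N, 9%N, 19274);
      (4%N, 9%N, 19906); (8%N, 9%N, 19941)].

(* For each of the vertices 4, ..., 9: its two earlier neighbours, and the
   positions of the two corresponding edges in [zedges]. *)
Definition zdyads : seq (nat * nat * (nat * nat)) :=
  [:: (1, 3, (1, 2)); (2, 3, (3, 4)); (2, 4, (5, 6)); (5, 6, (7, 8));
      (7, 3, (9, 10)); (7, 4, (11, 12))]%N.

(* Fixed-point inverse of the Jacobian, with 17 fractional bits. The graph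
   without the edge (8, 9) is a linkage of one degree of freedom in which
   vertices 4, ..., 9 are obtained from two earlier ones, so that the linear
   system is triangular up to the motion [w] of the linkage. Nothing is proved
   about the result, which is checked a posteriori. *)
Definition zinverse (P : seq zpoint) : seq (seq zpoint) :=
  let d (v a : nat) := let e := zvec P (v, a) in
    (Z.shiftr e.1 8, Z.shiftr e.2 8) in
  let dyads := map (fun vd =>
    let: (v, (a, b, (ea, eb))) := vd in
    let p := d v a in let q := d v b in
    let det := p.1 * q.2 - p.2 * q.1 in
    let inv z := Z.shiftl z 26 / det in
    (a, b, ea, eb, p, q, (inv q.2, inv (- p.2), inv (- q.1), inv p.1)))
    (zip (iota 4 6) zdyads) in
  let rhs (j e : nat) := if Nat.eqb j e then 65536 else 0 in
  let propagate h3 (j : nat) := foldl (fun h dy =>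
    let: (a, b, ea, eb, p, q, (m11, m12, m21, m22)) := dy in
    let ra := Z.shiftr (zdot p (znth h a)) 12 + rhs j ea in
    let rb := Z.shiftr (zdot q (znth h b)) 12 + rhs j eb in
    h ++ [:: (Z.shiftr (m11 * ra + m12 * rb) 14,
              Z.shiftr (m21 * ra + m22 * rb) 14)])
    [:: (0, 0); (0, 0); (0, 0); h3] dyads in
  let d30 := d 3%N 0%N in
  let n30 := zdot d30 d30 in
  let d89 := d 8%N 9%N in
  let closing h := Z.shiftr (zdot d89 (zvec h (8, 9)%N)) 12 in
  let w := propagate (Z.shiftl (- d30.2) 5, Z.shiftl d30.1 5) 14%N in
  let cw := closing w in
  map (fun j =>
    let h := propagate (if Nat.eqb j 0 then
      (Z.shiftl d30.1 28 / n30, Z.shiftl d30.2 28 / n30) else (0, 0)) j in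
    let s := Z.shiftl (rhs j 13%N - closing h) 17 / cw in
    map (fun xw => (xw.1.1 + Z.shiftr (s * xw.2.1) 17,
                    xw.1.2 + Z.shiftr (s * xw.2.2) 17))
      (zip (drop 3 h) (drop 3 w))) (iota 0 14).

Definition zcolumn (B : seq (seq zpoint)) (j : nat) : seq zpoint :=
  [:: (0, 0); (0, 0); (0, 0)] ++ nth [::] B j.

Definition zedge (i : nat) : nat * nat := (nth (0%N, 0%N, 0) zedges i).1.
Definition zlength (i : nat) : Z := (nth (0%N, 0%N, 0) zedges i).2.

(* [newton_kantorovich] is applied with a defect of at most 1/2, an inverse of
   norm at most 13, residuals of at most 2^-16 and radius 2^-14, so that the
   exact solutions lie within 13 * 2^-14 of the approximations. Directions are
   in units of 2^-17, hence derivatives are in units of 2^-37. *)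
Definition zunit : Z := 2 ^ 37.
Definition zunit_half : Z := 2 ^ 36.
Definition zresidual_bound : Z := 2 ^ 24.
Definition znorm_bound : Z := 13 * 2 ^ 17.
Definition zseparation : Z := 13 * 2 ^ 7.

(** Squares of coordinates are in units of 2^-40, hence the shift of the stored lengths by 28
    bits. *)
Definition residual_check (P : seq zpoint) : bool :=
  all (fun i => let d := zvec P (zedge i) in
    Z.leb (Z.abs (zdot d d - Z.shiftl (zlength i) 28)) zresidual_bound)
    (iota 0 14).

Definition zdefect (P : seq zpoint) (B : seq (seq zpoint)) (i j : nat) : Z :=
  (if Nat.eqb i j then zunit else 0) -
  2 * zdot (zvec P (zedge i)) (zvec (zcolumn B j) (zedge i)).

Definition defect_check (P : seq zpoint) (B : seq (seq zpoint)) : bool :=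
  all (fun i => Z.leb
    (zsum (map (fun j => Z.abs (zdefect P B i j)) (iota 0 14))) zunit_half)
    (iota 0 14).

Definition norm_check (B : seq (seq zpoint)) : bool :=
  all (fun k =>
    Z.leb (zsum (map (fun j => Z.abs (znth (zcolumn B j) k).1) (iota 0 14)))
      znorm_bound &&
    Z.leb (zsum (map (fun j => Z.abs (znth (zcolumn B j) k).2) (iota 0 14)))
      znorm_bound) (iota 0 10).

Definition newton_check (l : seq zpoint) : bool :=
  let P := ztriangle ++ l in
  Nat.eqb (size l) 7 && residual_check P &&
  (let B := zinverse P in defect_check P B && norm_check B).

(** The threshold is 13 * 2^-13 in real length, twice the distance from an approximation to its
    exact solution. *)
Definition separated (l l' : seq zpoint) : bool :=
  has (fun pq => Z.ltb zseparation (Z.abs (pq.1.1 - pq.2.1)) ||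
    Z.ltb zseparation (Z.abs (pq.1.2 - pq.2.2))) (zip l l').

Fixpoint zpairs (l : seq Z) : seq zpoint :=
  if l is x :: y :: l' then (x, y) :: zpairs l' else [::].

(** Candidate positions of the vertices 3, ..., 9, with the triangle kept at [ztriangle];
    [newton_check] certifies each one and [separated] tells them apart. *)
Definition approximations : seq (seq zpoint) := map zpairs [::
[:: -2575584; -332878; -264791; -414517; -2613946; 2007771; -2519775; -591795;
-559877; 654403; -603300; -1606409; -2576329; -398092];
[:: -2575465; -333794; -298885; 70694; -2614352; 2006846; -2426393; -697480;
-549310; 670281; -592441; -1590537; -2565626; -382475];
[:: -2574981; -337514; -264155; -418227; -400394; -1204279; -2519392; -592252;
-1015293; 1177464; -314769; -972518; -2574973; -478200];
[:: -2565229; -405019; -299279; 55303; -2644602; 1934598; -2435850; -687287;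
-542253; 657518; -2406456; 1937325; -2571334; -370420];
[:: -2555215; -464025; -243736; -523152; -2667691; 1874235; -2503991; -610482;
-543209; 634324; -2430151; 1880361; -2553454; -429979];
[:: -2555162; -464315; -299505; 44057; -332767; -1199890; -2442358; -680210;
-1025778; 1160309; -262125; -968069; -2535929; -540651];
[:: -2548699; 498575; -237100; 552819; -909735; -1172924; -1453969; -1353909;
-2452346; 743102; -201189; 529911; -1554354; -1346739];
[:: -2548631; 498917; -237032; 553115; -909974; -1172882; -1452628; -1354425;
-2456576; 739925; -201918; 567645; -1216660; 2646869];
[:: -2544849; 517866; -233191; 569535; -923282; -1170515; -1375901; -1382540;
-2714388; 515529; -3777712; -1480091; -1466003; -1385881];
[:: -2544815; 518032; -233157; 569678; -2034063; 2802598; -1375209; -1382781;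
-2787540; 461001; -3938023; 2407677; -1624409; 2415727];
[:: -2544743; 518384; -233085; 569984; -923647; -1170449; -1373734; -1383294;
-2722063; 507795; -3873339; 2454002; -1559730; 2462995];
[:: -2542250; 530475; -230557; 580514; -932192; -1168884; -1321983; -1400691;
-589653; -3604756; -1806882; -1699103; 505064; -1610910];
[:: -2539981; 541236; -228259; 589916; -2011985; 2821878; -1274101; -1415725;
-600809; 807086; -1752608; 2752984; 560999; 2762598];
[:: -2535297; -562769; -223521; -608814; -281383; -1195208; -2485343; -632112;
-1003471; 1156258; -3201158; 1688545; -2533658; -526701];
[:: -2535218; -563124; -299743; 27706; -281199; -1195189; -2451239; -670466;
-1013086; 1153245; -3210834; 1685282; -2543081; -529888];
[:: -2533038; -572851; -221239; -617698; -2705639; 1761741; -2483117; -634662;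
-4635896; 236975; -4388921; -2010726; -2532804; -629530];
[:: -2532140; 576810; -220331; 621194; -1977406; 2851097; -1103203; -1461333;
-2443096; 435743; -3515144; -1555205; -1203046; -1471113];
[:: -2532001; 577417; -220191; 621730; -1976809; 2851592; -1100116; -1462044;
-2439200; 435604; -184467; 606895; -1200120; -1471883];
[:: -2531913; 577804; -220102; 622071; -1976427; 2851907; -1098145; -1462496;
-2436711; 435517; -185134; 644225; -1534559; 2523565];
[:: -2531652; -578947; -299769; 25311; -2707588; 1755396; -2452484; -669092;
-4608583; 194300; -4358854; -2053097; -2504432; -669627];
[:: -2530910; 582182; -219089; 625941; -969207; -1161720; -1075680; -1467533;
-3396316; -1561649; -1148535; -1315402; -2529130; 541161];
[:: -2529860; 586726; -218030; 629962; -972497; -1161052; -1052040; -1472609;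
-3355153; -1772407; -4795360; -29145; -2511355; 339897];
[:: -2526570; -600736; -214711; -642385; -261798; -1193116; -2476652; -642030;
-2015253; -2918282; -325021; -1416192; -2525547; -701657];
[:: -2519869; 628254; -207957; 666899; -1002853; -1154657; -820927; -1510404;
1454548; -1045190; -174508; 523036; 2052733; 1149349];
[:: -2519074; 631434; -207156; 669741; -1005199; -1154145; -802126; -1512550;
1443421; -919481; -171570; 663227; -732772; -1581305];
[:: -2514716; -648570; -299851; 15359; -237287; -1190258; -2457511; -663526;
-1971596; -2934671; -4151054; -2332074; -2491286; -720230];
[:: -2510467; -664828; -299864; 13157; -228996; -1189231; -2458591; -662325;
-1965117; -2931839; -286447; -1416839; -2492384; -719190];
[:: -2507186; -677096; -195196; -710736; -222752; -1188437; -2456665; -664465;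
-1957235; -2932676; -4144622; -2359531; -2506745; -725447];
[:: -2502322; -694858; -299882; 9194; -2741091; 1633897; -2460507; -660192;
-4657819; 92158; -2976696; 1604436; -2511883; -662019];
[:: -2502227; 695198; -190212; 727079; -1052910; -1143169; -394799; -1525591;
-1517556; -3558724; -2718183; -1642568; -405558; -1574465];
[:: -2499267; -705765; -187239; -736642; -2743897; 1622382; -2448304; -673697;
-4649571; 67001; -2980143; 1592178; -2497892; -670631];
[:: -2485634; 752373; -173552; 778995; -1793305; 2988618; 2087478; 843191;
644945; 2663441; -147052; 545447; 2132256; 942473];
[:: -2479758; 771519; -167658; 796470; -1771822; 3002872; 2092002; 898044;
-222400; 1092350; -1546140; 2925618; -2479223; 808490];
[:: -2473722; 790658; -161605; 813980; -1750060; 3016960; 2095674; 959131;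
-223275; 1088300; -998680; -1035824; -2472255; 747838];
[:: -2472812; 793501; -299897; 3012; -1746803; 3019039; 1951544; 220711; 510855;
2042420; -290476; -72060; 1990561; 314909];
[:: -2470952; 799274; -158828; 821875; -1133657; -1122120; 2096943; 988849;
-219181; 1161417; -1576531; 2969941; -2470381; 835953];
[:: -2467283; 810529; -299894; 5013; -1727159; 3031413; 1951698; 221150;
-195393; 1106706; -1503379; 2951247; -2454565; 842192];
[:: -2466689; 812333; -154555; 833856; -1144053; -1119180; 2098274; 1036697;
1315592; -1149995; -129604; 589133; 2153334; 964719];
[:: -2464775; 818124; -152636; 839174; -1148682; -1117854; 2098595; 1059038;
-221726; 1160645; -953846; -978785; -2463330; 774592];
[:: -2463800; 821055; -151659; 841868; -1714900; 3038995; 2098686; 1070620;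
743566; 2956849; -116503; 865572; -1517271; 2706963];
[:: -2457465; 839825; -145311; 859132; -1166138; -1112759; 616984; -1270489;
102910; 994448; -984366; -988224; 1328309; -921856];
[:: -2454262; 849142; -299881; 9455; -1173685; -1110510; 1952040; 222128;
-181319; 1140271; -1485361; 2987603; -2441051; 880584];
[:: -2450568; 859743; -138401; 877487; -1182311; -1107904; 2094069; 1241431;
1271116; -930425; -102856; 865504; -976986; -1276637];
[:: -2441419; 885388; -299862; 13516; -1638024; 3084176; 1952356; 223029;
630292; 2132573; -247812; 48804; -1632619; 1902228];
[:: -2441314; 885678; -299862; 13548; -1637671; 3084374; 1952358; 223037;
-204143; 1085424; -1055517; -1009408; -2463922; 826148];
[:: -2438523; -893335; -126338; -908518; -114184; -1171827; 1902448; 91685;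
-88366; 1287875; -92168; -973351; 1905665; 193497];
[:: -2434528; -904165; -122338; -918542; -108806; -1170865; -2377852; -748137;
-1000271; 1121752; -87198; -946933; 1266198; 929550];
[:: -2421082; 939575; -299823; 19420; -1248634; -1086622; 1952817; 224350;
-185246; 1131487; -1042658; -960880; -2445763; 878730];
[:: -2393085; 1008755; -299754; 26718; -1308134; -1065611; 1953392; 226000;
1007578; -1895237; -296673; -48054; 2008699; 147207];
[:: -2392178; -1010902; -79954; -1017739; -56014; -1160719; 1897675; 80152;
-79343; 1299008; -44969; -961960; -2058396; 177770];
[:: -2391929; 1011492; -79705; 1018289; -1310528; -1064726; 1849766; 2198765;
-216646; 1138504; -1331246; 3105945; 982126; 3071577];
[:: -2391103; 1013444; -78878; 1020109; -1312238; -1064093; 1409557; -683106;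
-103978; 1078548; -1217345; 3046687; 1096005; 3010870];
[:: -2388674; 1019156; -76448; 1025437; -1467014; 3171051; 1823641; 2252647;
720317; 4296390; -472143; 2375141; 1840751; 2316881];
[:: -2385809; 1025845; -73581; 1031679; -1323135; -1060021; 1440722; -648579;
-110386; 1080083; -1208271; 3056901; -2384940; 1064836];
[:: -2385051; 1027606; -72823; 1033323; -1324688; -1059435; 1444936; -643814;
-111250; 1080278; -1114157; -946378; -2383968; 987647];
[:: -2377009; 1046073; -64779; 1050567; -1341049; -1053188; 1721173; 2438644;
665278; 369998; -425270; 2350872; 1887512; 2288322];
[:: -2373343; 1054364; -299699; 31413; -1348441; -1050318; 1953765; 227071;
968614; -1876185; -266923; 17648; -1299110; -2052970];
[:: -2370056; 1061731; -57824; 1065200; -1409280; 3196449; 1517218; -558260;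
-83829; 1124256; -1194485; 3093926; 1118813; 3054923];
[:: -2368420; 1065377; -56188; 1068609; -1404260; 3198568; 1523982; -549861;
-92940; 1117404; -1188906; 3095286; -2367507; 1104364];
[:: -2368155; 1065966; -55923; 1069159; -1403448; 3198910; 1525059; -548517;
-94307; 1116374; -1099229; -909284; -2367116; 1026003];
[:: -2354605; 1095570; -42371; 1096861; -1385622; -1035435; 1495717; 2755373;
-80659; 1049721; -1089641; 3073360; -2353644; 1135534];
[:: -2354450; 1095904; -42216; 1097173; -1385926; -1035310; 1494068; 2757357;
-78873; 1048536; -1170784; -931587; -2353461; 1056916];
[:: -2353473; 1098001; -41239; 1099137; -1387838; -1034523; 1483665; 2769781;
-66586; 1040349; -1173312; -931532; 1139904; -887916];
[:: -2333481; -1139872; -21247; -1138378; 7472; -1146804; -2265458; -855719;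
-1004969; 1095018; 4684; -928286; -2303684; -772377];
[:: -2329200; 1148594; -16966; 1146561; -1286299; 3244416; 1641116; -391992;
625708; 1696825; -467954; -282332; 1844923; -223419];
[:: -2321124; 1164827; -8892; 1161795; -1262522; 3252762; 1132285; 3114766;
-47294; 1114065; -1051895; 3139882; -2320088; 1204796];
[:: -2320123; 1166821; -7890; 1163667; -1259584; 3253773; 1121485; 3123486;
-44641; 1114914; -1140501; -863026; -2319209; 1127833];
[:: -2311798; 1183229; 433; 1179075; -1235260; 3261973; 1032559; 3191809;
-21700; 1122329; -1132898; -847037; 1180412; -808669];
[:: -2309757; 1187209; 2474; 1182814; -1229320; 3263929; 1677871; -336866;
-200008; 1029803; -1313132; -938473; 1000214; -902370];
[:: -2306083; 1194328; 6146; 1189502; -1477811; -995209; 1683793; -327693;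
566225; -2363683; -618150; -437439; 1694968; -388901];
[:: -2282513; 1238780; 29710; 1231296; -1520777; -974784; 1715978; -276312;
-169106; 1080402; -1284827; -886404; 1028564; -853354];
[:: -2263209; -1273706; -299324; -53220; 73361; -1130347; 1947377; 208914;
-89938; 1324065; 59542; -932219; 1973688; 367365];
[:: -2241866; 1310906; 70339; 1299202; -1036800; 3317875; 386016; 3539007;
248495; 1220538; -846500; 3198958; 1466416; 3141603];
[:: -2201510; -1377605; 110673; -1362076; -2798956; 885836; -2118549; -978734;
-4440859; -945818; -3028122; 819779; -2200826; -1340881];
[:: -2181364; -1409287; 130805; -1391960; 140569; -1111399; -2096193; -995907;
-1232933; -3152060; 166113; -1375595; 1010087; -3529795];
[:: -2175854; 1417779; -298980; 67309; -1703547; -875043; -2428529; -695187;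
-1933612; 1574012; -284514; 26875; -2503513; -628041];
[:: -2174522; 1419822; -298974; 67509; -1705725; -873721; -2428403; -695322;
-1938865; 1575044; -262479; 57516; 209420; 2322506];
[:: -2163554; -1436480; 148603; -1417616; -2792071; 818532; 1879770; 38214;
-333408; 742525; 184060; -1458699; 1859171; 137195];
[:: -2161375; -1439756; 150781; -1420708; -2791627; 814771; 1879624; 37881;
-442435; 85320; -2561831; 873558; -2160762; -1405042];
[:: -2149074; -1458054; 163073; -1437975; -2789028; 793739; -2060405; -1022615;
-4382230; -1080431; -3686815; -3232072; -2147558; -1504773];
[:: -2128774; -1487535; 183358; -1465799; 179774; -1099315; 1877475; 32982;
2359690; -2238951; 218827; -1511033; 1969237; 1891];
[:: -2115291; 1506648; 196832; 1483839; -699075; 3370633; -300538; 3690421;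
-1431907; 5718773; -2625534; 3798249; -312676; 3738585];
[:: -2114691; 1507488; -298722; 76166; -697533; 3370757; -2422870; -701249;
-2426745; 1621292; -2074117; 3854857; -285154; 2387722];
[:: -2112422; 1510667; -298712; 76482; -1804764; -809992; -2422664; -701469;
-2229003; 1612987; -1875279; 3846378; -87036; 2378366];
[:: -2110393; 1513500; -298703; 76764; -1807920; -807840; -2422480; -701665;
-2240207; 1613715; -4333037; 757430; -2494182; -646666];
[:: -2106981; -1518246; 205134; -1494786; 195278; -1094323; 1876071; 29795;
2372514; -2239071; 240511; -1485599; 678791; -3757335];
[:: -2103141; -1523561; 208972; -1499804; -2778026; 718009; 1875826; 29240;
-319191; 788259; 241448; -1402367; -1982238; -763546];
[:: -2100543; -1527141; 211568; -1503183; -2777347; 713851; 1875661; 28866;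
-444886; -67448; 131860; -2253889; -2096467; -1631451];
[:: -2088700; 1543300; -298609; 79741; -631083; 3375092; -2420522; -703753;
-758498; 918556; -373932; 3146844; 1393845; 1654250];
[:: -2079880; 1555165; -298570; 80932; -1854811; -774954; -2419732; -704594;
-2994304; -2954944; -2670751; -716983; -862861; -2160730];
[:: -2079143; 1556151; 232950; 1530565; -606878; 3376191; -416161; 3697368;
1843488; 3160527; 268506; 1538002; -348546; 3767826];
[:: -2075451; 1561071; 236639; 1535209; -597559; 3376545; -426562; 3697741;
1860957; 3295909; 268707; 1690325; 2509874; 1115833];
[:: -2068362; -1570452; 243722; -1544063; 221818; -1085495; -1971188; -1085200;
-1024672; -3206124; 269135; -1351610; -2037303; -1169361];
[:: -2024956; -1626036; 287090; -1596518; -2755264; 598096; -1923341; -1116543;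
-296097; 540650; 322748; -1634250; 1922161; 37501];
[:: -2023937; 1627304; 288108; 1597715; -469374; 3377574; -549092; 3699019;
-2854830; 3977911; -4292333; 2232419; -2007759; 1866917];
[:: -2018091; 1634549; 293949; 1604550; -455041; 3377243; -560638; 3698843;
-2881785; 3779383; -634233; 3531051; -2016550; 1675769];
[:: -1997325; 1659859; 314696; 1628428; -1976447; -681011; -598325; 3697914;
-1904973; 1777788; 349799; 1607022; -967791; -294774];
[:: -1996902; 1660369; 315119; 1628908; -1977052; -680511; -599042; 3697891;
-1906498; 1778316; 350763; 1644416; -699203; 3706077];
[:: -1992046; -1666191; -298171; -92274; 271223; -1068093; 1944642; 201270;
2527965; -2046828; 346005; -1453354; 1999016; 165419];
[:: -1990150; -1668456; -298162; -92509; -2743750; 547891; 1944626; 201225;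
-362262; -67994; -2516442; 619513; -794809; 2165104];
[:: -1985808; 1673621; 326202; 1641408; -1992826; -667332; -617147; 3697246;
-1945469; 1792050; -3027609; 3777531; -715113; 3705176];
[:: -1983805; -1675995; -298133; -93295; -2741571; 538932; 1944572; 201076;
-360892; -80076; -2513899; 611097; -2009761; -1646937];
[:: -1982109; -1678001; -298125; -93505; -2740983; 536546; 1944558; 201036;
-360518; -83281; 295554; -2247243; -1953983; -1706455];
[:: -1972940; 1688771; -298082; 94633; -345790; 3371771; -2410337; -714538;
-2027032; 1576158; -4189171; 914104; -2485886; -651684];
[:: -1953251; 1711505; -297988; 97029; -298943; 3367819; -2408635; -716329;
-1972308; 1564862; -283803; 60830; -2485148; -651175];
[:: -1952498; 1712365; -297985; 97120; -297160; 3367650; -2408570; -716397;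
-1970215; 1564405; -258056; 87356; 159600; 2362973];
[:: -1915546; 1753603; 396396; 1716799; -210575; 3357718; -705304; 3692308;
380242; 5745549; -828448; 3834470; 1483869; 3756622];
[:: -1910523; -1759075; 401414; -1721953; -2714755; 439406; -1797589; -1192081;
-257235; 546171; 432290; -1607364; -1825358; -1101499];
[:: -1909850; 1759805; -297779; 102199; -2097290; -573642; -2404902; -720243;
-4059950; 909182; -2332210; -549610; -1938731; 1730313];
[:: -1906212; 1763745; 405720; 1726351; -2102137; -569006; -714088; 3691652;
-591521; 1372345; -1736107; -577804; 577520; -578852];
[:: -1897868; 1772721; -297721; 103602; -2113204; -558318; -2403875; -721317;
-4180893; 774149; -3889068; 3016468; -2060912; 1598471];
[:: -1891907; 1779081; 420011; 1740793; -156073; 3349747; -726426; 3690681;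
-2054082; 1785021; -3129024; 3774407; -816806; 3693678];
[:: -1889295; 1781854; 422620; 1743404; -150094; 3348791; -728537; 3690509;
-2038799; 1772848; -3179311; -179687; -865687; -175904];
[:: -1886961; 1784326; 424951; 1745730; -2127556; -544241; -730388; 3690356;
-2226187; 1913619; -3364230; -40356; -1050612; -33648];
[:: -1880737; -1790885; -297636; -105590; -2703075; 400888; 1943737; 198756;
-284991; 852194; 414675; -1298068; 1950515; 432269];
[:: -1826149; -1846515; -297362; -111800; -2680640; 332924; -2503524; -611030;
-250392; -47464; 497561; -2181410; 1994011; -416897];
[:: -1819498; 1853070; 492343; 1810394; 6528; 3317905; -770951; 3686685;
-1722049; 1567812; 527549; 1796869; -434461; -307272];
[:: -1818243; -1854301; -297322; -112685; -2677289; 323347; -2503741; -610775;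
-247483; -59859; -2460663; 403814; -906064; 2117317];
[:: -1817301; 1855224; 494537; 1812419; 11357; 3316771; -771897; 3686592;
-1714372; 1563869; 530344; 1836648; -872082; 3676776];
[:: -1816431; -1856077; -297312; -112887; -2676517; 321161; 1943246; 197396;
-312089; -357284; 444603; -2488147; 1933809; -717515];
[:: -1781996; 1889162; -297135; 116701; -2259054; -402677; -2393978; -731608;
-641902; -2256221; -399126; -8062; 1459567; -1385789];
[:: -1772981; 1897625; -297088; 117690; -2269779; -390016; -2393208; -732404;
-560142; -2158616; -280615; 85270; -2405833; -829236];
[:: -1717834; -1947688; -296795; -123660; -2632729; 207092; -2506332; -607733;
-213447; -237745; 595260; -2349415; -1687113; -1970411];
[:: -1714116; -1950961; -296775; -124058; -2631014; 202968; -2506422; -607627;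
-212338; -245152; -2408943; 291582; -1745929; -1925010];
[:: -1702982; 1960687; -296715; 125247; -2349890; -289118; -2387215; -738575;
-4688567; -1051611; -3869401; 1056025; -2433027; -757729];
[:: -1399299; 2187785; -294936; 156329; 812544; 2954504; 1964669; 259103;
-302766; 762043; 896437; 2679090; 1967917; 628529];
[:: -1378807; 2200757; -294806; 158364; -2642038; 229880; -2358568; -767524;
-188131; 59165; -2448765; 111027; -1324644; -1911156];
[:: -1350410; 2218295; -294623; 161175; 890010; 2896989; 1965136; 260505;
3248026; 2196585; 992883; 2362385; 2013595; 286086];
[:: -1340450; -2224328; -294559; -162159; -2441026; -158211; -2513975; -598703;
-4832591; -733730; -3647481; -2659521; -2560990; -616873];
[:: -1287875; 2255176; -294212; 167339; -2698720; 387122; 1965735; 262309;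
-282149; 846455; 1017983; 2696540; 1978127; 591547];
[:: -1277796; 2260902; -294144; 168330; -2704284; 404765; -2349138; -776858;
-251396; 219982; 1061405; 2061099; 2007077; -50435];
[:: -1271808; 2264276; -294104; 168918; -2707521; 415266; -2348569; -777418;
-254836; 227814; 1067207; 2062306; -1236171; 2279839];
[:: -1270258; 2265146; -294093; 169071; -2708351; 417986; -2348421; -777563;
-255720; 229816; -2516488; 275499; -1306200; 2247319];
[:: -1264763; 2268218; -294056; 169610; -2711264; 427636; 1965958; 262979;
-319846; -148494; 1008454; 1681473; 1936263; -437971];
[:: -1263601; 2268866; 1047512; 2196870; 1018768; 2789348; 1907852; 104934;
3328243; 1942513; 1083502; 2215086; 2004589; 92712];
[:: -1258149; 2271894; 1052956; 2199630; 1026478; 2782375; 1908108; 105568;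
3336472; 1936957; 1087412; 2171237; 2458105; 4035123];
[:: -1257781; 2272097; 1053323; 2199815; 1026996; 2781905; -642993; 3696108;
-1009826; 1402717; 1089749; 2242325; -737877; 3661006];
[:: -1229468; 2287542; 1081592; 2213871; 1066297; 2745331; -626358; 3696870;
-995560; 1403859; 1116980; 2210292; 735518; -71672];
[:: -1211580; -2297066; -293691; -174825; 655945; -885521; -2516024; -596268;
-870853; 1043129; 534854; -728069; 1370733; 1429285];
[:: -1179320; -2313794; -293464; -177984; -2351252; -287298; -2516501; -595700;
-943583; -2304542; -301235; -136468; -2547301; -691497];
[:: -1178746; -2314087; -293460; -178040; -2350926; -287734; -2516509; -595691;
-946645; -2307338; -266763; -150739; 1284909; -1866894];
[:: -1170264; 2318388; 1140703; 2241826; 1144589; 2667050; 1912094; 115482;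
-335156; 702067; 1176547; 2383707; -1090068; 2847745];
[:: -1135606; -2335560; -293151; -182261; -2326313; -320039; -2517125; -594957;
-1194007; -2503771; -3433449; -2816915; -2550915; -678223];
[:: -1135527; 2335598; -293150; 182268; -2767284; 657063; 1967212; 266773;
-353780; 181880; -2593194; 495219; -1710847; -1643550];
[:: -1130106; 2338226; -293111; 182799; -2769108; 666765; 1967266; 266935;
-354268; 198417; -2594827; 503458; -1166075; 2323221];
[:: -1129478; 2338530; -293106; 182860; -2769316; 667889; 1967272; 266953;
-354317; 200360; 1170954; 1869703; -1091828; 2352081];
[:: -1126015; -2340199; -293081; -183199; -2320812; -327100; -2517258; -594798;
-1252925; -2543046; 187801; -4285880; 980520; -2112296];
[:: -1124074; -2341132; -293067; -183389; 691822; -863758; -2517285; -594766;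
-1161847; -2480766; 279452; -4223125; 1071456; -2049281];
[:: -1106520; 2349480; 1204342; 2269817; -2776548; 709017; 1914829; 122356;
-406592; 50145; 1147467; 1692722; -1106589; 2214360];
[:: -1104788; 2350295; 1206071; 2270548; -2777062; 712123; 1914902; 122540;
-317740; 762478; 1242421; 2399261; -1009678; 2929284];
[:: -1097335; 2353784; 1213512; 2273675; 1233827; 2567775; 1915214; 123328;
-340244; 677510; 1249396; 2285677; 1846189; 50345];
[:: -1075179; -2363986; -292705; -188173; 711515; -851426; -2517947; -593977;
-1143883; -2466451; -3373664; -2842266; -2551446; -679668];
[:: -1073124; 2364920; 1237682; 2283637; -2785709; 768937; 1916218; 125867;
-406245; 145275; -2621283; 599988; -1073632; 2319768];
[:: -1061589; 2370120; 1249196; 2288277; -2788500; 789648; 1916691; 127067;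
-329741; 716772; 1285072; 2299660; 1846525; 55191];
[:: -845484; 2455524; 1464907; 2363190; 1482599; 2210286; -363503; 3694842;
1751086; 4655427; 1501754; 2407986; -352913; 3791128];
[:: -798623; 2471162; 1511674; 2376539; -2801108; 1258659; -328033; 3692539;
-2650479; 3713881; -2921688; 1468974; -799874; 2391350];
[:: -773079; 2479272; 1537167; 2383397; 1537909; 2105849; -308474; 3691062;
1851125; 4545664; 1567956; 2302235; 3694655; 3213291];
[:: -735788; -2490594; -289902; -221758; -2089684; -580862; -2521765; -589414;
-3020549; -2857767; -2279208; -721515; -777301; -2481386];
[:: -731821; 2491762; 1578340; 2393860; -2789289; 1375100; -276575; 3688336;
-2594961; 3827250; -570166; 4833909; -729489; 2525774];
[:: -690501; 2503527; 1619572; 2403585; -2779095; 1446226; -244270; 3685174;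
-320635; 1363886; 1656826; 2460612; -334549; 3638448];
[:: -685722; -2504841; -289440; -226817; -2059204; -609146; -2522218; -588871;
-3097842; -2838952; -1704579; -4619957; -853605; -2468512];
[:: -662458; -2511093; -289220; -229181; 870010; -741446; -2522419; -588629;
-998487; -2341297; -294838; -192335; -2555758; -683366];
[:: -656240; 2512726; 1653760; 2411085; -2769015; 1504613; -217231; 3682215;
-313334; 1361660; 1689305; 2411706; 1579742; 100674];
[:: -650129; -2514314; -289103; -230438; 874577; -737975; -2522523; -588504;
-994276; -2337409; -257043; -199736; 1248245; -1956717];
[:: -599696; 2526817; -288612; 235605; 1643572; 1857595; -2274227; -847776;
-244113; 280430; -2386476; 1003924; -639196; 2520461];
[:: -599099; 2526959; -288606; 235666; 1643874; 1856749; -2274148; -847848;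
-243196; 278849; 1570322; 1629519; -560354; 2531233];
[:: -593846; 2528199; -288554; 236207; 1646517; 1849312; -2273458; -848475;
-235328; 265183; 1572527; 1623425; 1835795; -675175];
[:: -444939; 2558607; -287006; 251772; 1709001; 1641736; -2252928; -866945;
-80180; -46350; -2125079; 918816; -1918728; -1385591];
[:: -438703; 2559684; -286937; 252435; 1711119; 1633199; 1974695; 289821;
-347847; 287293; 1611572; 1415936; -398638; 2561331];
[:: -436680; 2560030; -286915; 252650; 1711798; 1630432; 1974720; 289897;
-347820; 285525; -2389676; 1257112; -475429; 2556547];
[:: -426451; 2561753; -286803; 253740; 1715170; 1616466; 1974844; 290285;
-347659; 276488; -2382293; 1263112; -2200194; -1043338];
[:: -414351; 2563738; -286669; 255032; 1719028; 1599993; -2248462; -870911;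
-591810; 756883; -2619422; 1757855; -2453621; -549824];
[:: -373778; -2569967; 1935544; -2453955; 975163; -656732; 1761524; -198718;
512103; 1759127; -563461; -229923; 1748783; -149916];
[:: -350078; 2573303; -285938; 261958; -2618866; 1996493; -2238771; -879455;
-4296519; 197525; -2400054; 1429019; -2294515; -882199];
[:: -326063; 2576456; 1983132; 2457935; 1743045; 1481512; 1942869; 196352;
-379303; 237951; -2338384; 1367180; -327832; 2511973];
[:: -325205; 2576564; 1983987; 2457998; 1743244; 1480377; 1942897; 196430;
-379290; 237134; 1629253; 1275842; -326998; 2511137];
[:: -299987; 2579622; -285347; 267434; -2585022; 2070972; -2230914; -886320;
-539264; 705073; -2515736; 1803580; -2462490; -509434];
[:: -276639; 2582230; -285064; 270011; 1753477; 1416580; 1976726; 296204;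
-339432; 124087; 1637156; 1222386; 1583666; -1090623];
[:: -189222; -2590103; 2119584; -2464221; 1040828; -598348; 94645; -1456252;
-1161547; 497256; -2258075; -1480315; 54885; -1424753];
[:: -89616; -2595459; -282625; -291294; -1687522; -884668; -2525412; -585034;
-1672220; 1575122; -354921; -262779; 585585; 1851062];
[:: -40880; -2596684; -281933; -297049; -1656625; -902731; -2525477; -584956;
-1627414; 1556934; -283403; -261525; -2583998; -506745];
[:: 101068; -2595039; 2408906; -2452510; 1142417; -498446; 433829; -1350035;
2372896; -2628405; 1354119; -609680; 99522; -2553608];
[:: 110812; -2594641; 2418614; -2451524; 1145799; -494900; 445561; -1345431;
2388667; -2617654; 1317007; -4608810; 114111; -2632473];
[:: 112204; -2594581; 2420000; -2451380; -1559239; -955560; 1696062; -308417;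
500817; -2299798; -730879; -403463; 1580329; -297679];
[:: 192525; -2589860; 2500009; -2441724; 1174092; -464622; 1679934; -333679;
2609983; -2461875; 1379864; -564518; 3691158; -460654];
[:: 234549; 2586393; 2541863; 2435611; 1761110; 811647; 1961419; 249412;
4220827; 787266; 2568309; 2330749; 4785853; 2990575];
[:: 245811; -2585347; -277291; -333061; 1192484; -444337; 1929944; 161401;
355301; 1868654; -288033; -299128; 1958285; 254880];
[:: 248778; -2585063; 2556032; -2433375; 1193507; -443195; 1667016; -353464;
2524146; -2512060; 1538176; -4547011; 252280; -2623643];
[:: 249729; -2584971; 2556978; -2433223; 1193834; -442829; 1666784; -353816;
2522455; -2512991; 1410294; -544169; 248072; -2544697];
[:: 251317; 2584817; -277191; 333794; 1758909; 793930; 1984719; 321899; 4211569;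
981711; 2598968; 2566853; 2034381; 323170];
[:: 257339; -2584225; 2564556; -2431989; -1466501; -1000405; 626304; -1265987;
-535306; -3277174; -1753160; -1371921; 558757; -1282970];
[:: 264037; -2583549; 2571226; -2430883; 1198764; -437298; 634806; -1261842;
2643093; -2428458; 1408777; -533828; 3719836; -424849];
[:: 264398; -2583512; 2571586; -2430823; 1198889; -437158; 1663140; -359324;
2495182; -2527714; 1519462; -4567599; 3824904; -4373159];
[:: 271359; -2582790; 2578517; -2429652; 1201286; -434455; 644129; -1257251;
2655636; -2418307; 1682220; -4459292; 3987441; -4262249];
[:: 275285; 2582375; 2582426; 2428984; 1755551; 768836; 1962816; 253561;
4214823; 821606; 2617532; 2422175; 2031405; 184022];
[:: 294436; -2580261; -276391; -339595; 1209229; -425438; 1929585; 160453;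
379881; 1890374; -220470; -289703; -1834023; 1368404];
[:: 428551; 2561403; -273703; 358389; 1728659; 614654; 1988097; 333047; 802898;
-1664330; -277186; 322269; 2035233; 247521];
[:: 445152; 2558570; -273347; 360801; 1725228; 598592; 1988438; 334182; 906693;
-1721064; -137927; 284410; -1367455; -1675471];
[:: 471777; 2553795; 2777997; 2387119; 1719532; 573084; 1969751; 274510; 676527;
-1654683; -356219; 356932; 1953782; 227455];
[:: 519810; -2544452; 2825778; -2374331; 1286385; -332559; 1566566; -495298;
3387970; 945777; 2334696; -1055166; 4645901; -949331];
[:: 521854; -2544034; 2827811; -2373764; -1296611; -1069824; 1565328; -496928;
616043; -2616614; 2861636; -2351154; 1465216; -506464];
[:: 522974; -2543804; 2828925; -2373453; -1295889; -1070086; 1564643; -497827;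
616012; -2617806; 2865487; -2387549; 1904600; -4492203];
[:: 526552; -2543066; 2832484; -2372454; -1293584; -1070919; 1562427; -500734;
-125951; 1094130; -1164478; -914507; 1145887; -791674];
[:: 554775; -2537058; 2860552; -2364374; 1298287; -317306; 1543148; -525672;
800253; -2726199; -160579; -4773139; 2143386; -4561907];
[:: 556594; -2536660; 2862361; -2363841; -1274219; -1077813; 1541778; -527421;
612610; -2656002; -346795; -4703610; 1957021; -4490772];
[:: 564431; -2534928; 2870155; -2361527; 1301570; -313051; 1535662; -535189;
670367; -2690526; 2903795; -2337028; 1435963; -548637];
[:: 564622; -2534885; 2870344; -2361471; 1301635; -312967; 1535509; -535383;
667748; -2689727; 2906817; -2373928; 2026819; -4513665];
[:: 585170; -2530221; 2890777; -2355269; 1308618; -303848; 1517497; -557914;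
372458; -2578581; -880637; -696319; 1429224; -564364];
[:: 613548; -2523490; 2918990; -2346386; 1318250; -291113; 1485620; -596577;
3776979; -217254; 2952681; -2322887; 1520730; -505640];
[:: 638818; -2517211; 2944110; -2338162; 1326816; -279630; 1442582; -646479;
3764788; -606882; 2977189; -2726515; 5255667; -2324760];
[:: 643563; -2516002; 2948827; -2336585; -1218076; -1096704; 1253529; -839138;
-62308; 1074702; -1094165; -937369; 1215779; -806872];
[:: 650669; -2514174; 2955889; -2334203; 1330829; -274198; 1283864; -810814;
-1034545; -949334; 1102522; -210348; 648836; -2479057];
[:: 656236; -2512727; 2961422; -2332320; 1332714; -271636; 1322108; -773786;
-973282; -1127900; -1550429; -3314235; 678013; -2692206];
[:: 662395; 2511110; -268140; 394383; 1672416; 399247; 1993382; 350860; 3155260;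
2361893; 2104155; 4363976; 880977; 2400126];
[:: 672119; 2508525; 2977207; 2326868; 1669741; 390776; 920993; 3269397;
-542627; 1466059; -1435038; 3543740; 860652; 3256208];
[:: 685656; 2504859; -267514; 398227; 1665977; 379046; 1993973; 352879; 2996965;
2447687; 1878229; 482594; 722700; 2486995];
[:: 718799; 2495550; 3023588; 2310151; 1656567; 350625; 1979118; 303796;
3125513; 2323694; 1864793; 446530; 4174100; 305208];
[:: 727764; 2492950; -266342; 405324; -1520295; 3145899; 1995077; 356671;
808283; 2353100; -300723; 382500; -1466149; 2381163];
[:: 729484; 2492447; -266293; 405618; -1518120; 3146959; 1995123; 356830;
810612; 2354615; -267355; 366866; 2044983; 444077];
[:: 735383; 2490713; 3040063; 2303959; 1651757; 336562; 1979781; 305915;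
3009662; 2387634; 2050638; 4435421; 739467; 2529194];
[:: 735726; 2490612; 3040404; 2303830; 1651657; 336272; 1979795; 305959;
3007229; 2388887; 1869433; 434768; 733454; 2450314];
[:: 745882; 2487589; 3050492; 2299970; 1648678; 327713; 1980203; 307268;
2934648; 2424636; 1989505; 4478867; 4291786; 4250012];
[:: 749759; 2486424; 3054343; 2298483; 1647535; 324455; 989780; 3222581;
3119252; 2295458; 2176576; 4350821; 4478580; 4119204];
[:: 754328; 2485041; -265575; 409896; -1486620; 3161990; 1995798; 359159;
844320; 2376164; 3101977; 2503211; 2045758; 444747];
[:: 755083; 2484812; 3059631; 2296430; 1645959; 319991; 994497; 3219252;
3122046; 2287724; 1858423; 412513; 4167509; 267617];
[:: 763992; 2482087; 3068479; 2292962; -1474321; 3167700; 1980937; 309623;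
839280; 2332203; -428208; 459602; 1880574; 309945];
[:: 771687; 2479706; 3076121; 2289935; -1464509; 3172193; 1981250; 310633;
849927; 2339011; 3110144; 2271374; 1880763; 311401];
[:: 777552; 2477873; 3081945; 2287609; -1457020; 3175584; 1981490; 311406;
858047; 2344159; 3118950; 2305716; 1982845; 4321191];
[:: 816411; 2465342; -263696; 420887; 1627337; 269321; -1922059; -1117363;
297819; -1800265; -275600; 387051; 1951777; -238776];
[:: 871189; 2446522; -261928; 430964; 1610007; 225203; -1894279; -1134861;
310961; -1863644; -174941; 344762; -1872727; -1226988];
[:: 885889; 2441238; -261434; 433732; 1605248; 213541; -1886448; -1139707;
-759441; 891073; 1375189; 145073; 928955; 2415260];
[:: 916190; 2430028; -260391; 439529; -1277372; 3247584; -1869766; -1149902;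
-2466998; 1094541; -306844; 426039; -834691; 2678648];
[:: 927871; -2425592; -259979; -441797; -1033564; -1147749; 1924178; 146285;
1244931; -2074713; -303143; -426495; -956798; -2645866];
[:: 929225; 2425074; -259931; 442061; -1260236; 3253549; -1862356; -1154376;
-702441; 857789; 1439658; 133514; 970383; 2399050];
[:: 931901; 2424047; -259835; 442584; 1590072; 177511; -1860817; -1155301;
-763769; 891818; -1321381; 3083217; 901420; 2441324];
[:: 934596; 2423009; 3237793; 2218778; -1253164; 3255967; 1153465; 3097388;
221517; 5224753; -1177446; 3448223; 1114579; 3132801];
[:: 937445; 2421908; -259637; 443670; -1249408; 3257240; 2001372; 378715;
-231485; 1017902; -1340941; 2988249; -2505910; 989320];
[:: 946554; -2418362; -259308; -445464; -1021375; -1150544; 1923990; 145798;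
1256598; -2078791; -269260; -409985; 1993352; 73189];
[:: 958669; 2413586; -258864; 447869; 1581051; 156873; 2002097; 381303; 3470591;
-1418068; 2447973; 598714; 1197079; -1347599];
[:: 969953; 2409073; -258446; 450128; -1206437; 3271299; -1838244; -1168705;
-710904; 861890; -1289172; 3047929; 939588; 2427043];
[:: 974414; -2407272; -258279; -451026; 1439368; -112947; 1923706; 145062;
3290819; -1732493; 2760728; -3930711; 1094803; -2325231];
[:: 988515; 2401516; 3291249; 2192121; 1570829; 134134; 1990626; 341511;
3417003; -1491426; 2410564; 533478; 4718682; 373904];
[:: 992360; 2399930; -257598; 454670; -1176677; 3280490; -1824321; -1176820;
-2306018; 1095223; -167994; 359008; -1924258; -1147116];
[:: 1014462; 2390671; -256738; 459226; 1561807; 114595; 2004097; 388491;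
1112366; 2533025; 74575; 4542042; -1161613; 2586355];
[:: 1015761; 2390119; -256687; 459496; 1561352; 113622; 2004145; 388666;
1107843; 2531293; 3363405; 2371290; 2054906; 463227];
[:: 1016462; 2389821; -256659; 459642; -1144541; 3289921; 2004171; 388760;
1207736; 2570480; 170857; 4579967; -1066218; 2624842];
[:: 1032191; -2383070; -256032; -462937; 1458457; -81243; 1923101; 143495;
3261176; -1754864; 1689414; -129219; 1067942; -2357816];
[:: 1042654; 2378511; 3344891; 2163715; -1109470; 3299634; 1993159; 350099;
1231496; 2544200; 308605; 4608523; 2608279; 4354806];
[:: 1043733; 2378037; 3345959; 2163131; 1551479; 92801; 1993211; 350274;
1173814; 2523474; 251423; 4588021; 2551035; 4333747];
[:: 1046299; 2376910; 3348500; 2161742; 1550567; 90904; 1252155; 3011280;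
3265851; 1854026; 1782266; 147529; 1043798; 2340139];
[:: 1048722; 2375841; 3350901; 2160426; 1549704; 89113; 1993449; 351088;
1155307; 2517127; 3384117; 2135598; 1893933; 365789];
[:: 1049271; 2375599; 3351444; 2160127; 1549508; 88707; 1993475; 351177;
1153291; 2516426; 3388159; 2172152; 2535468; 4322917];
[:: 1092894; 2355849; 3394637; 2135830; 1533787; 56778; 1293229; 2972766;
3287252; 1781934; 2782324; 3986068; 1098155; 2399736];
[:: 1101748; 2351721; -253101; 478005; 1530555; 50366; 2007530; 401020; 848707;
2413814; -284934; 457283; -1425193; 2470410];
[:: 1103250; 2351017; -253035; 478340; 1530005; 49280; 2007593; 401251; 844811;
2411761; -254495; 435733; 2058541; 488044];
[:: 1129594; 2338473; 3430956; 2114501; 1520300; 30345; 1997429; 364821; 896199;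
2409694; -396376; 554321; 1910182; 373603];
[:: 1216906; 2294249; 3517280; 2060352; -872472; 3350000; 2002005; 380971;
-244142; 971764; -985236; 3108102; 1283919; 2656654];
[:: 1352322; 2217130; 3650895; 1966153; -684063; 3371793; 1520202; 2725444;
-33867; 999442; -814094; 3121800; 1462975; 2712127];
[:: 1497052; -2122093; -229647; -584256; -655865; -1202822; 1917150; 128233;
1604495; -2173170; 3743009; -1438380; 1987749; 68914];
[:: 1556027; -2079236; -224675; -604268; -615546; -1204947; 1916200; 125822;
1642553; -2180544; 1238545; -4405390; -516132; -2897416];
[:: 1558537; -2077355; -224451; -605152; 1624792; 262671; 1916158; 125716;
1775351; -2192555; 1373299; -4417755; -382703; -2911325];
[:: 1569497; -2069086; -223462; -609044; 1628031; 271145; 1915975; 125251;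
1703349; -2187540; 3807003; -1358205; 1986334; 69393];
[:: 1612972; -2035377; -219330; -625024; 1640743; 305421; 1915223; 123350;
1409944; -2143565; -256109; -614701; -743360; -2876439];
[:: 1613523; -2034941; -219276; -625232; 1640902; 305862; 1915213; 123325;
1406194; -2142753; -233273; -585414; 1989746; 55722];
[:: 1665604; 1992537; 3958052; 1690693; -233916; 3360724; 2033010; 503008;
-255183; 900978; -371718; 3159202; 1681806; 2093411];
[:: 1700141; -1963151; -209887; -659993; 1665494; 377556; 1913593; 119244;
4012853; 1112883; 3900902; -1145573; 1965417; 122010];
[:: 1754426; -1914792; -203062; -684074; -476919; -1206832; 1912483; 116457;
-126821; 1227965; -414001; -1014954; -2245090; 399254];
[:: 1771432; 1899071; -200748; 692035; 1246174; -382204; -649796; -1524886;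
-920834; 781789; 1046059; -333779; -956478; -1492536];
[:: 1789891; 1881683; -198130; 700920; -49121; 3330180; 2063386; 657067;
-248583; 878442; 1576666; -456333; 1810220; 1845475];
[:: 1801687; 1870391; -196397; 706738; -31367; 3326421; 2065217; 668237;
-248003; 876141; -175555; 3136209; 1781796; 1902660];
[:: 1817141; 1855381; 4104911; 1519916; -8046; 3321260; 2048822; 577113;
-254692; 873819; 1557979; -477990; 1813077; 1821531];
[:: 1873536; 1798417; 4159080; 1448108; 77673; 3300078; 2056078; 615185;
2503789; 2894169; 4183784; 1380637; 1978458; 681059];
[:: 1906645; 1763277; 4190719; 1403503; 1177263; -461159; 1977725; 1871516;
3555502; 167160; 1404460; -530104; 1902204; 1729348];
[:: 1916550; 1752506; -176543; 769962; 1172000; -466898; -64272; -1489192;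
1826412; -2838090; 2070999; -590127; -39736; -1537583];
[:: 1917765; 1751176; 4201313; 1388085; 145626; 3280763; 2062524; 651906;
2578336; 2916448; 4235655; 1378119; 4735780; 3637045];
[:: 1921915; 1746620; 4205263; 1382271; 152038; 3278823; 1989033; 1834712;
-106184; 832576; -2476; 3091426; 1937622; 1830915];
[:: 1926431; 1741639; -174534; 776042; 159021; 3276687; -16522; -1480373;
-160572; 837699; 1598565; -583074; 1942238; 1704886];
[:: 1926807; 1741223; -174456; 776276; 159603; 3276508; -14685; -1480016;
-162345; 837830; 7096; 3092702; 1909666; 1776230];
[:: 1930302; 1737347; -173732; 778456; 165014; 3274835; 2457; -1476613; -177451;
838953; 12937; 3092153; -2074372; 2094148];
[:: 1953405; 1711330; 4235152; 1337088; 1152122; -488228; 2011888; 1753591;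
-296731; 1499642; 552559; 3595320; 1962789; 1761165];
[:: 1962511; -1700880; -166699; -799273; 1731552; 628663; 1907274; 103509;
-174508; -926245; 1494249; 599667; 1977496; -1662930];
[:: 1963680; -1699530; -166431; -800054; 1731808; 629921; 1907240; 103423;
-176672; -922016; 127652; -3162673; 1947873; -1734504];
[:: 1971240; 1690755; 4252012; 1310613; 228734; 3254015; 2024516; 1703859;
2585815; 3957557; 4213168; 2387564; 1985248; 1763669];
[:: 1980860; 1679474; 4261083; 1296053; 243804; 3248788; 2031221; 1675648;
2608806; 3925227; 404838; 3419572; 1991725; 1735926];
[:: 1995668; 1661851; 4275013; 1273246; 267076; 3240483; 2041378; 1629971;
-132877; 813378; 1590444; -650632; 1990815; 1628090];
[:: 1997895; -1659173; -158153; -823779; 1739089; 667440; 1906184; 100824;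
-233823; -801717; 1510366; 637368; -662471; 1432133];
[:: 2003133; 1652845; 4282020; 1261560; 1124509; -516977; 2046418; 1605746;
-274009; 1506621; 905608; -422540; 1997915; 1617004];
[:: 2004443; -1651257; -156467; -828519; 1740436; 674772; -2415266; -709334;
-105353; -951225; 229189; -3187570; -1917844; -2325525];
[:: 2008938; -1645785; -155289; -831813; 1741352; 679835; 1905828; 99948;
-249904; -764361; 90979; -2999748; -2058490; -2143796];
[:: 2018169; 1634453; -152815; 838678; 302620; 3227249; 2098573; 1056927;
-212045; 821854; 148365; 3054177; -2008504; 2217045];
[:: 2022557; 1629019; -151614; 841992; 309578; 3224580; 492934; -1326173;
-324339; 847827; 1386398; -630867; -804089; -1375608];
[:: 2025136; 1625812; -150899; 843955; 313671; 3222997; 2098722; 1079721;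
-209184; 819369; 1499059; -662206; -692680; -1403254];
[:: 2041118; 1605701; 4317489; 1200034; 1102737; -538955; 2086143; 829256;
3519288; -998394; 4335955; 1110211; 2052168; 739818];
[:: 2042380; 1604096; -145962; 857379; 341124; 3212150; 2098140; 1140905;
2796759; 3355886; 4385742; 1747069; 2143412; 1177134];
[:: 2058435; 1583442; -141101; 870369; 1092598; -548991; 2096010; 1204605;
-201786; 1542748; 876294; -444939; 2072806; 1535271];
[:: 2060360; -1580936; -140500; -871960; -247990; -1191539; 1904055; 95603;
-103178; 1264033; -212945; -994531; -2149655; 271180];
[:: 2071111; 1566825; 4345248; 1148822; 1085084; -556347; 2094031; 928817;
3520190; -904290; 4387412; 1184031; 5781869; -662144];
[:: 2071206; 1566699; -137036; 881063; 1085028; -556403; 2092863; 1260448;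
-213674; 1532659; 811763; 3548009; 2059935; 1599949];
[:: 2086200; 1546678; 4359119; 1122100; 1076036; -565118; 2097559; 1163622;
-194044; 1541467; 863243; -457358; 2080346; 1510262];
[:: 2090007; 1541529; -130705; 897427; 1073735; -567333; 2085112; 1351887;
3531457; -465335; 4436820; 1606736; 2139379; 1333538];
[:: 2107501; 1517525; -124409; 913367; 1063059; -577529; 964927; -1068986;
-1357053; -1017825; -157231; 898835; 913586; -1152073];
[:: 2108153; -1516619; -124167; -913975; 1759456; 798229; -2379869; -746085;
-59984; -857199; 1523414; 757115; -720878; 1319276];
[:: 2110813; 1512914; -123170; 916468; 1061019; -579463; 982399; -1056879;
-1339366; -1117009; -122462; 788852; -2434423; 876650];
[:: 2113909; 1508586; -121997; 919389; 1059107; -581272; 2067892; 1485750;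
3506821; -337350; 1272174; -683050; 2123491; 1468259];
[:: 2116920; 1504357; -120843; 922254; 461549; 3159609; 2064979; 1504112;
2864705; 3684628; 632538; 3323257; 2106667; 1540053];
[:: 2128384; -1488093; -116324; -933375; 1762575; 824112; -2371211; -754859;
-50178; -838636; 382792; -3058027; 2117666; -1527314];
[:: 2140952; -1469954; -111130; -945971; 1764398; 840526; -2365465; -760636;
-43873; -827096; 1529701; 796796; 2148688; -1432492];
[:: 2151869; 1453926; -106398; 957276; 1035195; -603536; 1185928; -899138;
3494662; -646236; 4498424; 1379997; 2190519; 1217372];
[:: 2153179; 1451986; -105816; 958656; 521305; 3130407; 1191958; -893954;
2099781; 1243818; -145192; 973156; 777701; 3094745];
[:: 2153684; 1451235; -105590; 959190; 522144; 3129981; 1194277; -891952;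
2103041; 1245420; -137106; 937365; 1294092; -880474];
[:: 2156262; 1447402; -104433; 961925; 1032369; -606125; 1206026; -881734;
3486813; -443299; 1241962; -714966; 2163905; 1407036];
[:: 2157144; -1446088; -104034; -962865; 1766610; 862069; -2357607; -768479;
-693205; 851390; -188723; -1352846; -2395360; -657415];
[:: 2168402; -1429152; -98810; -975082; -159197; -1179360; -2351816; -774217;
-1016654; 1126192; -130792; -954290; 1247099; 904281];
[:: 2187381; 1399931; -89409; 996622; 578497; 3100402; 1920268; 2034687; 15410;
705880; 1627287; -879999; 2192899; 1363426];
[:: 2191409; 1393617; -87310; 1001356; 585290; 3096701; 1905996; 2070518; 30799;
700173; 414947; 2928534; 2183003; 1436271];
[:: 2193132; 1390904; -86401; 1003399; 1008135; -627980; 1359545; -736033;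
1387361; -3058410; 2221470; -956644; -65307; -1308101];
[:: 2197311; -1384293; -84165; -1008399; -134306; -1175308; -2335552; -790141;
-1743331; -3035911; -149934; -1431465; -2390691; -855372];
[:: 2201605; 1377453; -81823; 1013606; 602544; 3087164; 1390825; -703277;
2387455; 1394564; 3170886; 3515742; 893201; 3109508];
[:: 2201681; 1377332; -81782; 1013699; 1002374; -633084; 1391098; -702986;
2410288; 1383988; 3193640; 3505195; 915971; 3098877];
[:: 2202812; 1375522; -81156; 1015083; 1001607; -633761; 1395157; -698649;
2374458; 1407338; 3775819; -367302; 1484222; -685819];
[:: 2206953; -1368869; -78841; -1020190; -125875; -1173872; 1897568; 79895;
-87458; 1285666; -107573; -975474; 1898626; 176931];
[:: 2212408; 1360034; -75721; 1027024; 995063; -639512; 1428506; -662260;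
2085518; 1565417; -112814; 1035801; 557377; 3250234];
[:: 2212554; 1359797; -75637; 1027208; 994963; -639599; 1428997; -661713;
2081373; 1567326; -107283; 999045; 1526956; -638677];
[:: 2227448; 1335259; -66686; 1046508; 646665; 3061885; 1476928; -606862;
-358222; 816666; 489053; 2913159; -1799884; 2576052];
[:: 2229585; 1331688; -65348; 1049357; 650340; 3059720; 1483436; -599172;
2530716; 1473848; 3868956; -348862; 1567595; -586788];
[:: 2293307; 1218681; -17755; 1145058; 936560; -689026; 1228555; 3032673;
-399540; 1376316; 763981; -562595; -1549527; -586171];
[:: 2295494; 1214556; -15804; 1148769; 934883; -690397; 1207282; 3051514;
2555357; 1160243; 3605321; 3162924; 1294294; 3053268];
[:: 2297857; 1210081; -13669; 1152814; 770192; 2983877; 1184041; 3071634;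
2203597; 984839; -49604; 1175216; 1284483; 3065476];
[:: 2297913; 1209973; -13617; 1152911; 770294; 2983808; 1183481; 3072113;
2207515; 987511; -48702; 1137988; 986092; -931329];
[:: 2301724; 1202709; -10108; 1159518; 777141; 2979154; 1145424; 3104029;
2476810; 1200973; 3547379; 3192716; 1235343; 3106908];
[:: 2302225; 1201749; -9640; 1160395; 778043; 2978538; 1140367; 3108179;
2512565; 1234337; 3654798; -717191; 1341172; -715448];
[:: 2302271; 1201660; -9597; 1160476; 929650; -694657; 1139899; 3108562;
2482288; 1213252; 3624753; -738141; 1311126; -736672];
[:: 2305817; 1194842; -6246; 1166731; 784517; 2974099; 1103797; 3137564; 754948;
5433760; 1952802; 3515869; -359919; 3451111];
[:: 2317366; -1172286; 5183; -1187753; 1777429; 1105559; -2235984; -881896;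
-666987; 830546; -24533; -1337497; -2270626; -782577];
[:: 2322242; 1162598; 10262; 1196941; 814342; 2953226; 929987; 3263456; 3252477;
3279262; 998256; 3101373; 2321848; 1203749];
[:: 2324009; 1159062; 12142; 1200319; 912467; -708466; 910723; 3276116; 2233109;
1366795; -23038; 1215268; 1010792; 3285067];
[:: 2324280; 1158519; 12432; 1200839; 912249; -708639; 907761; 3278041; 2229880;
1368535; -23354; 1178546; 1310406; -711944];
[:: 2324375; 1158327; 12534; 1201022; 818243; 2950443; 906718; 3278717; 3220602;
3479099; 4609926; 1695020; 2316227; 1392012];
[:: 2345358; 1115229; 36672; 1243290; 856990; 2922125; 671807; 3414231;
-1602746; 2944530; 10431; 1359974; -2223007; 756129];
[:: 2347124; 1111509; 38864; 1247034; 860283; 2919661; 651678; 3424381;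
-1598550; 2849327; 3717; 1253739; 582872; 3493706];
[:: 2348874; -1107804; 41064; -1250777; 1776237; 1162041; -2195992; -916174;
111075; -648494; 1546636; 1098595; 2345786; -1072633];
[:: 2352537; 1100004; 45756; 1258709; 888893; -726975; 1733384; -247376;
2749718; -2335742; 4070375; -500252; 1766833; -284460];
[:: 2353443; -1098066; 46934; -1260690; 12960; -1145512; -2189454; -921647;
-1449713; -3123236; 26598; -1410442; -2249199; -993765];
[:: 2387048; -1022958; 96774; -1340880; 1772573; 1235921; -2133994; -966643;
163192; -624374; 834186; -2783754; 2392913; -1074005];
[:: 2392544; -1010037; 106242; -1355371; 1771809; 1247128; -2123471; -974900;
-650856; 821099; 65851; -1323543; 1587912; 418926];
[:: 2403174; -984478; 125834; -1384667; 66867; -1132062; -2101712; -991703;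
-1305482; -3173498; 91730; -1395590; 937928; -3548917];
[:: 2424203; 931494; 170433; 1448164; 822965; -776179; 1808438; -111746; 258580;
1618038; 652276; -608655; 2413920; 891172];
[:: 2426047; 926680; 174774; 1454124; 821106; -777513; 1810011; -108687; 254747;
1616237; 1862928; 3205864; 2433761; 963762];
[:: 2430394; -915218; 185318; -1468444; 1764538; 1329051; 1877348; 32693;
4122330; 627896; 1993963; 1391579; 2421348; -882231];
[:: 2434611; -903941; 195984; -1482715; 103829; -1122031; 1876658; 31126;
2287307; -2254826; 160440; -1486976; 583371; -3761619];
[:: 2448450; -865756; 234398; -1532391; 121023; -1117138; 1874219; 25610;
2300578; -2257464; 180270; -1471681; 1971116; -6846];
[:: 2450720; -859310; 241251; -1540984; 1758891; 1377089; 1873791; 24645;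
4109730; 652964; 4700696; -1529676; 2468364; -921756];
[:: 2454937; 847185; 254451; 1557317; 790582; -799032; -473532; 3698910; 630590;
1655598; 2292228; 3189259; 78633; 3862217];
[:: 2457000; 841185; 261134; 1565479; 788290; -800618; 1834635; -59475; 196526;
1586979; 1865119; 3113070; -345392; 3796085];
[:: 2457042; 841063; 261271; 1565646; 788243; -800650; 1834666; -59410; 196454;
1586940; 629339; -632467; -1553637; 134010];
[:: 2461955; 826570; 277847; 1585584; 782713; -804459; -527738; 3699209;
-339895; 1384274; 1345473; 2891819; -857350; 3599238];
[:: 2480600; 768807; 350434; 1668153; 760756; -819351; -652423; 3695629; 366999;
1608767; 2082054; 3082451; 2495242; 806018];
[:: 2480765; 768274; 351156; 1668938; 760554; -819486; -653389; 3695578; 365392;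
1608404; 602585; -640351; 2464694; 732756];
[:: 2480827; 768074; 351428; 1669233; 1131291; 2680889; -653752; 3695559;
1164585; 5140502; 1510496; 2905886; -640893; 3757001];
[:: 2481624; 765495; 354938; 1673039; 759501; -820191; -658375; 3695309; 357055;
1606502; 602151; -641405; -1508798; 305572];
[:: 2488882; -741558; 388683; -1708819; 1743721; 1477641; 1864949; 4954;
-434153; 334107; 380912; -1775118; -1902593; -1402991];
[:: 2503202; -691681; 466320; -1786004; 1735959; 1519981; 1860493; -4807;
-433216; 360031; 402984; -1740904; 1824629; 84417];
[:: 2521531; 621550; 594865; 1899982; 1229062; 2573379; -795499; 3684153;
-913285; 1364598; 1063848; 2461915; -927879; 3639156];
[:: 2560120; 436150; 1081516; 2213834; 1339263; 2433553; -626404; 3696868;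
-887817; 1389083; 1169428; 2327647; -723635; 3657754];
[:: 2564040; 412481; 1162881; 2251824; 1352304; 2415430; 1913060; 117905;
-350077; 639845; 1177533; 2307048; -1084571; 2792597];
[:: 2567436; 390787; 1241869; 2285332; 1364059; 2398769; -523715; 3699226;
-886163; 1405137; 1192988; 2294120; 901668; -1093];
[:: 2569488; 377059; 1294081; 2305729; 1371400; 2388202; 1918505; 131683;
-349769; 630823; 1196071; 2281137; 1852731; 62654];
[:: 2574038; -344626; 4355124; 1129878; 1659857; 1810457; 2095103; 1223057;
279939; -225870; 1443548; 1712988; 2552699; -317444];
[:: 2574624; -340227; 4348061; 1143467; 1658642; 1814091; 2090799; 1288881;
391332; -294161; 1348952; -2342604; 2661429; -437276];
[:: 2578388; -310416; 4296383; 1237137; 1650241; 1838689; 2056589; 1552892;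
3708846; 3185147; 4483965; 1060918; 5957780; 2844381];
[:: 2579803; 298427; 1627148; 2405291; 584681; -926154; -238298; 3684545;
-314962; 1363267; 1662710; 2459613; -328439; 3637831];
[:: 2580142; 295482; 1640738; 2408288; 583582; -926754; -227556; 3683379;
648116; 1532237; 464121; -721494; 2548590; 282428];
[:: 2580325; -293874; 4264662; 1290246; 1645454; 1852314; 2033847; 1664200;
3508446; 3458571; 4274754; 1331148; 2000418; 1755728];
[:: 2580985; 288021; 1675523; 2415594; 580800; -928271; 1932541; 168302;
2801900; -1985398; 709122; -1128987; 2548061; 274998];
[:: 2581125; -286769; 4250329; 1313289; 362175; -1032673; 2071176; 706928;
-153988; 1372400; 300188; -842748; 2020343; 704487];
[:: 2581490; 283465; 1697014; 2419847; 1419483; 2315668; -182713; 3678023;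
1887652; 4730543; 1737658; 2474294; -176191; 3774314];
[:: 2581644; 282054; 1703703; 2421131; 1420182; 2314569; 1933510; 170893;
3771226; 1591108; 1679222; 2449407; 3519427; 3851733];
[:: 2582495; 274155; 1741490; 2428021; 575626; -931078; -146886; 3673178;
-326024; 1357553; 1662492; 2434105; 1583634; 121822];
[:: 2582590; 273262; 1745797; 2428768; 575293; -931258; -143399; 3672680;
736558; 1523288; 2715570; 2617212; 2656964; 304327];
[:: 2582693; 272285; 1750515; 2429578; 1425000; 2306949; -139577; 3672128;
1936678; 4712981; 1733200; 2460926; 3826273; 3446783];
[:: 2582978; 269565; 1763700; 2431789; 573913; -932004; 1935554; 176385;
2799592; -1979456; 4697593; -750331; 2630478; 288853];
[:: 2583298; -266485; 4206951; 1379777; 1637327; 1874834; 1990338; 1830338;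
2454161; -445421; 272980; 150906; 1928106; 1767516];
[:: 2584195; -257640; 4186851; 1409070; 1634650; 1882097; 1974699; 1881048;
2763373; -303490; 4222355; 1424090; 4992163; -757713];
[:: 2584202; -257565; 4186678; 1409318; 1634627; 1882158; 1974563; 1881473;
2765951; -302083; 4195426; 1449989; 1909198; 1805000];
[:: 2584301; 256567; 1827555; 2441462; 1432677; 2294672; 1937705; 182204;
3788156; 1585785; 1689207; 2426957; 2032973; 139011];
[:: 2584477; -254792; 4180220; 1418538; 374699; -1027443; 1969495; 1897154;
2724302; -299315; 3384057; -2462156; 4951654; -760536];
[:: 2584531; -254241; 4178927; 1420373; 1633614; 1884887; 1968477; 1900261;
2879174; -236288; 3539533; -2398945; 5106655; -696888];
[:: 2585172; -247637; 1872236; -2447217; 377493; -1026264; -185251; -1507467;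
-1749527; 209288; 450850; 730346; -227954; -1481463];
[:: 2585472; -244493; 4155585; 1452909; 378720; -1025745; 1949984; 1954607;
2709739; -240155; 4191827; 1467643; 4932218; -724318];
[:: 2585527; -243904; 4154146; 1454879; 378949; -1025648; 1948836; 1957856;
2708872; -236810; 4163320; 1494588; 1882417; 1882341];
[:: 2585905; -239862; 4144169; 1468425; 380526; -1024980; 1940855; 1980076;
-292068; 1341119; 315393; -836988; 1923528; 826374];
[:: 2586803; 229977; 1962438; 2456319; 559129; -939914; 1942186; 194468; -9644;
1453264; 1993893; 2501594; 31740; 3727492];
[:: 2587006; -227681; 1974338; -2457270; 385270; -1022960; 1757548; -205741;
99047; 1420169; 2256704; 2096687; 1737225; -157867];
[:: 2589089; 202626; 2106541; 2463948; 548902; -945305; 1946925; 207645; -16209;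
1448740; 1998765; 2474916; 1861751; 165350];
[:: 2589110; -202364; 2107946; -2463981; 395106; -1018733; 1742577; -231743;
2386041; -2463371; 483656; -1241041; 2547043; -194472];
[:: 2589444; -198044; 2131154; -2464406; 396781; -1018007; 1739744; -236587;
2383785; -2468049; 4472065; -1600728; 2625824; -206359];
[:: 2589699; -194678; 4021058; 1621263; 1614838; 1933645; 2039238; 530957;
4060950; 1674150; 1827228; 2025778; 3293562; 3815397];
[:: 2589760; -193867; 4018649; 1624017; 1614574; 1934306; 2038986; 529799;
4060525; 1673297; 4927010; -415329; 6322119; 1430353];
[:: 2589861; -192506; 4014584; 1628646; 1614131; 1935418; 1834320; 2231000;
4030640; 1475757; 4899846; -611739; 6292547; 1235761];
[:: 2590116; -189051; 4004174; 1640394; 1613002; 1938238; 1825579; 2248755;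
4043525; 1559607; 1832412; 2033036; 2558810; -163601];
[:: 2590126; -188908; 4003743; 1640878; 1612956; 1938355; 1825217; 2249485;
4043986; 1562990; 4913770; -524264; 2621339; -211806];
[:: 2590415; -184910; 3991522; 1654473; 401867; -1015795; 2036230; 517277;
2768406; -1686839; 536720; -1322506; 2013214; 458740];
[:: 2590665; -181367; 3980542; 1666515; 1610479; 1944508; 1805657; 2288008;
4061366; 1734849; 1820330; 2036372; 3246224; 3858376];
[:: 2591042; -175906; 2251678; -2463101; 1608674; 1948962; 247383; -1414682;
2336856; -400624; 551897; 987568; 250344; -1306323];
[:: 2591515; -168797; 3940419; 1709203; 408095; -1013066; 1771604; 2351561;
2565370; 168868; 317604; 415254; 1698314; 2271732];
[:: 2591691; -166067; 2305995; -2460584; 409149; -1012602; 311120; -1394350;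
2316561; -2565852; 496116; -1224533; 254299; -3525488];
[:: 2591853; -163515; 2320150; -2459730; 1604540; 1959060; 1713282; -280719;
3771602; 795167; 1913720; 2084133; 1737487; -222772];
[:: 2592050; -160368; 2337630; -2458563; 411348; -1011632; 348546; -1381565;
2420729; -2430503; 4496395; -1533414; 2630407; -165583];
[:: 2592056; -160262; 2338221; -2458522; 411389; -1011614; 349248; -1381320;
2422696; -2427753; 503354; -1232226; 2551858; -156819];
[:: 2592215; -157677; 2352611; -2457464; 412386; -1011173; 366356; -1375258;
2470712; -2358058; 4545821; -1459680; 4264886; -3756187];
[:: 2592276; -156667; 2358242; -2457027; 412776; -1011001; 1707037; -290852;
2354312; -2521378; 4428131; -1620027; 4150488; -3916935];
[:: 2592315; -156028; 2361804; -2456744; 413022; -1010892; 1706434; -291826;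
2353718; -2522349; 501911; -1224671; 314844; -3530723];
[:: 2593212; -140321; 3842670; 1805260; 1596663; 1977933; 2023159; 461474;
4031486; 1628022; 4920255; -451221; 2625072; -159665];
[:: 2593513; -134650; 3822052; 1824207; 1594709; 1982541; 2021567; 455034;
4028319; 1624289; 1813419; 2079675; 2557703; -110967];
[:: 2593997; -124975; 2536166; -2436486; 1591350; 1990399; 590391; -1283083;
-532751; 749836; 1412036; 1903510; 1423879; -410087];
[:: 2594085; -123152; 2546453; -2434896; 425671; -1005246; 603355; -1276989;
-741537; -3170525; 1200809; -2012747; 1217538; -4326313];
[:: 2594152; -121728; 2554489; -2433622; 1590216; 1993035; 613520; -1272150;
2680083; -212184; 2533651; -2468667; 617752; -1171670];
[:: 2594171; -121309; 2556853; -2433243; 1590069; 1993375; 616516; -1270713;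
2682892; -210382; 2572842; -2468932; 4623297; -1397248];
[:: 2594455; -115080; 2592022; -2427314; 428768; -1003850; 661485; -1248583;
2794224; -329000; 4764913; 779847; 4723787; -1533415];
[:: 2594471; -114729; 2594005; -2426964; 1587759; 1998714; 664042; -1247292;
2727440; -181179; 4697752; 928340; 4657413; -1384936];
[:: 2594550; -112932; 2604157; -2425146; 429593; -1003477; 677180; -1240605;
2756609; -206109; 2582429; -2460620; 682630; -1140152];
[:: 2594552; -112882; 2604435; -2425096; 429611; -1003469; 677541; -1240420;
2755675; -203324; 2619772; -2460466; 4682363; -1412331];
[:: 2594750; -108232; 3720892; 1911231; 1585463; 2003982; 2014338; 426626;
-308194; 433993; 752218; -1563176; 1966242; 406346];
[:: 2594798; -107060; 2637316; -2418903; 431844; -1002458; 720597; -1217835;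
2624744; 111990; 633021; 1182597; 718785; -1129440];
[:: 2595257; -95308; 2703617; -2405002; 1580852; 2014454; 1623236; -417753;
-450757; 627599; 1400695; 1925783; 1588392; -380218];
[:: 2595468; -89369; 3643532; 1971697; 1578715; 2019262; 1513719; 2733456;
-806147; 2621955; 384220; 699409; 1465126; 2745017];
[:: 2595544; -87135; 2749615; -2394231; 439472; -998981; 875442; -1127798;
707013; -3444227; 2728571; -2431083; 788148; -1171070];
[:: 2595891; -76100; 2811501; -2378260; 443690; -997045; 968988; -1066191;
1021112; -3388150; 3045360; -2380392; 2887290; -4688613];
[:: 2596412; -55546; 2925726; -2344210; 451532; -993416; 1184685; -900203;
965993; 1412022; 3068519; 2244215; 2714977; -42241];
[:: 2596481; -52219; 2944051; -2338182; 452800; -992826; 1236798; -854380;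
847002; 1435220; 362289; -773447; 2562607; -58275]].

End Certificate.

(** * From integer checks to real realizations *)

Section CertificateSound.
Variable R : realType.

(** The checks are evaluated on binary integers, and only their outcomes are read in the reals. *)
Definition zr (z : Z) : R := (int_of_Z z)%:~R.

Lemma zrD a b : zr (Z.add a b) = zr a + zr b.
Proof. by rewrite /zr -intrD; congr (_%:~R); lia. Qed.

Lemma zrM a b : zr (Z.mul a b) = zr a * zr b.
Proof. by rewrite /zr -intrM; congr (_%:~R); lia. Qed.

Lemma zrB a b : zr (Z.sub a b) = zr a - zr b.
Proof. by rewrite /zr -intrB; congr (_%:~R); lia. Qed.

Lemma zr_abs a : zr (Z.abs a) = `|zr a|.
Proof. by rewrite /zr -intr_norm; congr (_%:~R); lia. Qed.

Lemma zr_le a b : Z.leb a b -> zr a <= zr b.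
Proof. by rewrite /zr ler_int; lia. Qed.

Lemma zr_lt a b : Z.ltb a b -> zr a < zr b.
Proof. by rewrite /zr ltr_int; lia. Qed.

Lemma zr_pow2 n : zr (Z.pow 2 (Z.of_nat n)) = 2 ^+ n.
Proof.
elim: n => [|n IH]; first by [].
rewrite Nat2Z.inj_succ Z.pow_succ_r; last by lia.
by rewrite zrM IH exprS.
Qed.

Lemma zr_zunit : zr zunit = 2 ^+ 37. Proof. exact: (zr_pow2 37). Qed.

Lemma zr_zunit_half : zr zunit_half = 2 ^+ 36. Proof. exact: (zr_pow2 36). Qed.

Lemma zr_zresidual_bound : zr zresidual_bound = 2 ^+ 24.
Proof. exact: (zr_pow2 24). Qed.

Lemma zr_znorm_bound : zr znorm_bound = 13 * 2 ^+ 17.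
Proof. by rewrite /znorm_bound zrM (zr_pow2 17). Qed.

Lemma zr_zseparation : zr zseparation = 13 * 2 ^+ 7.
Proof. by rewrite /zseparation zrM (zr_pow2 7). Qed.

Lemma zr_sum (s : seq Z) : zr (zsum s) = \sum_(z <- s) zr z.
Proof.
elim: s => [|z s IH]; first by rewrite big_nil.
by rewrite big_cons -IH -zrD.
Qed.

(** [s] is the number of integer units per unit of length: [unit_pos] for points, [unit_dir] for
    directions. *)
Definition zpt (s : R) (l : seq zpoint) (n : nat) : 'rV[R]_2 :=
  \row_i (zr (if i == 0 then (znth l n).1 else (znth l n).2) / s).

Lemma dot_zpt (s s' : R) l l' (e : nat * nat) :
  dot (zpt s l e.1 - zpt s l e.2) (zpt s' l' e.1 - zpt s' l' e.2) =
  zr (zdot (zvec l e) (zvec l' e)) / (s * s').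
Proof.
rewrite /dot !mxE /= zrD !zrM !zrB invfM.
by ring.
Qed.

Definition block_vertex (n : nat) : 'I_3 + 'I_7 :=
  if (n < 3)%N then inl (inord n) else inr (inord (n - 3)).

Definition vnum (x : 'I_3 + 'I_7) : nat :=
  match x with inl k => k | inr y => (3 + y)%N end.

Lemma block_vertexK n : (n < 10)%N -> vnum (block_vertex n) = n.
Proof.
rewrite /block_vertex; case: (ltnP n 3) => n3 n10 /=; rewrite inordK//; lia.
Qed.

Lemma vnumK x : block_vertex (vnum x) = x.
Proof.
case: x => [k|y] /=; rewrite /block_vertex.
  by rewrite ltn_ord inord_val.
by rewrite ltnNge leq_addr /= addKn inord_val.
Qed.

Definition block_edge (i : nat) : ('I_3 + 'I_7) * ('I_3 + 'I_7) :=
  (block_vertex (zedge i).1, block_vertex (zedge i).2).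

Lemma zedge_lt (i : 'I_14) : ((zedge i).1 < 10)%N /\ ((zedge i).2 < 10)%N.
Proof.
have : all (fun i => ((zedge i).1 < 10)%N && ((zedge i).2 < 10)%N) (iota 0 14) by [].
by move=> /allP/(_ i); rewrite mem_iota => /(_ (ltn_ord i))/andP.
Qed.

Definition unit_pos : R := 2 ^+ 20.
Definition unit_dir : R := 2 ^+ 17.

Definition triangle (k : 'I_3) : 'rV[R]_2 := zpt unit_pos ztriangle k.

Definition block_conf (l : seq zpoint) (x : 'I_3 + 'I_7) : 'rV[R]_2 :=
  zpt unit_pos (ztriangle ++ l) (vnum x).

Lemma sum_ord_iota (F : nat -> Z) n :
  \sum_(j < n) zr (F j) = zr (zsum (map F (iota 0 n))).
Proof. by rewrite zr_sum big_map -[n in iota 0 n]subn0 big_mkord. Qed.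

(** Any [B] that passes the checks will do as approximate inverse of the 14 edge constraints on the
    14 coordinates of the block. The target lengths do not depend on [l], so all realizations
    obtained share them. *)
Lemma approximate_inverse_sound l (B : seq (seq zpoint)) :
  residual_check (ztriangle ++ l) -> defect_check (ztriangle ++ l) B ->
  norm_check B ->
  exists w : 'I_7 -> 'rV[R]_2,
  [/\ forall y i, `|w y 0 i - block_conf l (inr y) 0 i| <= 13 / 2 ^+ 14,
      forall i : 'I_14, cval (inr (block_edge i)) (glue triangle w) =
        zr (zlength i) / 2 ^+ 12 &
      forall t : 'I_14 -> R, exists h : 'I_7 -> 'rV[R]_2, forall i : 'I_14,
        cdiff (inr (block_edge i)) (glue triangle w) (glue (fun=> 0) h) = t i].
Proof.
rewrite /residual_check /defect_check /norm_check; set P := ztriangle ++ l.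
move=> /allP res /allP def /allP nor.
have mem14 (i : 'I_14) : (i : nat) \in iota 0 14 by rewrite mem_iota ltn_ord.
pose H (j : 'I_14) x := zpt unit_dir (zcolumn B j) (vnum x).
pose c (i : 'I_14) : constr ('I_3 + 'I_7) := inr (block_edge i).
pose t (i : 'I_14) : R := zr (zlength i) / 2 ^+ 12.
have up0 : unit_pos != 0 by rewrite expf_neq0.
have ud0 : unit_dir != 0 by rewrite expf_neq0.
have Hth i : \sum_j `|(i == j)%:R - cdiff (c i) (block_conf l) (H j)| <= 2^-1.
  have E j : `|(i == j)%:R - cdiff (c i) (block_conf l) (H j)| =
      zr (Z.abs (zdefect P B i j)) / 2 ^+ 37.
    have [e1 e2] := zedge_lt i.
    rewrite /c /= /block_conf /H !block_vertexK// dot_zpt zr_abs /zdefect.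
    rewrite zrB zrM; set a := zr (if _ then _ else _); set b := zr (zdot _ _).
    rewrite -[X in _ = _ / X]ger0_norm ?exprn_ge0// -normfV -normrM mulrBl.
    congr `|_ - _|; last by rewrite mulrA /unit_pos /unit_dir -exprD.
    rewrite /a -val_eqE /= (_ : Nat.eqb i j = (i == j :> nat))//.
    case: eqP => _; last by rewrite mul0r.
    by rewrite zr_zunit divff// expf_neq0.
  rewrite (eq_bigr _ (fun j _ => E j)) -mulr_suml.
  rewrite (sum_ord_iota (fun j => Z.abs (zdefect P B i j))).
  rewrite ler_pdivrMr ?exprn_gt0//.
  apply: le_trans (zr_le (def i (mem14 i))) _.
  by rewrite zr_zunit_half [in leRHS]exprS mulrA mulVf ?mul1r// pnatr_eq0.
have Hbe x k : \sum_j `|H j x 0 k| <= 13.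
  have xk : vnum x \in iota 0 10.
    by rewrite mem_iota /=; case: x => [y|y] /=; have := ltn_ord y; lia.
  have := nor _ xk => /andP[n1 n2].
  have E j : `|H j x 0 k| = zr (Z.abs (if k == 0 then (znth (zcolumn B j) (vnum x)).1
      else (znth (zcolumn B j) (vnum x)).2)) / unit_dir.
    by rewrite mxE normrM zr_abs normfV [X in _ / X]ger0_norm ?exprn_ge0.
  rewrite (eq_bigr _ (fun j _ => E j)) -mulr_suml ler_pdivrMr ?exprn_gt0//.
  rewrite (sum_ord_iota (fun j => Z.abs (if k == 0 then (znth (zcolumn B j) (vnum x)).1
      else (znth (zcolumn B j) (vnum x)).2))).
  rewrite -[13 * unit_dir]zr_znorm_bound.
  by apply: zr_le; case: (k == 0).
have Hep i : `|cval (c i) (block_conf l) - t i| <= (2 ^+ 16)^-1.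
  have [e1 e2] := zedge_lt i.
  have := zr_le (res i (mem14 i)).
  rewrite zr_abs zrB Z.shiftl_mul_pow2; last by [].
  rewrite zrM (zr_pow2 28) zr_zresidual_bound => r.
  rewrite /c /= /block_conf !block_vertexK// dot_zpt /t.
  rewrite -[leLHS](@mulfK _ (2 ^+ 40)) ?expf_neq0// ler_pdivrMr ?exprn_gt0//.
  rewrite -[X in _ * X](@ger0_norm _ (2 ^+ 40)) ?exprn_ge0// -normrM mulrBl.
  rewrite -exprD -mulrA mulVf ?expf_neq0// mulr1 -mulrA.
  rewrite (_ : (2 ^+ 12)^-1 * 2 ^+ 40 = 2 ^+ 28 :> R); last first.
    by rewrite -[40%N]/(12 + 28)%N exprD mulKf// expf_neq0.
  apply: le_trans r _; rewrite -[40%N]/(16 + 24)%N exprD mulKf// expf_neq0.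
have rho0 : 0 <= (2 ^+ 14)^-1 :> R by rewrite invr_ge0 exprn_ge0.
(* With th = 1/2, be = 13, ep = 2^-16 and rho = 2^-14, the contraction constant is about 0.67; the
   second condition, in units of 2^-16, reads 2 + 1 + 0.34 <= 4. *)
have [||||y [yr yt yreg]] := newton_kantorovich Hth Hbe Hep _ _ rho0.
- by rewrite invr_ge0.
- by [].
- by lra.
- by lra.
(* Every column starts with three zero vectors, so the correction leaves the triangle exactly in
   place. *)
have H0 j k : H j (inl k) = 0.
  apply/rowP => i; rewrite !mxE /znth /zcolumn /=.
  by case: k => -[|[|[|]]] // p; case: (i == 0); rewrite /= /zr mul0r.
pose w y' := block_conf l (inr y') + lincomb H y (inr y').
have wE : (fun x => block_conf l x + lincomb H y x) =1 glue triangle w.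
  case=> [k|y'] //=; rewrite /lincomb big1 => [|j _]; last by rewrite H0 scaler0.
  rewrite addr0; apply/rowP => i; rewrite !mxE /znth nth_cat /= ltn_ord.
  by case: k => -[|[|[|]]].
have linb x k : `|lincomb H y x 0 k| <= 13 / 2 ^+ 14.
  apply: le_trans (lincomb_bound _ _ _ Hbe) _.
  by rewrite ler_wpM2l.
exists w; split.
- by move=> y' i; rewrite mxE addrAC subrr add0r.
- by move=> i; rewrite -(cval_ext _ wE) yt.
- move=> s; have [z zs] := yreg s.
  exists (fun y' => lincomb H z (inr y')) => i; rewrite -zs.
  apply: cdiff_ext => [x|]; first by rewrite wE.
  case=> [k|y'] //=; rewrite /lincomb big1// => j _; by rewrite H0 scaler0.
Qed.

(** By the triangle inequality, one exact solution cannot be close to two approximations that differ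
    by more than twice the radius in some coordinate. *)
Lemma separated_sound l l' (w : 'I_7 -> 'rV[R]_2) :
  size l = 7%N -> size l' = 7%N -> separated l l' ->
  (forall y i, `|w y 0 i - block_conf l (inr y) 0 i| <= 13 / 2 ^+ 14) ->
  (forall y i, `|w y 0 i - block_conf l' (inr y) 0 i| <= 13 / 2 ^+ 14) -> False.
Proof.
move=> sl sl' sep wl wl'; have [n] := has_nthP (znth [::] 0, znth [::] 0) sep.
rewrite size_zip sl sl' minnn => n7; rewrite nth_zip ?sl//= => {}sep.
suff [i] : exists i : 'I_2, 2 * (13 / 2 ^+ 14) <
    `|block_conf l (inr (Ordinal n7)) 0 i - block_conf l' (inr (Ordinal n7)) 0 i|.
  apply/negP; rewrite -leNgt mulrDl mul1r.
  set x := w (Ordinal n7) 0 i.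
  rewrite (_ : _ - _ = (x - block_conf l' (inr (Ordinal n7)) 0 i) -
    (x - block_conf l (inr (Ordinal n7)) 0 i)); last by ring.
  by apply: le_trans (ler_normB _ _) _; apply: lerD; [exact: wl'|exact: wl].
have E (a b : Z) : Z.ltb zseparation (Z.abs (a - b)) ->
    2 * (13 / 2 ^+ 14) < `|zr a / unit_pos - zr b / unit_pos|.
  move=> /zr_lt; rewrite zr_abs zrB -mulrBl normrM normfV.
  rewrite (@ger0_norm _ unit_pos) ?exprn_ge0// ltr_pdivlMr ?exprn_gt0//.
  apply: le_lt_trans; rewrite zr_zseparation /unit_pos.
  have -> : 2 ^+ 20 = 2 ^+ 14 * 2 ^+ 6 :> R by rewrite -exprD.
  have -> : 2 ^+ 7 = 2 * 2 ^+ 6 :> R by rewrite -exprS.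
  have : 2 ^+ 14 != 0 :> R by rewrite expf_neq0.
  by move: (2 ^+ 14) (2 ^+ 6) => x y x0; rewrite le_eqVlt (_ : _ == _)//; apply/eqP; field.
have nthE s : (znth (ztriangle ++ s) (vnum (inr (Ordinal n7)))) = znth s n.
  by rewrite /znth nth_cat /= addKn.
case/orP: sep => /E sep; [exists 0|exists 1]; by rewrite !mxE !nthE.
Qed.

End CertificateSound.

Section Block.
Variables (R : realType) (apx : seq (seq zpoint)).
Hypotheses (apx_newton : all newton_check apx) (apx_sep : pairwise separated apx).

Definition block_edges : seq (('I_3 + 'I_7) * ('I_3 + 'I_7)) :=
  map block_edge (iota 0 14).

Lemma block_edgesP e : e \in block_edges -> exists i : 'I_14, e = block_edge i.
Proof. by move=> /mapP[i]; rewrite mem_iota => i14 ->; exists (Ordinal i14). Qed.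

Lemma block_attachment : exists w : 'I_(size apx) -> 'I_7 -> 'rV[R]_2,
  attachment (@triangle R) block_edges w.
Proof.
pose l (j : 'I_(size apx)) := nth [::] apx j.
have lP j : newton_check (l j) by apply: (all_nthP [::] apx_newton).
have ls j : size (l j) = 7%N.
  by have := lP j; rewrite /newton_check => /andP[/andP[/PeanoNat.Nat.eqb_spec]].
have /choice[w wP] j : exists w : 'I_7 -> 'rV[R]_2,
  [/\ forall y i, `|w y 0 i - block_conf R (l j) (inr y) 0 i| <= 13 / 2 ^+ 14,
      forall i : 'I_14, cval (inr (block_edge i)) (glue (@triangle R) w) =
        zr R (zlength i) / 2 ^+ 12 &
      forall t : 'I_14 -> R, exists h : 'I_7 -> 'rV[R]_2, forall i : 'I_14,
        cdiff (inr (block_edge i)) (glue (@triangle R) w) (glue (fun=> 0) h) = t i].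
  have := lP j; rewrite /newton_check => /andP[/andP[_ res] BB].
  have [def nor] : defect_check (ztriangle ++ l j) (zinverse (ztriangle ++ l j)) /\
      norm_check (zinverse (ztriangle ++ l j)) by apply/andP; exact: BB.
  exact: approximate_inverse_sound res def nor.
exists w; split.
- move=> _ /block_edgesP[i ->].
  have : all (fun i => (zedge i).1 != (zedge i).2) (iota 0 14) by [].
  move=> /allP/(_ i); rewrite mem_iota => /(_ (ltn_ord i)).
  have [e1 e2] := zedge_lt i.
  by apply: contra_neq => /(congr1 vnum); rewrite !block_vertexK.
- move=> _ /block_edgesP[i ->].
  have : all (fun i => ((zedge i).1 < 3)%N ==> ~~ ((zedge i).2 < 3)%N) (iota 0 14).
    by [].
  move=> /allP/(_ i); rewrite mem_iota => /(_ (ltn_ord i)).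
  by rewrite /= /block_vertex; case: ifP => // _; case: ifP.
(* Numbering the vertices turns the edges into a concrete list of pairs of naturals, where
   distinctness is computed. *)
- apply: (@map_uniq _ _ (fun e => (vnum e.1, vnum e.2))).
  rewrite -map_comp (_ : map _ _ = map zedge (iota 0 14)) //.
  apply/eq_in_map => i; rewrite mem_iota => i14 /=.
  have [e1 e2] := zedge_lt (Ordinal i14).
  by rewrite !block_vertexK// -surjective_pairing.
- by rewrite size_map size_iota card_ord.
- move=> S Sk H x; rewrite -(vnumK x).
  have S3 n : (n < 3)%N -> S (block_vertex n) by rewrite /block_vertex => ->; exact: Sk.
  have E i : (i < 14)%N -> S (block_vertex (zedge i).1) <-> S (block_vertex (zedge i).2).
    by move=> i14; apply: (H (block_edge i)); rewrite map_f// mem_iota.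
  have S0 := S3 0%N isT; have S1 := S3 1%N isT; have S2 := S3 2%N isT.
  (* A forest rooted at the triangle: 3 hangs from 0, 4 from 1, 5 and 6 from 2, 7 from 5, and 8 and
     9 from 7. *)
  have V3 := (E 0%N isT).1 S0; have V4 := (E 1%N isT).1 S1.
  have V5 := (E 3%N isT).1 S2; have V6 := (E 5%N isT).1 S2.
  have V7 := (E 7%N isT).1 V5; have V8 := (E 9%N isT).1 V7.
  have V9 := (E 11%N isT).1 V7.
  have : (vnum x < 10)%N.
    by case: x => y /=; have := ltn_ord y; [move=> /leq_trans; apply|rewrite -(ltn_add2l 3)].
  by move: (vnum x); do 10![case=> [|] //].
- move=> j t; have [_ _ /(_ (fun i => t (inr (block_edge i))))[h ht]] := wP j.
  by exists h => _ /block_edgesP[i ->].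
- move=> i j _ /block_edgesP[k ->].
  have [_ -> _] := wP i; by have [_ -> _] := wP j.
- suff H (i j : 'I_(size apx)) : (i < j)%N -> w i =1 w j -> False.
    move=> i j E; apply/val_inj; case: (ltngtP i j) => // [/H|/H] F.
      by case: (F E).
    by case: F => y; rewrite E.
  move=> ij E; have sep : separated (l i) (l j).
    by apply: (pairwiseP [::] apx_sep); rewrite ?inE.
  have [wi _ _] := wP i; have [wj _ _] := wP j.
  by apply: (separated_sound (ls i) (ls j) sep wi) => y k; rewrite E; exact: wj.
Qed.

End Block.

(** * Evaluation of the certificate and assembly of the bound *)

Lemma newton_checks : all newton_check approximations.
Proof. by vm_compute. Qed.

Lemma separated_checks : pairwise separated approximations.
Proof. by vm_compute. Qed.

Lemma size_approximations : size approximations = 430%N.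
Proof. by vm_compute. Qed.

Lemma iter_attach (R : realType) (T : 'I_3 -> 'rV[R]_2) n N (W J : finType)
    (es : seq (('I_3 + W) * ('I_3 + W))) (w : J -> W -> 'rV[R]_2) k :
  fan_exists T n N -> attachment T es w ->
  fan_exists T (n + #|W| * k)%N (N * #|J| ^ k)%N.
Proof.
move=> F A; elim: k => [|k IH]; first by rewrite muln0 addn0 expn0 muln1.
by rewrite mulnSr addnA expnSr mulnA; exact: fan_exists_attach IH A.
Qed.

Lemma lower_bound_r2 (R : realType) n : (3 <= n)%N ->
  ((lower_bound n)%:R%:E <= r2 R n)%E.
Proof.
move=> n3; pose T := @triangle R.
have Tneg (k : 'I_3) i : T k 0 i =
    zr R (if i == 0 then (znth ztriangle k).1 else (znth ztriangle k).2) / unit_pos R.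
  by rewrite mxE.
have u0 : 0 < unit_pos R by rewrite exprn_gt0.
have z0 : zr R 0 = 0 by [].
have T0 : T t0 0 1 = 0 by rewrite Tneg /= z0 mul0r.
have T0' : T t0 0 0 = 0 by rewrite Tneg /= z0 mul0r.
have T1 : T t1 0 1 = 0 by rewrite Tneg /= z0 mul0r.
have T1' : 0 < T t1 0 0 by rewrite Tneg divr_gt0// -z0; exact: zr_lt.
have T2 : 0 < T t2 0 1 by rewrite Tneg divr_gt0// -z0; exact: zr_lt.
have T01 : T t0 != T t1.
  by apply/eqP => /(congr1 (fun x : 'rV[R]_2 => x 0 0)) E; move: T1'; rewrite -E T0' ltxx.
have F3 : fan_exists T 3 1.
  have B (x y : 'rV[R]_2) i : (x - y) 0 i = x 0 i - y 0 i by rewrite !mxE.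
  apply: fan_triangle; rewrite !B T0 T0' T1.
  rewrite (_ : _ - _ = T t2 0 1 * T t1 0 0); last by ring.
  by rewrite mulf_neq0// gt_eqF.
have [w7] := block_attachment R newton_checks separated_checks.
have [es1 [w1]] := vertex_attachment T0 T1 (lt0r_neq0 T2) T01.
move=> A1 A7.
(* As many blocks of 7 vertices as fit beside the triangle, the remainder being filled by single
   vertices; the reflection in [fan_r2] supplies the last factor 2. *)
have F := iter_attach ((n - 3) %% 7) (iter_attach ((n - 3) %/ 7) F3 A7) A1.
move: F; rewrite !card_ord size_approximations card_unit card_bool mul1n => F.
have := fan_r2 T0 T1 (lt0r_neq0 T2) _ F.
rewrite !muln_gt0 !expn_gt0 => /(_ isT).
rewrite (_ : (3 + _ + _)%N = n); last first.
  by rewrite -addnA mulnC -divn_eq subnKC.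
by rewrite /lower_bound mul1n [X in _ -> (X%:R%:E <= _)%E]mulnC mulnA.
Qed.

(** * Growth rate *)

Lemma powR_invnK (R : realType) (a : R) n : 0 <= a -> (0 < n)%N -> (a `^ (n%:R^-1)) ^+ n = a.
Proof.
move=> a0 n0; rewrite -powR_mulrn ?powR_ge0// -powRrM mulVf ?powRr1//.
by rewrite pnatr_eq0 -lt0n.
Qed.

(* Numerals are unary, so the bounds have small numerators and denominators. *)
Lemma seventh_root_bounds (R : realFieldType) (r : R) : 0 <= r -> r ^+ 7 = 430 ->
  107 / 45 < r < 88 / 37.
Proof.
move=> r0 r7; have E : (r * r * r) * (r * r * r) * r = 430.
  by rewrite -r7 !exprS expr0 mulr1 !mulrA.
apply/andP; split; rewrite ltNge; apply/negP => h.
  have mul_le (a b c d e : R) : a <= b -> c <= d -> 0 <= a -> 0 <= c ->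
      b * d <= e -> a * c <= e.
    by move=> ab cd a0 c0; apply: le_trans; exact: ler_pM.
  have p3 : 0 <= r * r * r by rewrite !mulr_ge0.
  (* Each power is rounded up to a short fraction, tightly enough to end with r^7 <= 429.9. *)
  have h2 : r * r <= 2827 / 500 by apply: (mul_le _ _ _ _ _ h h r0 r0); clear; lra.
  have h3 : r * r * r <= 3361 / 250.
    by apply: (mul_le _ _ _ _ _ h2 h (mulr_ge0 r0 r0) r0); clear; lra.
  have h6 : (r * r * r) * (r * r * r) <= 723 / 4.
    by apply: (mul_le _ _ _ _ _ h3 h3 p3 p3); clear; lra.
  have : 430 <= 859 / 2 + 2 / 5 :> R.
    by rewrite -E; apply: (mul_le _ _ _ _ _ h6 h (mulr_ge0 p3 p3) r0); clear; lra.
  by clear; lra.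
have mul_ge (a b c d e : R) : a <= b -> c <= d -> 0 <= a -> 0 <= c ->
    e <= a * c -> e <= b * d.
  by move=> ab cd a0 c0 eac; exact: le_trans eac (ler_pM a0 c0 ab cd).
(* The same with rounding down, ending with r^7 >= 430.2. *)
have h2 : 707 / 125 <= r * r by apply: (mul_ge _ _ _ _ _ h h); clear; lra.
have h3 : 269 / 20 <= r * r * r by apply: (mul_ge _ _ _ _ _ h2 h); clear; lra.
have h6 : 1809 / 10 <= (r * r * r) * (r * r * r).
  by apply: (mul_ge _ _ _ _ _ h3 h3); clear; lra.
have : 2151 / 5 <= 430 :> R.
  by rewrite -E; apply: (mul_ge _ _ _ _ _ h6 h); clear; lra.
by clear; lra.
Qed.

Section GrowthRate.
Variable R : realType.
Let r : R := 430 `^ (7^-1).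

Let r7 : r ^+ 7 = 430.
Proof. by apply: powR_invnK; first exact: ler0n. Qed.

Lemma root7_bounds : 107 / 45 < r < 88 / 37.
Proof. by apply: seventh_root_bounds r7; exact: powR_ge0. Qed.

(** Writing n = 3 + m + 7k with m <= 6 and using r^7 = 430, the quotient of the bound by r^n is
    2^(m+1) / r^(3+m). It lies between 2 / 3^9 and 128 because 1 <= r <= 3. *)
Lemma lower_bound_growth n : (3 <= n)%N ->
  2 / 3 ^+ 9 * r ^+ n <= (lower_bound n)%:R <= 128 * r ^+ n.
Proof.
move=> n3; have /andP[rl ru] := root7_bounds.
have r1 : 1 <= r by lra.
have r3 : r <= 3 by lra.
set m := ((n - 3) %% 7)%N; set k := ((n - 3) %/ 7)%N.
have m6 : (m <= 6)%N by rewrite -ltnS ltn_mod.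
have rn : r ^+ n = r ^+ (3 + m) * 430 ^+ k.
  by rewrite -r7 -exprM -exprD -addnA [(m + _)%N]addnC mulnC -divn_eq subnKC.
have -> : (lower_bound n)%:R = 2 ^+ m * 2 * 430 ^+ k :> R.
  by rewrite /lower_bound !natrM !natrX.
have k0 : 0 < 430 ^+ k :> R by rewrite exprn_gt0 ?ltr0n.
rewrite rn {rn}.
have b1 : r ^+ (3 + m) <= 3 ^+ 9.
  apply: (@le_trans _ _ (3 ^+ (3 + m))); first by rewrite lerXn2r// nnegrE; lra.
  by rewrite ler_eXn2l; [lia|lra].
have b2 : 1 <= r ^+ (3 + m) by rewrite exprn_ege1.
have b3 : 1 <= 2 ^+ m :> R by rewrite exprn_ege1// ler1n.
have b4 : 2 ^+ m <= 64 :> R.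
  apply: (@le_trans _ _ (2 ^+ 6)); first by rewrite ler_eXn2l// ltr1n.
  by rewrite !exprS expr0; lra.
have t0 : 0 < 3 ^+ 9 :> R by rewrite exprn_gt0// ltr0n.
move: k0 b1 b2 b3 b4 t0; move: (r ^+ (3 + m)) (2 ^+ m) (3 ^+ 9) (430 ^+ k).
move=> x y t z z0 xt x1 y1 y64 t0.
rewrite !mulrA !(ler_pM2r z0); apply/andP; split; last by lra.
have : x / t <= 1 by rewrite ler_pdivrMr ?mul1r.
by rewrite -mulrA [t^-1 * x]mulrC; move: (x / t) => u; lra.
Qed.

End GrowthRate.

Theorem corollary1 (R : realType) :
  [/\ forall n : nat, (3 <= n)%N -> ((lower_bound n)%:R%:E <= r2 R n)%E,
      (fun n : nat => (lower_bound n)%:R : R^o)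
        =Theta_\oo (fun n : nat => (430 `^ (7^-1)) ^+ n : R^o) &
      `|430 `^ (7^-1) - 2378 / 1000| < 5 / 10000 :> R].
Proof.
split.
- exact: lower_bound_r2.
- rewrite eqThetaE qualifE; apply/asboolP.
  exists (2 / 3 ^+ 9, 128); first by rewrite /= divr_gt0 ?exprn_gt0 ?ltr0n.
  exists 3%N => // n /= n3; have /andP[l u] := lower_bound_growth R n3.
  have g0 : 0 <= (430 `^ (7^-1)) ^+ n :> R by rewrite exprn_ge0 ?powR_ge0.
  by rewrite (ger0_norm g0) (ger0_norm (ler0n _ _)).
- by have := root7_bounds R; rewrite ltr_norml; lra.
Qed.
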